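(* Assume that $x_{10},\dots,x_{N0}$ are mutually independent with common mean $\bar x_0$, that $\max_{1\le i\le N}\mathbb E\|x_{i0}\|^2<C_0$ with $C_0$ independent of $N$, that $\{x_{i0}\}$ and $\{W_i\}$ are independent of each other, and that $Q\ge0$. Let $P,K,s$ be determined on $[0,T]$ by $$\begin{aligned} \rho P&=\dot P+A^TP+PA-PBR^{-1}B^TP+Q,\quad P(T)=0,\\ \rho K&=\dot K+(A+G)^TK+K(A+G)-PBR^{-1}B^TK-KBR^{-1}B^TP\\ &\quad+G^TP+PG-KBR^{-1}B^TK-Q_\Gamma,\quad K(T)=0,\\ \rho s&=\dot s+[A+G-BR^{-1}B^T(P+K)]^Ts+(P+K)f-\bar\eta,\quad s(T)=0, \end{aligned}$$ let $\bar x$ be determined by $$\frac{d\bar x}{dt}=(A+G)\bar x-BR^{-1}B^T\big((P+K)\bar x+s\big)+f,\quad \bar x(0)=\bar x_0,$$ and consider the decentralized control laws $$\hat u_i(t)=-R^{-1}B^T\big(P(t)\hat x_i(t)+K(t)\bar x(t)+s(t)\big),\quad 0\le t\le T,\ i=1,\dots,N,$$ where $\hat x_i$ is the corresponding closed-loop state, $$d\hat x_i=\big[(A-BR^{-1}B^TP)\hat x_i-BR^{-1}B^T(K\bar x+s)+G\hat x^{(N)}+f\big]dt+\sigma dW_i,\quad \hat x_i(0)=x_{i0},\quad \hat x^{(N)}=\tfrac1N\sum_{j=1}^N\hat x_j.$$ Then $\hat u=(\hat u_1,\dots,\hat u_N)$ has asymptotic social optimality, i.e., as $N\to\infty$, $$\Big|\frac1NJ^{\rm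 F}_{\rm soc}(\hat u)-\frac1N\inf_{u\in L^2_{\mathcal F_t}(0,T;\mathbb R^{Nr})}J^{\rm F}_{\rm soc}(u)\Big|=O\Big(\frac1{\sqrt N}\Big).$$
   Context: $N$ is the number of agents, $T>0$ a finite horizon, $\rho>0$ a discount constant. $A,G,\Gamma,Q\in\mathbb R^{n\times n}$, $B\in\mathbb R^{n\times r}$, $R\in\mathbb R^{r\times r}$, $\eta\in\mathbb R^n$ are constant and do not depend on $N$, with $Q,R$ symmetric and $R>0$; $f,\sigma:[0,\infty)\to\mathbb R^n$ are continuous, independent of $N$, with $\int_0^\infty e^{-\rho t}(\|f\|^2+\|\sigma\|^2)dt<\infty$. $W_1,W_2,\dots$ are independent one-dimensional Brownian motions. Agent $i$ has state $x_i\in\mathbb R^n$ and control $u_i\in\mathbb R^r$ with $$dx_i=[Ax_i+Bu_i+Gx^{(N)}+f]dt+\sigma dW_i,\quad x_i(0)=x_{i0},\quad x^{(N)}=\tfrac1N\sum_{j=1}^Nx_j.$$ $\mathcal F_t=\sigma\big(\bigcup_{i=1}^N\mathcal F^i_t\big)$ with $\mathcal F^i_t=\sigma(x_{i0},W_i(s),0\le s\le t)$, and $L^2_{\mathcal F_t}(0,T;\mathbb R^k)$ is the space of $\mathcal F_t$-adapted $\mathbb R^k$-valued processes $z$ with $\mathbb E\int_0^T\|z(t)\|^2dt<\infty$; $u=(u_1,\dots,u_N)$ is identified with an $\mathbb R^{Nr}$-valued process. Costs (with $\|z\|_M^2=z^TMz$): $J^{\rm F}_i(u)=\mathbb E\int_0^Te^{-\rho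 t}\{\|x_i-\Gamma x^{(N)}-\eta\|_Q^2+\|u_i\|_R^2\}dt$ and $J^{\rm F}_{\rm soc}(u)=\sum_{i=1}^NJ^{\rm F}_i(u)$. Notation: $Q_\Gamma=\Gamma^TQ+Q\Gamma-\Gamma^TQ\Gamma$, $\bar\eta=Q\eta-\Gamma^TQ\eta$. *)

(* Defs.v *)
From HB Require Import structures.
From mathcomp Require Export all_boot all_order all_algebra.
From mathcomp Require Export all_classical all_reals all_analysis.
Export Order.TTheory GRing.Theory Num.Theory.
Export numFieldNormedType.Exports.

#[export] Set Implicit Arguments.
#[export] Unset Strict Implicit.
#[export] Unset Printing Implicit Defensive.

Local Open Scope classical_set_scope.
Local Open Scope ring_scope.

Definition quad (R : realType) (n : nat) (M : 'M[R]_n) (z : 'cV[R]_n) : R :=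
  (z^T *m M *m z) 0 0.

Definition sqnorm (R : realType) (n : nat) (z : 'cV[R]_n) : R :=
  \sum_(k < n) z k 0 ^+ 2.

Definition sym_mx (R : realType) (n : nat) (M : 'M[R]_n) : Prop := M^T = M.

Definition psd_mx (R : realType) (n : nat) (M : 'M[R]_n) : Prop :=
  forall z : 'cV[R]_n, 0 <= quad M z.

Definition pd_mx (R : realType) (n : nat) (M : 'M[R]_n) : Prop :=
  forall z : 'cV[R]_n, z != 0 -> 0 < quad M z.

Section SigmaAlgebras.
Context (d : measure_display) (Omega : measurableType d) (R : realType).
Context (Pr : probability Omega R).

Definition sigma_gen (D : set (Omega -> R)) : set (set Omega) :=
  <<s \bigcup_(X in D) preimage_set_system setT X measurable >>.

Definition coords (n : nat) (X : Omega -> 'cV[R]_n) : set (Omega -> R) :=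
  [set Y | exists k : 'I_n, Y = fun w => X w k 0].

Definition indep2 (F1 F2 : set (set Omega)) : Prop :=
  forall A B, F1 A -> F2 B -> Pr (A `&` B) = (Pr A * Pr B)%E.

Definition mutual_indep (I : choiceType) (F : I -> set (set Omega)) : Prop :=
  forall (J : seq I) (A : I -> set Omega),
    uniq J -> (forall i, i \in J -> F i (A i)) ->
    Pr (\bigcap_(i in [set` J]) A i) = (\prod_(i <- J) Pr (A i))%E.

Definition brownian_motion (W : R -> Omega -> R) : Prop :=
  [/\ forall t, 0 <= t -> measurable_fun setT (W t),
      {ae Pr, forall w, W 0 w = 0},
      {ae Pr, forall w, {within `[0, +oo[, continuous (fun t => W t w)}},
      forall s t, 0 <= s -> s < t ->
        indep2 (sigma_gen [set W t \- W s])
               (sigma_gen [set W v | v in `[0, s]]) &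
      forall s t, 0 <= s -> s < t -> forall B : set R, measurable B ->
        Pr ((W t \- W s) @^-1` B) = normal_prob 0 (Num.sqrt (t - s)) B].

(* A deterministic step integrand is a list of triples ((a, b), c), standing
   for the sum of the functions c * \1_]a, b]. *)
Definition step_ok (phi : seq (R * R * R)) : bool :=
  all (fun q => 0 <= q.1.1 <= q.1.2) phi.

Definition step_fun (phi : seq (R * R * R)) (t : R) : R :=
  \sum_(q <- phi) q.2 * \1_(`]q.1.1, q.1.2] : set R) t.

Definition step_integral (W : R -> Omega -> R) (phi : seq (R * R * R))
    (t : R) (w : Omega) : R :=
  \sum_(q <- phi) q.2 * (W (Num.min q.1.2 t) w - W (Num.min q.1.1 t) w).

(* Y t = \int_0^t g dW almost surely, for every t in [0, T]: the stochastic
   integral of a deterministic integrand (all that additive noise requires) is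
   the L^2(Pr)-limit of the integrals of step functions that converge to g in
   L^2(0, T). *)
Definition wiener_integral (T : R) (W : R -> Omega -> R) (g : R -> R)
    (Y : R -> Omega -> R) : Prop :=
  exists phi : nat -> seq (R * R * R),
  [/\ forall m, step_ok (phi m),
      (fun m => \int[lebesgue_measure]_(s in `[0%R, T])
                  ((step_fun (phi m) s - g s) ^+ 2)%:E)%E @ \oo --> 0%E &
      forall t, t \in `[0, T] ->
        (fun m => \int[Pr]_w
                    ((Y t w - step_integral W (phi m) t w) ^+ 2)%:E)%E @ \oo
          --> 0%E].

Definition measurable_process (n : nat) (T : R)
    (x : R -> Omega -> 'cV[R]_n) : Prop :=
  forall k : 'I_n,
    measurable_fun ((`[0, T] : set R) `*` (setT : set Omega))
      (fun p : R * Omega => x p.1 p.2 k 0).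

Definition adapted (n : nat) (T : R) (F : R -> set (set Omega))
    (x : R -> Omega -> 'cV[R]_n) : Prop :=
  forall t, t \in `[0, T] -> sigma_gen (coords (x t)) `<=` F t.

(* Strong solution on [0, T] of dx = b dt + sigma dW, x(0) = x0, where
   b t w is the value of the drift along the path. *)
Definition ito_solution (n : nat) (T : R) (F : R -> set (set Omega))
    (W : R -> Omega -> R) (x0 : Omega -> 'cV[R]_n)
    (b : R -> Omega -> 'cV[R]_n) (sigma : R -> 'cV[R]_n)
    (x : R -> Omega -> 'cV[R]_n) : Prop :=
  [/\ measurable_process T x,
      adapted T F x,
      {ae Pr, forall w, {within `[0, T], continuous (fun t => x t w)}} &
      forall k : 'I_n,
        wiener_integral T W (fun t => sigma t k 0)
          (fun t w => x t w k 0 - x0 w k 0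
             - \int[lebesgue_measure]_(s in `[0%R, t]) b s w k 0)].

(* Agents are numbered from 0; the N-agent system uses the first N terms of
   the sequences of initial states and of Brownian motions. *)
Definition agent_filtration (n : nat) (x0 : Omega -> 'cV[R]_n)
    (W : R -> Omega -> R) (t : R) : set (set Omega) :=
  sigma_gen (coords x0 `|` [set W s | s in `[0, t]]).

Definition joint_filtration (n : nat) (x0 : nat -> Omega -> 'cV[R]_n)
    (W : nat -> R -> Omega -> R) (N : nat) (t : R) : set (set Omega) :=
  <<s \bigcup_(i in [set i | (i < N)%N]) agent_filtration (x0 i) (W i) t >>.

(* The space L^2_F(0, T; R^(N r)), the elements of which are presented as
   N-tuples of R^r-valued processes. *)
Definition L2_control (r : nat) (T : R) (F : R -> set (set Omega)) (N : nat)
    (u : 'I_N -> R -> Omega -> 'cV[R]_r) : Prop :=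
  [/\ forall i, measurable_process T (u i),
      forall i, adapted T F (u i) &
      (\int[Pr]_w \int[lebesgue_measure]_(t in `[0%R, T])
          (\sum_(i < N) sqnorm (u i t w))%:E < +oo)%E].

Definition mean_field (n N : nat) (x : 'I_N -> R -> Omega -> 'cV[R]_n)
    (t : R) (w : Omega) : 'cV[R]_n :=
  N%:R^-1 *: \sum_(j < N) x j t w.

Definition is_state (n r : nat) (T : R) (A G : 'M[R]_n) (B : 'M[R]_(n, r))
    (f sigma : R -> 'cV[R]_n) (x0 : nat -> Omega -> 'cV[R]_n)
    (W : nat -> R -> Omega -> R) (N : nat)
    (u : 'I_N -> R -> Omega -> 'cV[R]_r)
    (x : 'I_N -> R -> Omega -> 'cV[R]_n) : Prop :=
  forall i : 'I_N,
    ito_solution T (joint_filtration x0 W N) (W i) (x0 i)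
      (fun t w => A *m x i t w + B *m u i t w + G *m mean_field x t w + f t)
      sigma (x i).

(* Rw is the weight of the control; for Q and Rw nonnegative the integrand is
   nonnegative, hence the cost is a well-defined element of [0, +oo]. *)
Definition agent_cost (n r : nat) (T rho : R) (Gam Q : 'M[R]_n)
    (Rw : 'M[R]_r) (eta : 'cV[R]_n) (N : nat)
    (x : 'I_N -> R -> Omega -> 'cV[R]_n)
    (u : 'I_N -> R -> Omega -> 'cV[R]_r) (i : 'I_N) : \bar R :=
  (\int[Pr]_w \int[lebesgue_measure]_(t in `[0%R, T])
     (expR (- (rho * t)) *
       (quad Q (x i t w - Gam *m mean_field x t w - eta)
        + quad Rw (u i t w)))%:E)%E.

(* The state x of a control u is unique up to indistinguishability, so for
   is_state u x this is the social cost of u. *)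
Definition social_cost (n r : nat) (T rho : R) (Gam Q : 'M[R]_n)
    (Rw : 'M[R]_r) (eta : 'cV[R]_n) (N : nat)
    (x : 'I_N -> R -> Omega -> 'cV[R]_n)
    (u : 'I_N -> R -> Omega -> 'cV[R]_r) : \bar R :=
  (\sum_(i < N) agent_cost T rho Gam Q Rw eta x u i)%E.

Definition social_optimum (n r : nat) (T rho : R) (A G Gam Q : 'M[R]_n)
    (B : 'M[R]_(n, r)) (Rw : 'M[R]_r) (eta : 'cV[R]_n)
    (f sigma : R -> 'cV[R]_n) (x0 : nat -> Omega -> 'cV[R]_n)
    (W : nat -> R -> Omega -> R) (N : nat) : \bar R :=
  ereal_inf [set J | exists (u : 'I_N -> R -> Omega -> 'cV[R]_r)
                            (x : 'I_N -> R -> Omega -> 'cV[R]_n),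
    [/\ L2_control T (joint_filtration x0 W N) u,
        is_state T A G B f sigma x0 W u x &
        J = social_cost T rho Gam Q Rw eta x u]].

End SigmaAlgebras.

Definition Q_Gamma (R : realType) (n : nat) (Gam Q : 'M[R]_n) : 'M[R]_n :=
  Gam^T *m Q + Q *m Gam - Gam^T *m Q *m Gam.

Definition eta_bar (R : realType) (n : nat) (Gam Q : 'M[R]_n)
    (eta : 'cV[R]_n) : 'cV[R]_n :=
  Q *m eta - Gam^T *m Q *m eta.

(* Main.v *)
Require Import Defs.
From mathcomp Require Import measurable_realfun ring lra.

(** Perturb the feedback solution: write [u = uhat + v] and [x = xhat + y] for an
    admissible competitor. The two stochastic integrals agree almost surely, so
    the noise cancels and [y] solves a pathwise linear equation driven by [v].
    The cost being quadratic, the difference of the costs is a cross term plus a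
    term that is at least [lam * exp (- rho T) * E \int \sum_i |v_i|^2].

    The costate [p_i = P xhat_i + K xbar + s] is dual to [y_i]: the integral of the
    derivative of [exp (- rho t) <p_i, y_i>] vanishes in the mean, because [y_i]
    starts at 0, [p_i] ends at 0 and the martingale part of [xhat_i] is orthogonal
    to the past-measurable rate of change of [y_i]. With the equations of [P], [K]
    and [s] (the first two having symmetric solutions, by uniqueness), the cross term
    collapses to [2 N E \int exp (- rho t) <Lam (xhat^(N) - xbar), y^(N)>] with
    [Lam = P G + G^T P - Q_Gamma].

    By Gronwall, [E \int |xhat^(N) - xbar|^2 = O(1/N)], as the initial states and the
    noises of distinct agents are uncorrelated, while
    [E \int |y^(N)|^2 <= C / N * E \int \sum_i |v_i|^2]. Young's inequality then absorbs
    the cross term: the social cost of [u] is at least that of [uhat] minus a constant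
    independent of [N]. The per-agent gap is thus even [O(1/N)]. *)

(** Two obstacles shape the development. A competitor's state comes with continuous paths and no
    moments, so Gronwall's inequality has to run in [[0, +oo]] along paths, and square integrability
    is its conclusion. And a Wiener integral is determined at each time only up to a null set
    depending on that time; path identities therefore hold almost surely for almost every [t], and
    whatever is applied to them (integration by parts, Gronwall, duality) has to tolerate
    exceptional times. Fubini takes the place of Itô's formula: the products involved consist of a
    deterministic primitive, a state and an absolutely continuous [y_i], so no quadratic covariation
    arises.

    The equations of [K] and [s] are exactly those under which the cross term would vanish if
    [xhat^(N)] were [xbar]; hence the factor [xhat^(N) - xbar] in what is left. The factor [N] in
    front of it meets a [1 / N] in each term of Young's inequality, one from uncorrelated noise and
    one from averaging the response, so that the parameter of that inequality and the remaining
    constant can be fixed before [N]. *)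

Local Open Scope classical_set_scope.
Local Open Scope ring_scope.

(** * Square integrable functions *)

Section sqint.
Context d (T : measurableType d) (R : realType) (mu : {measure set T -> \bar R}).
Implicit Types (D : set T) (f g : T -> R).

(** Finiteness is asked of the extended integral of the square, so that membership can come out of
    an inequality in [[0, +oo]], which is how Gronwall's lemma delivers it. *)
Definition sqint D f :=
  measurable_fun D f /\ (\int[mu]_(x in D) (f x ^+ 2)%:E < +oo)%E.

Lemma sqint_meas D f : sqint D f -> measurable_fun D f.
Proof. by case. Qed.

Lemma sqint_sqr D f : measurable D -> sqint D f ->
  mu.-integrable D (fun x => (f x ^+ 2)%:E).
Proof.
move=> mD [mf foo]; apply/integrableP; split.
  by apply/measurable_EFinP; exact: measurable_funX.
by under eq_integral do rewrite gee0_abs ?lee_fin ?sqr_ge0//.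
Qed.

Lemma sqint_mul D f g : measurable D -> sqint D f -> sqint D g ->
  mu.-integrable D (fun x => (f x * g x)%:E).
Proof.
move=> mD sf sg.
apply: (@le_integrable _ _ _ mu D mD _ (fun x => (f x ^+ 2)%:E + (g x ^+ 2)%:E)%E).
- by apply/measurable_EFinP; apply: measurable_funM; apply: sqint_meas.
- move=> x Dx; rewrite -EFinD !abse_EFin lee_fin [leRHS]ger0_norm; last first.
    by rewrite addr_ge0 ?sqr_ge0.
  by rewrite ler_norml; apply/andP; split; nra.
- by apply: integrableD => //; exact: sqint_sqr.
Qed.

Lemma sqint_le D f g (c : R) : measurable D -> measurable_fun D f -> 0 <= c ->
  (forall x, D x -> f x ^+ 2 <= c * g x ^+ 2) -> sqint D g -> sqint D f.
Proof.
move=> mD mf c0 fg sg; split => //.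
apply: (@le_lt_trans _ _ (\int[mu]_(x in D) (c%:E * (g x ^+ 2)%:E))%E).
  apply: ge0_le_integral => //.
  - by move=> x _; rewrite lee_fin sqr_ge0.
  - by apply/measurable_EFinP; exact: measurable_funX.
  - apply: measurable_funeM; apply/measurable_EFinP; apply: measurable_funX.
    exact: sg.1.
rewrite ge0_integralZl//.
- by rewrite lte_mul_pinfty//; exact: sg.2.
- by apply/measurable_EFinP; apply: measurable_funX; exact: sg.1.
- by move=> x _; rewrite lee_fin sqr_ge0.
Qed.

Lemma sqintM D (h f : T -> R) (c : R) : measurable D -> measurable_fun D h ->
  (forall x, D x -> `|h x| <= c) -> sqint D f -> sqint D (fun x => h x * f x).
Proof.
move=> mD mh hc sf; apply: (@sqint_le _ _ f (c ^+ 2)) => //.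
- by apply: measurable_funM => //; exact: sf.1.
- exact: sqr_ge0.
- move=> x Dx; rewrite exprMn ler_wpM2r ?sqr_ge0// -(real_normK (num_real (h x))).
  by rewrite ler_sqr ?nnegrE// ?hc// (le_trans (normr_ge0 (h x))) ?hc.
Qed.

Lemma sqintZ D (k : R) f : measurable D -> sqint D f -> sqint D (fun x => k * f x).
Proof. by move=> mD; apply: (@sqintM _ (fun=> k) f `|k|). Qed.

Lemma sqintD D f g : measurable D -> sqint D f -> sqint D g ->
  sqint D (fun x => f x + g x).
Proof.
move=> mD sf sg; split; first by apply: measurable_funD; [exact: sf.1|exact: sg.1].
have sz h : sqint D h -> mu.-integrable D (fun x => (2%:E * (h x ^+ 2)%:E)%E).
  by move=> sh; apply: integrableZl => //; apply: sqint_sqr.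
have ih := integrableD mD (sz _ sf) (sz _ sg).
apply: le_lt_trans (integrable_lty mD ih).
apply: ge0_le_integral => //.
- by move=> x _; rewrite lee_fin sqr_ge0.
- apply/measurable_EFinP; apply: measurable_funX; apply: measurable_funD.
    exact: sf.1.
  exact: sg.1.
- exact: measurable_int ih.
- move=> x _; rewrite -!EFinM -EFinD lee_fin; have := sqr_ge0 (f x - g x); nra.
Qed.

Lemma sqintN D f : measurable D -> sqint D f -> sqint D (fun x => - f x).
Proof.
move=> mD sf; have := @sqintZ _ (-1) _ mD sf.
by under [X in sqint _ X -> _]eq_fun do rewrite mulN1r.
Qed.

Lemma sqintB D f g : measurable D -> sqint D f -> sqint D g ->
  sqint D (fun x => f x - g x).
Proof. by move=> mD sf sg; apply: sqintD => //; exact: sqintN. Qed.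

Lemma sqint0 D : measurable D -> sqint D (fun=> 0).
Proof.
move=> mD; split; first exact: measurable_cst.
by under eq_integral do rewrite expr0n/=; rewrite integral0.
Qed.

Lemma sqint_sum D (I : Type) (s : seq I) (P : pred I) (F : I -> T -> R) :
  measurable D -> (forall i, P i -> sqint D (F i)) ->
  sqint D (fun x => \sum_(i <- s | P i) F i x).
Proof.
move=> mD sF; elim: s => [|i s ih].
  by under eq_fun do rewrite big_nil; exact: sqint0.
have [Pi|nPi] := boolP (P i); last by under eq_fun do rewrite big_cons (negbTE nPi).
under eq_fun do rewrite big_cons Pi.
by apply: sqintD => //; exact: sF.
Qed.

Lemma sqintS D E f : measurable D -> measurable E -> E `<=` D ->
  sqint D f -> sqint E f.
Proof.
move=> mD mE ED [mf foo]; split; first exact: measurable_funS mf.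
apply: le_lt_trans foo; apply: ge0_subset_integral => //.
- by apply/measurable_EFinP; exact: measurable_funX.
- by move=> x _; rewrite lee_fin sqr_ge0.
Qed.

Lemma sqint_bounded D f (c : R) : measurable D -> (mu D < +oo)%E ->
  measurable_fun D f -> (forall x, D x -> `|f x| <= c) -> sqint D f.
Proof.
move=> mD Doo mf fc; suff : sqint D (fun x => f x * 1).
  by under [X in sqint _ X -> _]eq_fun do rewrite mulr1.
apply: (@sqintM _ f (fun=> 1) c) => //; split; first exact: measurable_cst.
under eq_integral do rewrite expr1n; rewrite integral_cst// mul1e//.
Qed.

Lemma sqint_cst D (k : R) : measurable D -> (mu D < +oo)%E -> sqint D (fun=> k).
Proof. by move=> mD Doo; apply: (@sqint_bounded _ _ `|k|). Qed.

Lemma sqint_integrable D f : measurable D -> (mu D < +oo)%E -> sqint D f ->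
  mu.-integrable D (fun x => (f x)%:E).
Proof.
move=> mD Doo sf; have := sqint_mul mD sf (sqint_cst 1 mD Doo).
by under [X in integrable _ _ X -> _]eq_fun do rewrite mulr1.
Qed.

Lemma eq_sqint D f g : (forall x, D x -> f x = g x) -> sqint D f -> sqint D g.
Proof.
move=> fg [mf foo]; split.
  by apply: eq_measurable_fun mf => x /set_mem; exact: fg.
by under eq_integral => x /set_mem Dx do rewrite -(fg x Dx).
Qed.

Lemma ge0_integrable_lty D f : measurable_fun D f -> (forall x, D x -> 0 <= f x) ->
  (\int[mu]_(x in D) (f x)%:E < +oo)%E -> mu.-integrable D (fun x => (f x)%:E).
Proof.
move=> mf f0 foo; apply/integrableP; split; first exact/measurable_EFinP.
by under eq_integral => x /set_mem Dx do rewrite gee0_abs ?lee_fin ?f0//.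
Qed.

End sqint.

Lemma fine_eq_fin_num (R : realType) (x y : \bar R) :
  x \is a fin_num -> y \is a fin_num -> fine x = fine y -> x = y.
Proof. by move=> xf yf xy; rewrite -(fineK xf) -(fineK yf) xy. Qed.

(** * Fubini on the strip [[0, T] x Omega] *)

Section strip.
Context d (Omega : measurableType d) (R : realType) (Pr : probability Omega R).
Variable T : R.
Notation Rm := (measurableTypeR R).
Notation leb := (@lebesgue_measure R).
Notation mu := (leb \x Pr)%E.
Notation IT := (`[0%R, T]%classic : set Rm).

Definition strip : set (Rm * Omega) := IT `*` setT.

Lemma measurable_strip : measurable strip.
Proof. exact: measurableX. Qed.
Local Hint Resolve measurable_strip : core.

Lemma lebesgue_itv0_lty : (leb IT < +oo)%E.
Proof. by rewrite lebesgue_measure_itv/=; case: ifP => //; rewrite ltry. Qed.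

Lemma strip_patch (F : Rm * Omega -> \bar R) t w :
  (F \_ strip) (t, w) = ((fun t => F (t, w)) \_ IT) t.
Proof.
rewrite !patchE; have [tI|tI] := boolP (t \in IT).
  by rewrite mem_set//; split => //=; exact: set_mem.
by rewrite memNset// => -[/= tI' _]; case/negP: tI; exact/mem_set.
Qed.

Lemma measurable_strip_time d' (rT : measurableType d')
  (F : Rm * Omega -> rT) w :
  measurable_fun strip F -> measurable_fun IT (fun t => F (t, w)).
Proof.
move=> mF; apply: (measurable_comp (F := strip)) => //.
- by move=> _ [t tI <-]; split.
- exact: (measurable_funTS (pair2_measurable w)).
Qed.

Lemma measurable_strip_omega d' (rT : measurableType d')
  (F : Rm * Omega -> rT) t : IT t ->
  measurable_fun strip F -> measurable_fun setT (fun w => F (t, w)).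
Proof.
move=> tI mF; apply: (measurable_comp (F := strip)) => //.
by move=> _ [w _ <-]; split.
Qed.

Lemma measurable_strip_cut (F : Rm * Omega -> \bar R) :
  measurable_fun strip F -> measurable_fun setT (F \_ strip).
Proof. by move/(measurable_restrictT _ measurable_strip). Qed.

Lemma strip_tonelli_time (F : Rm * Omega -> \bar R) :
  measurable_fun strip F -> (forall p, strip p -> 0 <= F p)%E ->
  (\int[mu]_(p in strip) F p = \int[leb]_(t in IT) \int[Pr]_w F (t, w))%E.
Proof.
move=> mF F0; rewrite integral_mkcond fubini_tonelli1//; last 2 first.
- exact: measurable_strip_cut.
- by move=> p; apply: erestrict_ge0.
rewrite [RHS]integral_mkcond; apply: eq_integral => t _.
rewrite /fubini_F patchE; under eq_integral do rewrite strip_patch patchE.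
by case: ifP => // _; rewrite integral0.
Qed.

Lemma strip_tonelli_omega (F : Rm * Omega -> \bar R) :
  measurable_fun strip F -> (forall p, strip p -> 0 <= F p)%E ->
  (\int[mu]_(p in strip) F p = \int[Pr]_w \int[leb]_(t in IT) F (t, w))%E.
Proof.
move=> mF F0; rewrite integral_mkcond fubini_tonelli2//; last 2 first.
- exact: measurable_strip_cut.
- by move=> p; apply: erestrict_ge0.
apply: eq_integral => w _; rewrite /fubini_G [RHS]integral_mkcond.
by apply: eq_integral => t _; rewrite strip_patch.
Qed.

Lemma measurable_strip_int_omega (F : Rm * Omega -> \bar R) :
  measurable_fun strip F -> (forall p, strip p -> 0 <= F p)%E ->
  measurable_fun setT (fun w => \int[leb]_(t in IT) F (t, w))%E.
Proof.
move=> mF F0.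
have := @measurable_fun_fubini_tonelli_G _ _ _ _ _ leb (F \_ strip)
  (measurable_strip_cut mF) (erestrict_ge0 F0).
apply: eq_measurable_fun => w _; rewrite /fubini_G [RHS]integral_mkcond.
by apply: eq_integral => t _; rewrite strip_patch.
Qed.

Lemma measurable_strip_int_time (F : Rm * Omega -> \bar R) :
  measurable_fun strip F -> (forall p, strip p -> 0 <= F p)%E ->
  measurable_fun IT (fun t => \int[Pr]_w F (t, w))%E.
Proof.
move=> mF F0.
have := @measurable_fun_fubini_tonelli_F _ _ _ _ _ Pr (F \_ strip)
  (measurable_strip_cut mF) (erestrict_ge0 F0).
move/(measurable_funTS (D := IT)).
apply: eq_measurable_fun => t tI; rewrite /fubini_F.
by apply: eq_integral => w _; rewrite strip_patch patchE tI.
Qed.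

Lemma integrable_strip_cut (f : Rm * Omega -> R) :
  mu.-integrable strip (fun p => (f p)%:E) ->
  mu.-integrable setT ((fun p => (f p)%:E) \_ strip).
Proof. exact: (integrable_mkcond _ measurable_strip).1. Qed.

Lemma ae_integrable_path (f : Rm * Omega -> R) :
  mu.-integrable strip (fun p => (f p)%:E) ->
  {ae Pr, forall w, leb.-integrable IT (fun t => (f (t, w))%:E)}.
Proof.
move/integrable_strip_cut/ae_integrable2; apply: filterS => w.
under eq_fun do rewrite strip_patch.
by move=> h; apply/integrable_mkcond.
Qed.

Lemma ae_integrable_time (f : Rm * Omega -> R) :
  mu.-integrable strip (fun p => (f p)%:E) ->
  {ae leb, forall t, IT t -> Pr.-integrable setT (fun w => (f (t, w))%:E)}.
Proof.
move/integrable_strip_cut/ae_integrable1; apply: filterS => t + tI.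
under eq_fun do rewrite strip_patch patchE mem_set//.
by [].
Qed.

(** Fubini with [Pr] outermost: this is how an identity known along almost every path becomes one in
    the mean. Real-valued integrals send infinities to 0, so equality of the extended inner
    integrals is recovered from their almost sure finiteness. *)
Lemma strip_eq_path (f g : Rm * Omega -> R) :
  mu.-integrable strip (fun p => (f p)%:E) ->
  mu.-integrable strip (fun p => (g p)%:E) ->
  {ae Pr, forall w, \int[leb]_(t in IT) f (t, w) = \int[leb]_(t in IT) g (t, w)} ->
  \int[mu]_(p in strip) f p = \int[mu]_(p in strip) g p.
Proof.
move=> If Ig fg; congr fine; rewrite integral_mkcond [RHS]integral_mkcond.
rewrite -!integral21_prod_meas1; [|exact: integrable_strip_cut..].
apply: ae_eq_integral => //.
- exact: (measurable_fubini_G (integrable_strip_cut If)).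
- exact: (measurable_fubini_G (integrable_strip_cut Ig)).
- near=> w => _; rewrite /fubini_G.
  under eq_integral do rewrite strip_patch.
  under [RHS]eq_integral do rewrite strip_patch.
  rewrite -integral_mkcond -[RHS]integral_mkcond; apply: fine_eq_fin_num.
  + by apply: integrable_fin_num => //; near: w; exact: ae_integrable_path.
  + by apply: integrable_fin_num => //; near: w; exact: ae_integrable_path.
  + by near: w.
Unshelve. all: by end_near. Qed.

(** The other order of Fubini: means have to agree at almost every time only. It serves to replace
    the martingale at time [t] by its terminal value. *)
Lemma strip_eq_time (f g : Rm * Omega -> R) :
  mu.-integrable strip (fun p => (f p)%:E) ->
  mu.-integrable strip (fun p => (g p)%:E) ->
  {ae leb, forall t, IT t -> \int[Pr]_w f (t, w) = \int[Pr]_w g (t, w)} ->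
  \int[mu]_(p in strip) f p = \int[mu]_(p in strip) g p.
Proof.
move=> If Ig fg; congr fine; rewrite integral_mkcond [RHS]integral_mkcond.
rewrite -!integral12_prod_meas1; [|exact: integrable_strip_cut..].
apply: ae_eq_integral => //.
- exact: (measurable_fubini_F (integrable_strip_cut If)).
- exact: (measurable_fubini_F (integrable_strip_cut Ig)).
- near=> t => _; rewrite /fubini_F.
  under eq_integral do rewrite strip_patch patchE.
  under [RHS]eq_integral do rewrite strip_patch patchE.
  have [/set_mem tI|//] := boolP (t \in IT); apply: fine_eq_fin_num.
  + apply: integrable_fin_num => //; move: (tI); near: t.
    exact: ae_integrable_time.
  + apply: integrable_fin_num => //; move: (tI); near: t.
    exact: ae_integrable_time.
  + by move: (tI); near: t.
Unshelve. all: by end_near. Qed.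

(** Null sets depending on the uncountable parameter [t] are merged by Tonelli applied to [|f|]: its
    integral over the strip vanishes when computed one way, hence when computed the other way. Joint
    measurability does the work that continuity in [t] would do. *)
Lemma strip_ae_path (f : Rm * Omega -> R) : measurable_fun strip f ->
  (forall t, IT t -> {ae Pr, forall w, f (t, w) = 0}) ->
  {ae Pr, forall w, {ae leb, forall t, IT t -> f (t, w) = 0}}.
Proof.
move=> mf f0.
have ma : measurable_fun strip (fun p => `|(f p)%:E|)%E.
  by apply: measurableT_comp => //; exact/measurable_EFinP.
have : (\int[mu]_(p in strip) `|(f p)%:E| = 0)%E.
  rewrite strip_tonelli_time//; apply: integral0_eq => t tI; have ft := f0 _ tI.
  rewrite (ae_eq_integral (cst 0%E))//; first by rewrite integral0.
  - exact: (measurable_strip_omega tI ma).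
  - by apply: filterS ft => w -> _; rewrite abse0.
rewrite strip_tonelli_omega// => h.
have : ae_eq Pr setT (fun w => \int[leb]_(t in IT) `|(f (t, w))%:E|)%E (cst 0%E).
  apply/ae_eq_integral_abs => //.
    exact: (measurable_strip_int_omega ma).
  under eq_integral do rewrite gee0_abs ?integral_ge0//.
  exact: h.
apply: filterS => w /(_ I)/= hw.
have : ae_eq leb IT (fun t => (f (t, w))%:E) (cst 0%E).
  apply/ae_eq_integral_abs => //.
  by apply/measurable_EFinP; exact: (measurable_strip_time (F := f)).
by apply: filterS => t ht /ht [].
Qed.

Lemma sqint_path (f : Rm * Omega -> R) : sqint mu strip f ->
  {ae Pr, forall w, sqint leb IT (fun t => f (t, w))}.
Proof.
move=> sf; have := ae_integrable_path (sqint_sqr measurable_strip sf).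
apply: filterS => w h; split; first exact: (measurable_strip_time (F := f) _ sf.1).
exact: integrable_lty h.
Qed.

Lemma sqint_time (f : Rm * Omega -> R) : sqint mu strip f ->
  {ae leb, forall t, IT t -> sqint Pr setT (fun w => f (t, w))}.
Proof.
move=> sf; have := ae_integrable_time (sqint_sqr measurable_strip sf).
apply: filterS => t + tI => /(_ tI) h; split.
  exact: (measurable_strip_omega (F := f) tI sf.1).
exact: integrable_lty h.
Qed.

Lemma strip_sq_le (f : Rm * Omega -> R) (c : \bar R) : measurable_fun strip f ->
  (forall t, IT t -> \int[Pr]_w (f (t, w) ^+ 2)%:E <= c)%E -> (0 <= c)%E ->
  (\int[mu]_(p in strip) (f p ^+ 2)%:E <= c * leb IT)%E.
Proof.
move=> mf fc c0.
have m2 : measurable_fun strip (fun p => (f p ^+ 2)%:E).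
  by apply/measurable_EFinP; exact: measurable_funX.
have p2 p : strip p -> (0 <= (f p ^+ 2)%:E)%E by rewrite lee_fin sqr_ge0.
rewrite strip_tonelli_time// -integral_cst//.
apply: ge0_le_integral => //.
- by move=> t _; apply: integral_ge0 => w _; rewrite lee_fin sqr_ge0.
- by apply: (measurable_strip_int_time (F := fun p => (f p ^+ 2)%:E)).
Qed.

Lemma sqint_strip_omega (X : Omega -> R) : sqint Pr setT X ->
  sqint mu strip (fun p => X p.2).
Proof.
move=> [mX Xoo].
have m : measurable_fun strip (fun p : Rm * Omega => X p.2).
  by apply: measurable_funTS; exact: measurableT_comp.
split => //; have c0 : (0 <= \int[Pr]_w (X w ^+ 2)%:E)%E.
  by apply: integral_ge0 => w _; rewrite lee_fin sqr_ge0.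
apply: le_lt_trans (strip_sq_le m _ c0) _; first by move=> t _; exact: lexx.
rewrite lte_mul_pinfty ?lebesgue_itv0_lty//.
by rewrite ge0_fin_numE.
Qed.

Lemma measurable_strip_det d' (rT : measurableType d') (g : R -> rT) :
  measurable_fun IT g -> measurable_fun strip (fun p => g p.1).
Proof.
move=> mg; apply: (measurable_comp (F := IT)) => //; first by move=> _ [p [? ?] <-].
exact: measurable_funTS.
Qed.

Lemma strip_measure_lty : (mu strip < +oo)%E.
Proof.
rewrite product_measure1E// lte_mul_pinfty//.
  by rewrite ge0_fin_numE// lebesgue_itv0_lty.
by rewrite [X in (X < _)%E]probability_setT ltry.
Qed.

(** The constraint [s <= t] is moved into the integrand, so that the primitive is a section integral
    of one jointly measurable kernel. Its positive and negative parts are treated separately, since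
    Tonelli's measurability statement concerns nonnegative functions. *)
Lemma measurable_strip_primitive (b : Rm * Omega -> R) : measurable_fun strip b ->
  measurable_fun strip (fun p => \int[leb]_(s in `[0, p.1]) b (s, p.2)).
Proof.
move=> mb; set h := fun q : R * (Rm * Omega) =>
  (((b \_ strip) (q.1, q.2.2) * (q.1 <= q.2.1)%R%:R)%:E : \bar R).
have mh : measurable_fun setT h.
  apply/measurable_EFinP; apply: measurable_funM.
    apply: (measurableT_comp (f := b \_ strip)).
      exact/(measurable_restrictT _ measurable_strip).
    apply: measurable_fun_pair => //.
    by apply: measurableT_comp => //; exact: measurable_snd.
  apply: (measurableT_comp (f := fun c : bool => (c%:R : R))) => //.
  apply: measurable_fun_ler => //.
  by apply: measurableT_comp => //; exact: measurable_fst.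
have mG : measurable_fun setT (fun p : Rm * Omega => \int[leb]_s h (s, p))%E.
  have -> : (fun p : Rm * Omega => \int[leb]_s h (s, p))%E =
    ((fun p => \int[leb]_s (h^\+)%E (s, p)) \- (fun p => \int[leb]_s (h^\-)%E (s, p)))%E.
    apply/funext => p /=; rewrite [LHS]integralE; congr (_ - _)%E.
    - by under eq_integral do rewrite funepos_comp/=.
    - by under eq_integral do rewrite funeneg_comp/=.
  apply: emeasurable_funB; apply: measurable_fun_fubini_tonelli_G => //.
  - exact: measurable_funepos.
  - exact: measurable_funeneg.
have : measurable_fun strip (fun p : Rm * Omega => fine (\int[leb]_s h (s, p))%E).
  apply: measurableT_comp; first exact: fine_measurable.
  exact: measurable_funTS.
apply: eq_measurable_fun => -[t w] /set_mem[/= tI _]; congr fine.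
rewrite [RHS]integral_mkcond; apply: eq_integral => s _.
rewrite /h/= /patch; move: tI; rewrite in_itv/= => /andP[t0 tT].
case: ifPn => [/set_mem[/= sI _]|nI].
  rewrite mem_setE in_itv/=; move: sI; rewrite in_itv/= => /andP[-> sT]/=.
  by case: (s <= t); rewrite ?mulr1 ?mulr0.
rewrite mul0r; case: ifPn => //; rewrite mem_setE in_itv/= => /andP[s0 st].
case/negP: nI; apply/mem_set; split => //=.
by rewrite in_itv/= s0/= (le_trans st).
Qed.

End strip.

(** * Cauchy-Schwarz, integration by parts and Gronwall *)

Lemma discriminant_le (R : realFieldType) (a b c : R) : 0 <= c ->
  (forall x, 0 <= a - x * b *+ 2 + x ^+ 2 * c) -> b ^+ 2 <= a * c.
Proof.
move=> c0 h; have [c00|cN0] := eqVneq c 0.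
  rewrite c00 mulr0; have [->|b0] := eqVneq b 0; first by rewrite expr0n.
  (* Value of [x] at which the affine expression [a - 2 x b] equals -1. *)
  have := h ((a + 1) / (b *+ 2)); rewrite c00 mulr0 addr0 -mulrnAr divfK.
    lra.
  by rewrite mulrn_eq0/=.
have cp : 0 < c by rewrite lt_def cN0.
have := h (b / c) => /(mulr_ge0 c0).
have -> : c * (a - b / c * b *+ 2 + (b / c) ^+ 2 * c) = a * c - b ^+ 2 by field.
by rewrite subr_ge0.
Qed.

Section cauchy_schwarz.
Context d (T : measurableType d) (R : realType) (mu : {measure set T -> \bar R}).

Lemma Rintegral_Cauchy_Schwarz (D : set T) (f g : T -> R) : measurable D ->
  sqint mu D f -> sqint mu D g ->
  (\int[mu]_(x in D) (f x * g x)) ^+ 2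
  <= (\int[mu]_(x in D) (f x ^+ 2)) * \int[mu]_(x in D) (g x ^+ 2).
Proof.
move=> mD sf sg; apply: discriminant_le.
  by apply: Rintegral_ge0 => x _; exact: sqr_ge0.
move=> k.
have ifg := sqint_mul mD sf sg.
have if2 := sqint_sqr mD sf; have ig2 := sqint_sqr mD sg.
have ik : mu.-integrable D (EFin \o (fun x => (- (k *+ 2)) * (f x * g x))).
  exact: (integrableZl mD _ ifg).
have ik2 : mu.-integrable D (EFin \o (fun x => k ^+ 2 * (g x ^+ 2))).
  exact: (integrableZl mD _ ig2).
have -> : \int[mu]_(x in D) (f x ^+ 2) - k * \int[mu]_(x in D) (f x * g x) *+ 2
   + k ^+ 2 * \int[mu]_(x in D) (g x ^+ 2) = \int[mu]_(x in D) ((f x - k * g x) ^+ 2).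
  transitivity (\int[mu]_(x in D)
     ((f x ^+ 2 + (- (k *+ 2)) * (f x * g x)) + k ^+ 2 * (g x ^+ 2))).
    rewrite RintegralD//; last exact: (integrableD mD if2 ik).
    rewrite RintegralD// !RintegralZl//; ring.
  by apply: eq_Rintegral => x _; ring.
by apply: Rintegral_ge0 => x _; exact: sqr_ge0.
Qed.

Lemma Rintegral_sqr_le (D : set T) (f : T -> R) : measurable D ->
  (mu D < +oo)%E -> sqint mu D f ->
  (\int[mu]_(x in D) f x) ^+ 2 <= fine (mu D) * \int[mu]_(x in D) (f x ^+ 2).
Proof.
move=> mD Doo sf; have := Rintegral_Cauchy_Schwarz mD (sqint_cst 1 mD Doo) sf.
under eq_Rintegral do rewrite mul1r.
by under [X in _ <= X * _]eq_Rintegral do rewrite expr1n; rewrite Rintegral_cst// mul1r.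
Qed.

End cauchy_schwarz.

Section calculus.
Context (R : realType).
Notation Rm := (measurableTypeR R).
Notation leb := (@lebesgue_measure R).
Implicit Types (T t : R) (f g : Rm -> R).

Lemma integrable_prim T t f : t <= T ->
  leb.-integrable `[0, T] (EFin \o f) -> leb.-integrable `[0, t] (EFin \o f).
Proof.
by move=> tT; apply: integrableS => //; apply: subset_itvl; rewrite bnd_simp.
Qed.

(** The product of the two integrals is the integral of [f s * g r] over the square; cutting the
    square along its diagonal gives the two terms. Both functions are merely integrable, as drifts
    of processes are, so their primitives are merely absolutely continuous. *)
Lemma Rintegral_prim_by_parts T f g :
  leb.-integrable `[0, T] (EFin \o f) -> leb.-integrable `[0, T] (EFin \o g) ->
  [/\ leb.-integrable `[0, T] (EFin \o (fun s => f s * \int[leb]_(r in `[0, s]) g r)),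
      leb.-integrable `[0, T] (EFin \o (fun s => g s * \int[leb]_(r in `[0, s]) f r)) &
  \int[leb]_(s in `[0, T]) (f s * \int[leb]_(r in `[0, s]) g r) +
  \int[leb]_(s in `[0, T]) (g s * \int[leb]_(r in `[0, s]) f r) =
  (\int[leb]_(s in `[0, T]) f s) * \int[leb]_(s in `[0, T]) g s].
Proof.
move=> If Ig; set IT := (`[0, T]%classic : set Rm).
have mIT : measurable IT by exact: measurable_itv.
pose f' : Rm -> R := f \_ IT; pose g' : Rm -> R := g \_ IT.
have If' : leb.-integrable setT (EFin \o f').
  by rewrite /f' -restrict_EFin; exact: (integrable_mkcond _ mIT).1.
have Ig' : leb.-integrable setT (EFin \o g').
  by rewrite /g' -restrict_EFin; exact: (integrable_mkcond _ mIT).1.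
have mf' : measurable_fun setT f' by apply/measurable_EFinP; exact: measurable_int If'.
have mg' : measurable_fun setT g' by apply/measurable_EFinP; exact: measurable_int Ig'.
pose H (p : Rm * Rm) : R := f' p.1 * g' p.2.
have mH : measurable_fun setT H.
  by apply: measurable_funM; apply: measurableT_comp.
have IH : (leb \x leb)%E.-integrable setT (EFin \o H).
  apply/integrable12ltyP; first exact/measurable_EFinP.
  rewrite (eq_integral (fun x => `|f' x|%:E * \int[leb]_y `|g' y|%:E)%E); last first.
    move=> x _; rewrite /H/=; under eq_integral do rewrite normrM EFinM.
    rewrite ge0_integralZl//; apply: measurableT_comp => //.
    by apply: measurableT_comp.
  have /integrableP[_ /=foo] := If'; have /integrableP[_ /=goo] := Ig'.
  rewrite ge0_integralZr//; last 2 first.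
  - by apply/measurable_EFinP; apply: measurableT_comp.
  - by apply: integral_ge0.
  by rewrite lte_mul_pinfty ?integral_ge0// ge0_fin_numE ?integral_ge0.
(* The diagonal goes to the first triangle alone, so that the two indicators add up to 1. *)
pose H1 (p : Rm * Rm) : R := H p * (p.2 <= p.1)%R%:R.
pose H2 (p : Rm * Rm) : R := H p * (p.1 < p.2)%R%:R.
have mH1 : measurable_fun setT H1.
  apply: measurable_funM => //.
  apply: (measurableT_comp (f := fun c : bool => (c%:R : R))) => //.
  by apply: measurable_fun_ler.
have mH2 : measurable_fun setT H2.
  apply: measurable_funM => //.
  apply: (measurableT_comp (f := fun c : bool => (c%:R : R))) => //.
  by apply: measurable_fun_ltr.
have IH1 : (leb \x leb)%E.-integrable setT (EFin \o H1).
  apply: le_integrable IH => //; first exact/measurable_EFinP.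
  move=> p _; rewrite lee_fin normrM ler_piMr//.
  by case: (p.2 <= p.1)%R; rewrite ?normr0 ?normr1.
have IH2 : (leb \x leb)%E.-integrable setT (EFin \o H2).
  apply: le_integrable IH => //; first exact/measurable_EFinP.
  move=> p _; rewrite lee_fin normrM ler_piMr//.
  by case: (p.1 < p.2)%R; rewrite ?normr0 ?normr1.
have E1 : fubini_F leb (EFin \o H1) =
    ((EFin \o (fun s => f s * \int[leb]_(r in `[0, s]) g r)) \_ IT).
  apply/funext => s; rewrite /fubini_F patchE; case: ifPn => [sI|sI]; last first.
    rewrite integral0_eq// => r _; rewrite /= /H1 /H/= /f' patchE (negbTE sI).
    by rewrite !mul0r.
  have sI2 := set_mem sI; move: (sI2); rewrite /IT/= in_itv/= => /andP[s0 sT].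
  transitivity (\int[leb]_(r in `[0%R, s]) ((f s)%:E * (g r)%:E))%E.
    rewrite [RHS]integral_mkcond; apply: eq_integral => r _.
    rewrite /= /H1 /H/= /f' /g' !patchE sI.
    rewrite /IT !mem_setE !in_itv/=.
    have [rs|rs] := leP r s; last by rewrite mulr0 andbF.
    by rewrite mulr1 andbT (le_trans rs sT) andbT; case: ifP => //; rewrite mulr0.
  rewrite integralZl//; last exact: integrable_prim Ig.
  rewrite /= EFinM; congr (_ * _)%E; rewrite /Rintegral fineK//.
  by apply: integrable_fin_num => //; exact: integrable_prim Ig.
have E2 : fubini_G leb (EFin \o H2) =
    ((EFin \o (fun s => g s * \int[leb]_(r in `[0, s]) f r)) \_ IT).
  apply/funext => s; rewrite /fubini_G patchE; case: ifPn => [sI|sI]; last first.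
    rewrite integral0_eq// => r _; rewrite /= /H2 /H/= /g' patchE (negbTE sI).
    by rewrite mulr0 mul0r.
  have sI2 := set_mem sI; move: (sI2); rewrite /IT/= in_itv/= => /andP[s0 sT].
  have ifs : leb.-integrable `[0, s] (EFin \o f) by exact: integrable_prim If.
  transitivity (\int[leb]_(r in `[0%R, s[) ((g s)%:E * (f r)%:E))%E.
    rewrite [RHS]integral_mkcond; apply: eq_integral => r _.
    rewrite /= /H2 /H/= /f' /g' !patchE sI.
    rewrite /IT !mem_setE !in_itv/=.
    have [rs|rs] := ltP r s; last by rewrite mulr0 andbF.
    rewrite mulr1 andbT (le_trans (ltW rs) sT) andbT mulrC.
    by case: ifP => //; rewrite mulr0.
  rewrite integralZl//; last first.
    apply: integrableS ifs => //.
    by apply: subset_itvl; rewrite bnd_simp.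
  (* The strict triangle yields a half-open interval, whose missing end point is negligible. *)
  rewrite integral_itv_bndo_bndc; last first.
    apply: (measurable_funS (E := `[0, s]%classic)) => //.
      by apply: subset_itvl; rewrite bnd_simp.
    exact: measurable_int ifs.
  rewrite /= EFinM; congr (_ * _)%E; rewrite /Rintegral fineK//.
  exact: integrable_fin_num.
have J1 : leb.-integrable IT (EFin \o (fun s => f s * \int[leb]_(r in `[0, s]) g r)).
  by apply/integrable_mkcond => //; rewrite -E1; exact: integrable_fubini_F.
have EI2 : (\int[leb \x leb]_p (H2 p)%:E = \int[leb]_(s in IT) (g s * \int[leb]_(r in `[0%R, s]) f r)%:E)%E.
  by rewrite -(integral21_prod_meas1 IH2) E2 -integral_mkcond.
have EI1 : (\int[leb \x leb]_p (H1 p)%:E = \int[leb]_(s in IT) (f s * \int[leb]_(r in `[0%R, s]) g r)%:E)%E.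
  by rewrite -(integral12_prod_meas1 IH1) E1 -integral_mkcond.
have J2 : leb.-integrable IT (EFin \o (fun s => g s * \int[leb]_(r in `[0, s]) f r)).
  apply/integrable_mkcond => //; rewrite -E2; apply/integrableP; split.
    exact: (measurable_fubini_G IH2).
  have mEH2 : measurable_fun setT (EFin \o H2) by exact/measurable_EFinP.
  have foo := (integrable21ltyP leb leb mEH2).1 IH2.
  apply: le_lt_trans foo; apply: ge0_le_integral => //.
  - by apply: measurableT_comp => //; exact: (measurable_fubini_G IH2).
  - apply: (measurable_fun_fubini_tonelli_G (abse \o (EFin \o H2))) => //.
      by apply: measurableT_comp => //; exact/measurable_EFinP.
    by move=> x; exact: abse_ge0.
  - move=> r _; apply: le_abse_integral => //.
    by apply/measurable_EFinP; exact: measurable_fun_pair1.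
split => //.
transitivity (fine (\int[leb \x leb]_p (H p)%:E)%E).
  rewrite /Rintegral -EI1 -EI2 -fineD; [|exact: integrable_fin_num..].
  rewrite -integralD//; congr fine; apply: eq_integral => p _.
  rewrite -EFinD /H1 /H2 -mulrDr; case: (leP p.2 p.1) => _.
    by rewrite addr0 mulr1.
  by rewrite add0r mulr1.
rewrite -(integral12_prod_meas1 IH).
rewrite (eq_integral (fun x => (f' x)%:E * (\int[leb]_(s in IT) g s)%:E)%E); last first.
  move=> x _; rewrite /fubini_F /H/=; under eq_integral do rewrite EFinM.
  rewrite integralZl//; congr (_ * _)%E; rewrite /Rintegral fineK; last first.
    exact: integrable_fin_num.
  by rewrite [RHS]integral_mkcond restrict_EFin.
rewrite integralZr// fineM//; last exact: integrable_fin_num.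
by congr (_ * _); rewrite /Rintegral [in RHS]integral_mkcond restrict_EFin.
Qed.


Lemma Rintegral_expRN l t : 0 < l -> 0 <= t ->
  \int[leb]_(s in `[0, t]) expR (- (l * s)) = (1 - expR (- (l * t))) / l.
Proof.
move=> l0; rewrite le_eqVlt => /predU1P[<-|t0].
  by rewrite set_itv1 Rintegral_set1 mulr0 oppr0 expR0 subrr mul0r.
pose F (s : R) := - expR (- (l * s)) / l.
have dF (x : R) : is_derive x 1 F (expR (- (l * x))).
  rewrite /F; apply: is_derive_eq; rewrite /GRing.scale/=.
  by field; rewrite gt_eqF.
have cF : continuous F.
  by move=> x; apply: differentiable_continuous; apply/derivable1_diffP; have [] := dF x.
rewrite /Rintegral (@continuous_FTC2 _ _ F)//; last 3 first.
- apply: continuous_subspaceT => x; apply: continuous_comp; last exact: continuous_expR.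
  by apply: continuousN; apply: mulrl_continuous.
- split; first by move=> x _; have [] := dF x.
  + exact: (cvg_at_right_filter (cF _)).
  + exact: (cvg_at_left_filter (cF _)).
- by move=> x _; rewrite derive1E; have [_ ->] := dF x.
by rewrite -EFinB/= /F mulr0 oppr0 expR0; field; rewrite gt_eqF.
Qed.

(** The inequality, valid at almost every time, is integrated against the weight [exp (- 2 C t)]
    instead of being iterated. Exchanging the integrals bounds the weighted double integral by
    [1 / (2 C)] times the weighted integral of [phi], so that half of the left side is absorbed:
    hence the factor 2, while [expR (2 * C * T)] pays for removing the weight. Integrability of
    [phi] allows the subtraction. *)
Lemma integral_gronwall T (C : R) (phi alpha : Rm -> R) : 0 <= T -> 0 < C ->
  (forall t, 0 <= phi t) -> (forall t, 0 <= alpha t) ->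
  measurable_fun `[0, T] alpha ->
  leb.-integrable `[0, T] (EFin \o phi) ->
  {ae leb, forall t, `[0, T]%classic t ->
    phi t <= alpha t + C * \int[leb]_(s in `[0, t]) phi s} ->
  (\int[leb]_(t in `[0%R, T]) (phi t)%:E <=
   (2 * expR (2 * C * T))%:E * \int[leb]_(t in `[0%R, T]) (alpha t)%:E)%E.
Proof.
move=> T0 C0 p0 a0 ma Ip h.
have c0 : 0 < 2 * expR (2 * C * T) by rewrite mulr_gt0// expR_gt0.
have [aoo|aoo] := eqVneq (\int[leb]_(t in `[0%R, T]) (alpha t)%:E)%E +oo%E.
  by rewrite aoo gt0_muley ?lte_fin// leey.
have Ia : leb.-integrable `[0, T] (EFin \o alpha).
  by apply: ge0_integrable_lty => //; rewrite ltey.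
(* Any rate above [C] would allow the absorption; twice [C] leaves the factor 1/2. *)
set l := 2 * C; have l0 : 0 < l by rewrite mulr_gt0.
pose e (t : Rm) : R := expR (- (l * t)).
have me : measurable_fun setT e.
  by apply: measurableT_comp => //; apply: measurableT_comp => //; exact: measurable_funM.
have e0 t : 0 <= e t by exact: expR_ge0.
have be : [bounded e x | x in `[0, T]%classic].
  exists 1; split => // M M1 x /=; rewrite in_itv/= => /andP[x0 xT].
  rewrite ger0_norm// (le_trans _ (ltW M1))// -expR0 ler_expR oppr_le0.
  by rewrite mulr_ge0// ltW.
have Iem (f : Rm -> R) : leb.-integrable `[0, T] (EFin \o f) ->
    leb.-integrable `[0, T] (EFin \o (fun t => e t * f t)).
  move=> If; apply: le_integrable (If) => //.
    apply/measurable_EFinP; apply: measurable_funM; first exact: measurable_funTS.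
    by apply/measurable_EFinP; exact: measurable_int If.
  move=> t; rewrite /= in_itv/= => /andP[t0 tT]; rewrite lee_fin normrM ler_piMl//.
  by rewrite ger0_norm// -expR0 ler_expR oppr_le0 mulr_ge0// ltW.
have Ie : leb.-integrable `[0, T] (EFin \o e).
  apply: measurable_bounded_integrable => //; last exact: measurable_funTS.
  exact: lebesgue_itv0_lty.
have [J1 J2 J] := Rintegral_prim_by_parts Ie Ip.
set X := \int[leb]_(t in `[0, T]) (e t * phi t).
set Y := \int[leb]_(t in `[0, T]) (e t * \int[leb]_(s in `[0, t]) phi s).
have YX : Y <= X / l.
  (* The order of integration is exchanged: [(e t - e T) / l] is the integral of the weight over
     [[t, T]]. *)
  have -> : Y = \int[leb]_(t in `[0, T]) (((e t - e T) / l) * phi t).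
    apply: (@addIr _ (\int[leb]_(s in `[0, T]) (phi s * \int[leb]_(r in `[0, s]) e r))).
    rewrite J -RintegralZl// -RintegralD//; last first.
      have := integrableB _ (Iem _ Ip) (integrableZl _ (e T) Ip).
      move=> /(_ (measurable_itv _) (measurable_itv _)) Iq.
      have := integrableZl _ l^-1 Iq; move=> /(_ (measurable_itv _)).
      apply: eq_integrable => // t _.
      by rewrite [LHS](_ : _ = (l^-1 * (e t * phi t - e T * phi t))%:E)//; congr EFin; ring.
    apply: eq_Rintegral => t /set_mem/=; rewrite in_itv/= => /andP[t0 tT].
    rewrite !Rintegral_expRN// -/(e t) -/(e T); field; by rewrite gt_eqF.
  rewrite /X mulrC -RintegralZl//; last exact: Iem.
  apply: le_Rintegral => //.
  - have := integrableB _ (Iem _ Ip) (integrableZl _ (e T) Ip).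
    move=> /(_ (measurable_itv _) (measurable_itv _)) Iq.
    have := integrableZl _ l^-1 Iq; move=> /(_ (measurable_itv _)).
    apply: eq_integrable => // t _.
      by rewrite [LHS](_ : _ = (l^-1 * (e t * phi t - e T * phi t))%:E)//; congr EFin; ring.
  - exact: (integrableZl _ _ (Iem _ Ip)).
  - move=> t _; rewrite mulrA ler_wpM2r// mulrC ler_wpM2l ?invr_ge0 ?(ltW l0)//.
    by rewrite gerBl.
set A := \int[leb]_(t in `[0, T]) (e t * alpha t).
have XA : X <= A + C * Y.
  rewrite -lee_fin /X /Rintegral fineK; last by apply: integrable_fin_num => //; exact: Iem.
  rewrite -RintegralZl// -RintegralD//; [|exact: Iem|exact: (integrableZl _ _ J1)].
  have Ir : leb.-integrable `[0, T] (EFin \o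
      (fun t => e t * alpha t + C * (e t * \int[leb]_(s in `[0, t]) phi s))).
    by apply: (integrableD _ (Iem _ Ia) (integrableZl _ _ J1)).
  rewrite /Rintegral fineK; last by apply: integrable_fin_num.
  apply: ae_ge0_le_integral => //.
  - by move=> t _; rewrite lee_fin mulr_ge0.
  - exact: measurable_int (Iem _ Ip).
  - move=> t _; rewrite lee_fin addr_ge0// mulr_ge0 ?(ltW C0)// mulr_ge0//.
    exact: Rintegral_ge0.
  - exact: measurable_int Ir.
  - apply: filterS h; first exact: (ae_filter_ringOfSetsType leb).
    move=> t ht tI; rewrite lee_fin.
    by rewrite (mulrCA C) -mulrDr ler_wpM2l// ht.
have X2A : X <= 2 * A.
  have : C * Y <= X / 2.
    apply: (le_trans (ler_wpM2l (ltW C0) YX)); rewrite /l.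
    by rewrite le_eqVlt; apply/orP; left; apply/eqP; field; rewrite gt_eqF.
  move: XA; lra.
have AA : A <= \int[leb]_(t in `[0, T]) alpha t.
  apply: le_Rintegral => //; first exact: Iem.
  move=> t /=; rewrite in_itv/= => /andP[t0 tT].
  by rewrite ler_piMl// -expR0 ler_expR oppr_le0 mulr_ge0// ltW.
have PX : \int[leb]_(t in `[0, T]) phi t <= expR (l * T) * X.
  rewrite /X -RintegralZl//; last exact: Iem.
  apply: le_Rintegral => //; first exact: (integrableZl _ _ (Iem _ Ip)).
  move=> t /=; rewrite in_itv/= => /andP[t0 tT].
  rewrite mulrA ler_peMl// /e -expRD -[leLHS]expR0 ler_expR -mulrBr mulr_ge0 ?(ltW l0)//.
  by rewrite subr_ge0.
rewrite -[leLHS]fineK; last by apply: integrable_fin_num.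
rewrite -[X in (_ <= _ * X)%E]fineK; last by apply: integrable_fin_num.
rewrite -EFinM lee_fin; apply: (le_trans PX).
rewrite -[leRHS]mulrA [leRHS]mulrCA; apply: ler_wpM2l; first exact: expR_ge0.
by apply: (le_trans X2A); rewrite ler_wpM2l.
Qed.

End calculus.

(** * Moments and independence *)

Section normal_moments.
Context (R : realType).
Notation leb := (@lebesgue_measure R).

(** Change of measure is expressed by a Radon-Nikodym derivative; it agrees almost everywhere with
    the Gaussian density because both have the same integral over every measurable set. *)
Lemma ge0_integral_normal_prob (s : R) (f : R -> R) :
  measurable_fun setT f -> (forall x, 0 <= f x) ->
  (\int[normal_prob 0 s]_x (f x)%:E =
   \int[leb]_x (f x * normal_pdf 0 s x)%:E)%E.
Proof.
move=> mf f0.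
have dom := normal_prob_dominates 0 s.
have mEf : measurable_fun setT (EFin \o f) by exact/measurable_EFinP.
have Ef0 (x : measurableTypeR R) : (0 <= (EFin \o f) x)%E by rewrite lee_fin.
rewrite -(Radon_Nikodym_SigmaFinite.change_of_variables dom Ef0)//.
have ip := integrable_normal_pdf 0 s.
apply: ae_eq_integral => //.
- apply: emeasurable_funM => //.
  exact: measurable_int (Radon_Nikodym_SigmaFinite.f_integrable dom).
- by apply/measurable_EFinP; apply: measurable_funM => //; exact: measurable_normal_pdf.
- have H : ae_eq leb setT
      (Radon_Nikodym_SigmaFinite.f (normal_prob 0 s) leb)
      (fun x => (normal_pdf 0 s x)%:E).
    apply: integral_ae_eq => //.
    + exact: Radon_Nikodym_SigmaFinite.f_integrable.
    + by apply/measurable_EFinP; exact: measurable_normal_pdf.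
    + by move=> E _ mE; rewrite -Radon_Nikodym_SigmaFinite.f_integral.
  apply: (@filterS _ _ (ae_filter_ringOfSetsType leb) _ _ _ H).
  by move=> x /= /(_ I) ->.
Qed.

Lemma ge0_integral_lebesgue_opp (f : R -> R) :
  measurable_fun setT f -> (forall x, 0 <= f x) ->
  (\int[leb]_x (f x)%:E = \int[leb]_x (f (- x))%:E)%E.
Proof.
move=> mf f0.
have mopp : measurable_fun setT (-%R : measurableTypeR R -> measurableTypeR R).
  exact: oppr_measurable.
have mEf : measurable_fun setT (EFin \o f : measurableTypeR R -> \bar R).
  exact/measurable_EFinP.
have Ef0 : {in setT, forall y : measurableTypeR R, (0 <= (EFin \o f) y)%E}.
  by move=> x _; rewrite lee_fin.
transitivity (\int[leb]_(x in -%R @^-1` setT) ((EFin \o f) \o -%R) x)%E; last first.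
  by rewrite preimage_setT.
rewrite -(ge0_integral_pushforward mopp leb measurableT mEf Ef0).
by apply: eq_measure_integral => A mA _; exact/esym/lebesgue_measureN.
Qed.

Lemma normal_pdf_opp (s x : R) : normal_pdf 0 s (- x) = normal_pdf 0 s x \/ s = 0.
Proof.
have [->|s0] := eqVneq s 0; first by right.
by left; rewrite !normal_pdfE// /normal_fun !subr0 sqrrN.
Qed.

(** By symmetry of the density the positive and negative parts have the same integral. Should that
    common value be infinite, [fine] still returns 0. *)
Lemma Rintegral_normal_prob_id (s : R) : s != 0 -> \int[normal_prob 0 s]_x x = 0.
Proof.
move=> s0; rewrite /Rintegral integralE.
set a := (\int[_]_x _)%E; set b := (\int[_]_x _)%E.
suff -> : a = b.
  by case: b => [r| |] //=; rewrite subrr.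
have -> : a = (\int[normal_prob 0 s]_x (Num.max x 0)%:E)%E.
  by apply: eq_integral => x _; rewrite funeposE EFin_max.
have -> : b = (\int[normal_prob 0 s]_x (Num.max (- x) 0)%:E)%E.
  by apply: eq_integral => x _; rewrite funenegE EFin_max.
have mmax : measurable_fun setT (fun x : R => Num.max x 0) by exact: measurable_maxr.
have mmaxN : measurable_fun setT (fun x : R => Num.max (- x) 0) by exact: measurable_maxr.
rewrite !ge0_integral_normal_prob//; try by move=> x; rewrite le_max lexx orbT.
rewrite ge0_integral_lebesgue_opp; last 2 first.
- by apply: measurable_funM => //; exact: measurable_normal_pdf.
- by move=> x; rewrite mulr_ge0 ?normal_pdf_ge0// le_max lexx orbT.
apply: eq_integral => x _; congr EFin; congr (_ * _).
by case: (normal_pdf_opp s x) => // s00; rewrite s00 eqxx in s0.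
Qed.

(** With [v = x^2 / 4], the bound [v exp (- v) <= 1] spends one of the two factors [exp (- v)] on
    [x^2]; the other one is, up to a constant, the Gaussian density of variance 2, whose integral is
    1. *)
Lemma normal_second_moment_lty :
  (\int[leb]_x (x ^+ 2 * normal_pdf 0 1 x)%:E < +oo)%E.
Proof.
set q := Num.sqrt (2 : R).
have q0 : q != 0 by rewrite gt_eqF// sqrtr_gt0.
have q2 : q ^+ 2 = 2 by rewrite sqr_sqrtr.
(* The 4 comes from [x^2 = 4 v]; the quotient of peaks changes the normalization from deviation 1 to
   deviation [q]. *)
set c := 4 * normal_peak (1 : R) / normal_peak q.
have pq : 0 < normal_peak q by exact: normal_peak_gt0.
apply: (@le_lt_trans _ _ (\int[leb]_x (c%:E * (normal_pdf 0 q x)%:E))%E); last first.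
  rewrite ge0_integralZl//; last 3 first.
  - by apply/measurable_EFinP; exact: measurable_normal_pdf.
  - by move=> x _; rewrite lee_fin normal_pdf_ge0.
  - by rewrite lee_fin /c mulr_ge0 ?invr_ge0 ?(ltW pq)// mulr_ge0// normal_peak_ge0.
  by rewrite integral_normal_pdf mule1 ltry.
apply: ge0_le_integral => //.
- by move=> x _; rewrite lee_fin mulr_ge0 ?normal_pdf_ge0 ?sqr_ge0.
- apply/measurable_EFinP; apply: measurable_funM; last exact: measurable_normal_pdf.
  exact: measurable_funX.
- by apply: measurable_funeM; apply/measurable_EFinP; exact: measurable_normal_pdf.
- move=> x _; rewrite -EFinM lee_fin !normal_pdfE ?oner_neq0//.
  rewrite /normal_fun !subr0 q2 expr1n.
  set u := x ^+ 2; set v := u / 4; set e := expR (- v).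
  have -> : expR (- u / (1 *+ 2)) = e * e.
    by rewrite -expRD; congr expR; rewrite /v; field.
  have -> : expR (- u / (2 *+ 2)) = e.
    by congr expR; rewrite /v; field.
  have -> : c * (normal_peak q * e) = 4 * normal_peak 1 * e.
    by rewrite /c; field; rewrite gt_eqF.
  have ve : v * e <= 1.
    rewrite -[leRHS]expR0 -(subrr v) expRD ler_wpM2r ?expR_ge0//.
    by apply: le_trans (expR_ge1Dx v); rewrite lerDr.
  have -> : u = 4 * v by rewrite /v; field.
  have := normal_peak_ge0 (1 : R); have : 0 <= e by exact: expR_ge0.
  move=> e0 p0.
  have -> : 4 * v * (normal_peak 1 * (e * e)) = (4 * normal_peak 1 * e) * (v * e) by ring.
  by rewrite ler_piMr// !mulr_ge0.
Qed.

(** The substitution [x / s] brings every deviation back to 1, so that one constant serves all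
    [s]. *)
Lemma normal_second_moment : exists2 k : R, 0 <= k & forall s : R, 0 < s ->
  (\int[normal_prob 0 s]_x (x ^+ 2)%:E = (k * s ^+ 2)%:E)%E.
Proof.
have m2 : measurable_fun setT (fun x : R => x ^+ 2) by exact: measurable_funX.
set K := (\int[leb]_x (x ^+ 2 * normal_pdf 0 1 x)%:E)%E.
have K0 : (0 <= K)%E.
  by apply: integral_ge0 => x _; rewrite lee_fin mulr_ge0 ?sqr_ge0 ?normal_pdf_ge0.
have Kfin : K \is a fin_num by rewrite ge0_fin_numE// normal_second_moment_lty.
exists (fine K); first exact: fine_ge0.
move=> s s0; rewrite ge0_integral_normal_prob//; last by move=> x; exact: sqr_ge0.
pose F (x : R) := x / s.
have dF (x : R) : is_derive x 1 F s^-1.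
  rewrite /F; apply: is_derive_eq; rewrite /GRing.scale/= ?mulr0 ?mulr1 ?addr0 ?add0r.
  by [].
have F'E : (F^`()%classic) = cst s^-1.
  by apply/funext => x; rewrite derive1E; have [_ ->] := dF x.
pose Gf (y : R) := y ^+ 2 * normal_pdf 0 1 y.
have Kf : K = (\int[leb]_x (((Gf \o F) * (F^`()%classic)) x)%:E)%E.
  rewrite -increasing_ge0_integration_by_substitutionT//.
  - by move=> x y xy; rewrite /F ltr_pM2r ?invr_gt0.
  - by rewrite F'E; move=> x; exact: cvg_cst.
  - by rewrite F'E; exact: is_cvg_cst.
  - by rewrite F'E; exact: is_cvg_cst.
  - by rewrite /F; apply: gt0_cvgMlNy; [rewrite invr_gt0|exact: cvg_id].
  - by rewrite /F; apply: gt0_cvgMly; [rewrite invr_gt0|exact: cvg_id].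
  - move=> x; apply: cvgM; first exact: sqr_continuous.
    by apply: continuous_normal_pdf; exact: oner_neq0.
  - by move=> x; rewrite mulr_ge0 ?sqr_ge0 ?normal_pdf_ge0.
have mGF : measurable_fun setT (fun x => (((Gf \o F) * (F^`()%classic)) x)%:E).
  apply/measurable_EFinP; rewrite F'E; apply: measurable_funM => //.
  apply: (measurableT_comp (f := Gf)).
    by apply: measurable_funM => //; exact: measurable_normal_pdf.
  exact: measurable_funM.
rewrite mulrC EFinM fineK// Kf -ge0_integralZl//; last 2 first.
- move=> x _; rewrite lee_fin F'E mulr_ge0 ?invr_ge0 ?(ltW s0)//.
  by rewrite /Gf/= mulr_ge0 ?sqr_ge0 ?normal_pdf_ge0.
- by rewrite lee_fin sqr_ge0.
apply: eq_integral => x _; rewrite -EFinM; congr EFin.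
rewrite F'E /Gf /F/= !normal_pdfE ?oner_neq0 ?gt_eqF// /normal_fun !subr0.
transitivity (s ^+ 2 * ((x / s) ^+ 2 * (normal_peak 1 * expR (- (x / s) ^+ 2 / (1 ^+ 2 *+ 2))) / s)); last by rewrite !fctE/= subr0.
have -> : - (x / s) ^+ 2 / (1 ^+ 2 *+ 2) = - x ^+ 2 / (s ^+ 2 *+ 2).
  by field; rewrite gt_eqF.
have -> : normal_peak s = normal_peak 1 / s.
  rewrite /normal_peak expr1n -mulrnAr sqrtrM ?sqr_ge0// sqrtr_sqr gtr0_norm//.
  by rewrite mul1r invfM mulrC.
by field; rewrite gt_eqF.
Qed.

End normal_moments.

Section independence.
Context d (Omega : measurableType d) (R : realType) (Pr : probability Omega R).

(** The law of the pair and the product of the laws agree on rectangles, hence as measures; Fubini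
    for the product measure then factors the mean. *)
Lemma Rintegral_mul_indep (X Y : Omega -> R) :
  measurable_fun setT X -> measurable_fun setT Y ->
  Pr.-integrable setT (EFin \o X) -> Pr.-integrable setT (EFin \o Y) ->
  (forall A B : set R, measurable A -> measurable B ->
    Pr (X @^-1` A `&` Y @^-1` B) = (Pr (X @^-1` A) * Pr (Y @^-1` B))%E) ->
  \int[Pr]_w (X w * Y w) = (\int[Pr]_w X w) * \int[Pr]_w Y w.
Proof.
move=> mX mY IX IY XY.
pose X' : {RV Pr >-> R} := mfun_Sub (mem_set mX).
pose Y' : {RV Pr >-> R} := mfun_Sub (mem_set mY).
have mphi : measurable_fun setT (fun w => (X w, Y w)) by exact: measurable_fun_pair.
pose phi : {mfun Omega >-> (R * R)%type} := mfun_Sub (mem_set mphi).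
have iabs (Z : {RV Pr >-> R}) : (\int[distribution Pr Z]_y `|y|%:E = \int[Pr]_w `|Z w|%:E)%E.
  rewrite ge0_integral_distribution//.
  apply/measurable_EFinP; exact: normr_measurable.
have mprod : measurable_fun setT (fun p : R * R => (p.1 * p.2)%:E).
  by apply/measurable_EFinP; apply: measurable_funM.
have Eset (A : set (R * R)) : measurable A ->
    pushforward Pr phi A = (distribution Pr X' \x distribution Pr Y')%E A.
  by move=> mA; apply/esym; apply: product_measure_unique.
have E : (\int[pushforward Pr phi]_p (p.1 * p.2)%:E =
    \int[distribution Pr X' \x distribution Pr Y']_p (p.1 * p.2)%:E)%E.
  by apply: eq_measure_integral => A mA _; exact: Eset.
have Iprod : (distribution Pr X' \x distribution Pr Y')%E.-integrable setT
    (fun p : R * R => (p.1 * p.2)%:E).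
  apply/integrable12ltyP => //=.
  under eq_integral => x _.
    under eq_integral do rewrite normrM EFinM.
    rewrite ge0_integralZl//=; last first.
      apply/measurable_EFinP; exact: normr_measurable.
    rewrite iabs.
    over.
  have /integrableP[_ /= Xoo] := IX; have /integrableP[_ /= Yoo] := IY.
  rewrite ge0_integralZr//=; last 2 first.
  - apply/measurable_EFinP; exact: normr_measurable.
  - exact: integral_ge0.
  by rewrite iabs lte_mul_pinfty ?integral_ge0// ge0_fin_numE ?integral_ge0.
have XYint : Pr.-integrable setT ((fun p : R * R => (p.1 * p.2)%:E) \o phi).
  apply/integrableP; split; first exact: measurableT_comp.
  have -> : (\int[Pr]_w `|((fun p : R * R => (p.1 * p.2)%:E) \o phi) w| =
      \int[pushforward Pr phi]_p `|(p.1 * p.2)%:E|)%E.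
    by rewrite ge0_integral_pushforward//; exact: measurableT_comp.
  have -> : (\int[pushforward Pr phi]_p `|(p.1 * p.2)%:E| =
    \int[distribution Pr X' \x distribution Pr Y']_p `|(p.1 * p.2)%:E|)%E.
    by apply: eq_measure_integral => A mA _; exact: Eset.
  by have /integrableP[] := Iprod.
have Idist (Z : {RV Pr >-> R}) : Pr.-integrable setT (EFin \o Z) ->
    (distribution Pr Z).-integrable setT (EFin : R -> \bar R).
  move=> /integrableP[_ Zoo]; apply/integrableP; split; first exact/measurable_EFinP.
  by rewrite iabs.
have EX (Z : {RV Pr >-> R}) : Pr.-integrable setT (EFin \o Z) ->
    (\int[distribution Pr Z]_y y%:E = \int[Pr]_w (Z w)%:E)%E.
  by move=> IZ; rewrite integral_distribution//; exact/measurable_EFinP.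
rewrite /Rintegral.
transitivity (fine (\int[pushforward Pr phi]_p (p.1 * p.2)%:E)%E).
  by rewrite integral_pushforward.
rewrite E -(integral12_prod_meas1 Iprod) /fubini_F.
rewrite (eq_integral (fun x : R => x%:E * \int[Pr]_w (Y w)%:E)%E); last first.
  move=> x _; under eq_integral do rewrite EFinM.
  by rewrite integralZl//= ?EX//; exact: Idist.
have Yfin : (\int[Pr]_w (Y w)%:E)%E \is a fin_num by exact: integrable_fin_num.
rewrite -(fineK Yfin) integralZr//; last exact: Idist.
by rewrite EX// fineM// integrable_fin_num.
Qed.

End independence.

(** * Increments are independent of the joint past *)

Section sigma_gen_theory.
Context d (Omega : measurableType d) (R : realType).
Implicit Types (D : set (Omega -> R)) (G : set (set Omega)).

Lemma g_sigma_setI G A B : <<s G >> A -> <<s G >> B -> <<s G >> (A `&` B).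
Proof. exact: (@measurableI _ (g_sigma_algebraType G)). Qed.

Lemma g_sigma_setT G : <<s G >> setT.
Proof. exact: (@measurableT _ (g_sigma_algebraType G)). Qed.

Lemma g_sigma_bigcap G (N : set nat) (F : nat -> set Omega) :
  (forall i, N i -> <<s G >> (F i)) -> <<s G >> (\bigcap_(i in N) F i).
Proof. exact: (@bigcap_measurableType _ (g_sigma_algebraType G)). Qed.

Lemma g_sigma_sub G G' : G `<=` <<s G' >> -> <<s G >> `<=` <<s G' >>.
Proof. by apply: smallest_sub; exact: smallest_sigma_algebra. Qed.

Lemma g_sigma_measurable G : G `<=` measurable -> <<s G >> `<=` @measurable _ Omega.
Proof. by apply: smallest_sub; exact: sigma_algebra_measurable. Qed.

Lemma sigma_gen_preimage D X (B : set R) : D X -> measurable B ->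
  sigma_gen D (X @^-1` B).
Proof.
move=> DX mB; apply: sub_gen_smallest; exists X => //.
by exists B => //; rewrite setTI.
Qed.

Lemma sigma_gen_sub D G :
  (forall X B, D X -> measurable B -> <<s G >> (X @^-1` B)) ->
  sigma_gen D `<=` <<s G >>.
Proof.
move=> h; apply: g_sigma_sub => _ [X DX [B mB <-]].
by rewrite setTI; exact: h.
Qed.

Lemma sigma_gen_measurable D : (forall X, D X -> measurable_fun setT X) ->
  sigma_gen D `<=` measurable.
Proof.
move=> h; apply: g_sigma_measurable => _ [X DX [B mB <-]].
exact: h.
Qed.

Lemma sigma_genS D D' : D `<=` D' -> sigma_gen D `<=` sigma_gen D'.
Proof. by move=> DD; apply: sigma_gen_sub => X B /DD; exact: sigma_gen_preimage. Qed.

Lemma sigma_gen_funP D X : D X ->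
  measurable_fun setT (X : g_sigma_algebraType
    (\bigcup_(Y in D) preimage_set_system setT Y measurable) -> R).
Proof. by move=> DX _ B mB; rewrite setTI; exact: sigma_gen_preimage. Qed.

End sigma_gen_theory.

Section increments.
Context d (Omega : measurableType d) (R : realType) (Pr : probability Omega R).
Context (n : nat) (W : nat -> R -> Omega -> R) (x0 : nat -> Omega -> 'cV[R]_n).
Hypothesis W_brownian : forall i, brownian_motion Pr (W i).
Hypothesis W_indep : mutual_indep Pr
  (fun i => sigma_gen [set W i t | t in `[0, +oo[]).
Hypothesis x0_meas : forall i k, measurable_fun setT (fun w => x0 i w k 0).
Hypothesis x0_W_indep : indep2 Pr
  (sigma_gen (\bigcup_i coords (x0 i)))
  (sigma_gen (\bigcup_i [set W i t | t in `[0, +oo[])).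

Lemma brownian_measurable i t : 0 <= t -> measurable_fun setT (W i t).
Proof. by move=> t0; have [+ _ _ _ _] := W_brownian i; exact. Qed.

Let past i s : set (set Omega) := sigma_gen [set W i v | v in `[0, s]].
Let init : set (set Omega) := sigma_gen (\bigcup_i coords (x0 i)).
Let future : set (set Omega) := sigma_gen (\bigcup_i [set W i t | t in `[0, +oo[]).

Let cylinders N s : set (set Omega) := [set F | exists A0 B,
  [/\ init A0, (forall j, past j s (B j)) &
      F = A0 `&` \bigcap_(j in [set` iota 0 N]) B j]].

Let cylindersI N s : setI_closed (cylinders N s).
Proof.
move=> _ _ [A [B [iA pB ->]]] [A' [B' [iA' pB' ->]]].
exists (A `&` A'), (fun j => B j `&` B' j); split.
- exact: g_sigma_setI.
- by move=> j; apply: g_sigma_setI; [exact: pB|exact: pB'].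
- apply/seteqP; split => [w [[Aw Bw] [A'w B'w]]|w [[Aw A'w] BB]].
    by split; [|move=> j jN; split; [exact: Bw|exact: B'w]].
  by split; split => // j /BB[].
Qed.

Let joint_sub_cylinders N s : joint_filtration x0 W N s `<=` <<s cylinders N s >>.
Proof.
apply: g_sigma_sub => A [i /= iN]; apply: sigma_gen_sub => X B [[k ->]|WX] mB.
- apply: sub_gen_smallest; exists ((fun w => x0 i w k 0) @^-1` B), (fun=> setT).
  split.
  + by apply: sigma_gen_preimage => //; exists i => //; exists k.
  + by move=> j; exact: g_sigma_setT.
  + by apply/seteqP; split => [w|w []].
- apply: sub_gen_smallest; exists setT, (fun j => if j == i then X @^-1` B else setT).
  split.
  + exact: g_sigma_setT.
  + move=> j; case: eqP => [->|_]; last exact: g_sigma_setT.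
    exact: sigma_gen_preimage.
  + rewrite setTI; apply/seteqP; split => [w Xw j _ /=|w /(_ i)/=].
      by case: eqP.
    by rewrite eqxx mem_iota add0n; exact.
Qed.

Let past_line i s : past i s `<=` sigma_gen [set W i t | t in `[0, +oo[].
Proof.
apply: sigma_genS => _ [v /= + <-]; rewrite in_itv/= => /andP[v0 _].
by exists v => //=; rewrite in_itv/= v0.
Qed.

Let line_future i : sigma_gen [set W i t | t in `[0, +oo[] `<=` future.
Proof. by apply: sigma_genS => X WX; exists i. Qed.

(** Dynkin's lemma in [F], with [A] fixed. On a cylinder, [A] is merged with the past event of the
    same noise, from which it splits off by independence of increments; mutual independence of the
    noises and their independence from the initial states handle the other factors. *)
Lemma brownian_increment_indep_joint N i s t (A F : set Omega) : (i < N)%N ->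
  0 <= s -> s < t -> sigma_gen [set W i t \- W i s] A ->
  joint_filtration x0 W N s F -> Pr (A `&` F) = (Pr A * Pr F)%E.
Proof.
move=> iN s0 st sA jF.
have t0 : 0 <= t by rewrite (le_trans s0) ?ltW.
have A_line : sigma_gen [set W i t | t in `[0, +oo[] A.
  move: sA; apply: sigma_gen_sub => _ B -> mB.
  have mm u : 0 <= u -> measurable_fun setT (W i u : g_sigma_algebraType
    (\bigcup_(Y in [set W i t | t in `[0, +oo[]) preimage_set_system setT Y measurable) -> R).
    by move=> u0; apply: sigma_gen_funP; exists u => //=; rewrite in_itv/= u0.
  have := measurable_funB (mm _ t0) (mm _ s0).
  by move=> /(_ measurableT _ mB); rewrite setTI.
have mA : measurable A.
  apply: sigma_gen_measurable A_line => _ [u + <-].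
  by rewrite /= in_itv/= andbT => u0; exact: brownian_measurable.
have cyl_meas S : <<s cylinders N s >> S -> measurable S.
  apply: g_sigma_measurable => _ [A0 [B [iA pB ->]]]; apply: measurableI.
    by apply: sigma_gen_measurable iA => _ [j _ [k ->]]; exact: x0_meas.
  apply: bigcap_measurableType => j _; apply: sigma_gen_measurable (pB j).
  move=> _ [u + <-].
  by rewrite /= in_itv/= => /andP[u0 _]; exact: brownian_measurable.
(* Stated for [A] and for the sure event at once: the second case evaluates the probability of the
   cylinder itself. *)
have core A' A0 B : (A' = A \/ A' = setT) -> init A0 -> (forall j, past j s (B j)) ->
    Pr (A' `&` (A0 `&` \bigcap_(j in [set` iota 0 N]) B j)) =
    (Pr A' * (Pr A0 * \prod_(j <- iota 0 N) Pr (B j)))%E.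
  move=> A'E iA pB.
  have A'line : sigma_gen [set W i t | t in `[0, +oo[] A'.
    by case: A'E => -> //; exact: g_sigma_setT.
  have AB : Pr (A' `&` B i) = (Pr A' * Pr (B i))%E.
    case: A'E => ->; last by rewrite setTI probability_setT mul1e.
    have [_ _ _ ind _] := W_brownian i.
    exact: (ind s t s0 st A (B i) sA (pB i)).
  (* Slot [i] receives [A'] beside its own past event, so that the family stays indexed by the
     agents. *)
  pose Cc j := if j == i then A' `&` B j else B j.
  have AC : A' `&` \bigcap_(j in [set` iota 0 N]) B j = \bigcap_(j in [set` iota 0 N]) Cc j.
    apply/seteqP; split => [w [Aw Bw] j jN|w Cw].
      by rewrite /Cc; case: eqP => _; [split|]; rewrite //; exact: Bw.
    split.
      have := Cw i; rewrite /= mem_iota add0n /Cc eqxx => /(_ iN).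
      by case.
    by move=> j jN; have := Cw _ jN; rewrite /Cc; case: eqP => // _ [].
  have Cline j : sigma_gen [set W j t | t in `[0, +oo[] (Cc j).
    rewrite /Cc; case: eqP => [->|_]; last exact: past_line.
    by apply: g_sigma_setI => //; exact: past_line.
  rewrite setIA (setIC A') -setIA AC x0_W_indep//; last first.
    apply: g_sigma_bigcap => //.
    by move=> j _; exact: line_future (Cline j).
  rewrite W_indep//; last exact: iota_uniq.
  have iI : i \in iota 0 N by rewrite mem_iota add0n.
  rewrite [in RHS](bigD1_seq i)//= ?iota_uniq// (bigD1_seq i)//= ?iota_uniq//.
  rewrite {1}/Cc eqxx AB.
  rewrite (eq_bigr (fun j => Pr (B j))); last by move=> j /negbTE; rewrite /Cc => ->.
  by rewrite !muleA (muleC (Pr A0)).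
have indepC (S : set Omega) : measurable S ->
    Pr (A `&` S) = (Pr A * Pr S)%E -> Pr (A `&` ~` S) = (Pr A * Pr (~` S))%E.
  move=> mS PS.
  have AS : Pr (A `\` S) = (Pr A - Pr (A `&` S))%E.
    by apply: measureD => //; rewrite ltey_eq fin_num_measure.
  rewrite -setDE AS PS probability_setC// muleBr ?mule1// ?fin_num_measure//.
have indepU (S : (set Omega)^nat) : (forall k, measurable (S k)) ->
    trivIset setT S -> (forall k, Pr (A `&` S k) = (Pr A * Pr (S k))%E) ->
    Pr (A `&` \bigcup_k S k) = (Pr A * Pr (\bigcup_k S k))%E.
  move=> mS tS PS; rewrite setI_bigcupr measure_bigcup//; last 2 first.
  + by move=> k _; exact: measurableI.
  + exact: trivIset_setIl.
  rewrite measure_bigcup//.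
  rewrite (eq_eseriesr (g := fun k => (Pr A * Pr (S k))%E)); last first.
    by move=> k _; exact: PS.
  have -> : Pr A = (fine (Pr A))%:E by rewrite fineK// fin_num_measure.
  by rewrite nneseriesZl.
have := joint_sub_cylinders jF.
apply: (@dynkin_induction _ (g_sigma_algebraType (cylinders N s)) (cylinders N s)
  (fun F => Pr (A `&` F) = (Pr A * Pr F)%E)) => //.
- transitivity (Pr A * 1)%E; first by rewrite mule1; congr (Pr _); exact: setIT.
  by congr (_ * _)%E; exact/esym/probability_setT.
- move=> _ [A0 [B [iA pB ->]]]; rewrite core//; last by left.
  have := core setT A0 B (or_intror erefl) iA pB.
  by rewrite setTI probability_setT mul1e => ->.
- by move=> S mS; apply: indepC; exact: cyl_meas.
- move=> S mS tS; apply: indepU => // k; exact: cyl_meas (mS k).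
Qed.

End increments.

(** * Second moments of finite sums, and orthogonality in the limit *)

Section sqint_more.
Context d (T : measurableType d) (R : realType) (mu : {measure set T -> \bar R}).
Implicit Types (D : set T).

Lemma Rintegral_sum D (I : eqType) (J : seq I) (f : I -> T -> R) : measurable D ->
  (forall i, i \in J -> mu.-integrable D (EFin \o f i)) ->
  mu.-integrable D (EFin \o (fun x => \sum_(i <- J) f i x)) /\
  \int[mu]_(x in D) (\sum_(i <- J) f i x) = \sum_(i <- J) \int[mu]_(x in D) f i x.
Proof.
move=> mD; elim: J => [_|i J ih If].
  split.
    rewrite (_ : EFin \o _ = cst 0%E); first exact: integrable0.
    by apply/funext => x /=; rewrite big_nil.
  rewrite big_nil -[RHS](mul0r (fine (mu D))) -Rintegral_cst//.
  by apply: eq_Rintegral => x _; rewrite big_nil.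
have [|IJ EJ] := ih; first by move=> j jJ; apply: If; rewrite in_cons jJ orbT.
have Ii : mu.-integrable D (EFin \o f i) by apply: If; rewrite mem_head.
split.
  have := integrableD mD Ii IJ; apply: eq_integrable => // x _.
  by rewrite /= big_cons.
rewrite big_cons -EJ -RintegralD//.
by apply: eq_Rintegral => x _; rewrite big_cons.
Qed.

Lemma Rintegral_sum_sqr D (I : eqType) (J : seq I) (c : I -> R) (F : I -> T -> R) :
  measurable D -> (forall i, i \in J -> sqint mu D (F i)) ->
  \int[mu]_(x in D) ((\sum_(i <- J) c i * F i x) ^+ 2) =
  \sum_(i <- J) \sum_(j <- J) c i * c j * \int[mu]_(x in D) (F i x * F j x).
Proof.
move=> mD sF.
have Iij i j : i \in J -> j \in J ->
    mu.-integrable D (EFin \o (fun x => c i * c j * (F i x * F j x))).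
  move=> iJ jJ.
  exact: (integrableZl mD (c i * c j) (sqint_mul mD (sF _ iJ) (sF _ jJ))).
transitivity (\int[mu]_(x in D)
    (\sum_(i <- J) \sum_(j <- J) c i * c j * (F i x * F j x))).
  apply: eq_Rintegral => x _; rewrite expr2 big_distrlr/=.
  by apply: eq_bigr => i _; apply: eq_bigr => j _; ring.
have [_ ->] := @Rintegral_sum D I J (fun i x => \sum_(j <- J) c i * c j * (F i x * F j x)) mD
  (fun i iJ => (@Rintegral_sum D I J (fun j x => c i * c j * (F i x * F j x)) mD (fun j jJ => Iij i j iJ jJ)).1).
rewrite [LHS]big_seq [RHS]big_seq; apply: eq_bigr => i iJ.
have [_ ->] := @Rintegral_sum D I J (fun j x => c i * c j * (F i x * F j x)) mD (fun j jJ => Iij i j iJ jJ).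
rewrite [LHS]big_seq [RHS]big_seq; apply: eq_bigr => j jJ.
rewrite RintegralZl//; apply: sqint_mul => //; exact: sF.
Qed.

(** Both sides are extended integrals of nonnegative functions, so the estimate may be used before
    either of them is known to be finite. *)
Lemma integral_sqrD_le D (f g : T -> R) : measurable D ->
  measurable_fun D f -> measurable_fun D g ->
  (\int[mu]_(x in D) ((f x + g x) ^+ 2)%:E <=
   2%:E * \int[mu]_(x in D) (f x ^+ 2)%:E + 2%:E * \int[mu]_(x in D) (g x ^+ 2)%:E)%E.
Proof.
move=> mD mf mg.
have m2 (h : T -> R) : measurable_fun D h -> measurable_fun D (fun x => (h x ^+ 2)%:E).
  by move=> mh; apply/measurable_EFinP; exact: measurable_funX.
rewrite -!ge0_integralZl//; [|exact: m2|by move=> x _; rewrite lee_fin sqr_ge0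
  |exact: m2|by move=> x _; rewrite lee_fin sqr_ge0].
rewrite -ge0_integralD//; last 4 first.
- by move=> x _; rewrite -EFinM lee_fin mulr_ge0 ?sqr_ge0.
- by apply: measurable_funeM; exact: m2.
- by move=> x _; rewrite -EFinM lee_fin mulr_ge0 ?sqr_ge0.
- by apply: measurable_funeM; exact: m2.
apply: ge0_le_integral => //.
- by move=> x _; rewrite lee_fin sqr_ge0.
- by apply: (m2 (fun x => f x + g x)); exact: measurable_funD.
- by apply: emeasurable_funD; apply: measurable_funeM; exact: m2.
- by move=> x _; rewrite -!EFinM -EFinD lee_fin; have := sqr_ge0 (f x - g x); nra.
Qed.

Lemma EFin_Rintegral_sqr D (f : T -> R) : measurable D -> sqint mu D f ->
  (\int[mu]_(x in D) (f x ^+ 2))%:E = (\int[mu]_(x in D) (f x ^+ 2)%:E)%E.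
Proof. by move=> mD sf; rewrite /Rintegral fineK// integrable_fin_num//; exact: sqint_sqr. Qed.

End sqint_more.

Lemma lee_vanishing (R : realType) (a c : \bar R) (e : nat -> \bar R) :
  (e @ \oo --> 0)%E -> (forall m, a <= e m + c)%E -> (a <= c)%E.
Proof.
move=> e0 h; have ec : ((fun m => e m + c) @ \oo --> 0 + c)%E.
  by apply: cvgeD => //; exact: cvg_cst.
rewrite add0e in ec.
rewrite -(cvg_lim _ ec)//; apply: lime_ge; first by apply/cvg_ex; exists c.
exact: nearW.
Qed.

Section orthogonality_limit.
Context d (Omega : measurableType d) (R : realType) (Pr : probability Omega R).

(** As [S m] is orthogonal to [xi], the pairing of [X] with [xi] equals that of [X - S m], which
    Cauchy-Schwarz makes arbitrarily small. *)
Lemma Rintegral_orth_limit (X xi : Omega -> R) (S : nat -> Omega -> R) :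
  sqint Pr setT X -> sqint Pr setT xi -> (forall m, sqint Pr setT (S m)) ->
  ((fun m => \int[Pr]_w ((X w - S m w) ^+ 2)%:E) @ \oo --> 0)%E ->
  (forall m, \int[Pr]_w (S m w * xi w) = 0) -> \int[Pr]_w (X w * xi w) = 0.
Proof.
move=> sX sxi sS cvS oS; set c := \int[Pr]_w (X w * xi w).
suff : ((c ^+ 2)%:E <= 0)%E.
  rewrite lee_fin => c0; apply/eqP; rewrite -sqrf_eq0 eq_le c0/=; exact: sqr_ge0.
set k := \int[Pr]_w (xi w ^+ 2).
pose e m := (k%:E * \int[Pr]_w ((X w - S m w) ^+ 2)%:E)%E.
apply: (@lee_vanishing _ _ _ e).
  by rewrite -[X in _ --> X](mule0 k%:E); apply: cvgeZl.
move=> m; rewrite adde0 /e -EFin_Rintegral_sqr//; last exact: sqintB.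
rewrite -EFinM lee_fin mulrC.
have -> : c = \int[Pr]_w ((X w - S m w) * xi w).
  rewrite -[LHS]subr0 -(oS m) /c -RintegralB//; [|exact: sqint_mul..].
  by apply: eq_Rintegral => w _; rewrite mulrBl.
by apply: Rintegral_Cauchy_Schwarz => //; exact: sqintB.
Qed.

End orthogonality_limit.

(* Only finiteness and scaling of the second moment matter, so the value of the
   variance (namely 1) is never computed. *)
Definition normal_var (R : realType) : R := s2val (cid2 (normal_second_moment R)).

Lemma normal_var_ge0 (R : realType) : 0 <= normal_var R.
Proof. exact: (s2valP (cid2 (normal_second_moment R))). Qed.

Lemma normal_varE (R : realType) (s : R) : 0 < s ->
  (\int[normal_prob 0 s]_x (x ^+ 2)%:E = (normal_var R * s ^+ 2)%:E)%E.
Proof. exact: (s2valP' (cid2 (normal_second_moment R))). Qed.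

(** * Wiener integrals of deterministic integrands *)

Section brownian_moments.
Context d (Omega : measurableType d) (R : realType) (Pr : probability Omega R).
Variable W : R -> Omega -> R.
Hypothesis hW : brownian_motion Pr W.
Notation kappa := (normal_var R).

Lemma brownian_meas t : 0 <= t -> measurable_fun setT (W t).
Proof. by move=> t0; have [+ _ _ _ _] := hW; exact. Qed.

Lemma increment_meas s t : 0 <= s -> 0 <= t -> measurable_fun setT (fun w => W t w - W s w).
Proof. by move=> s0 t0; apply: measurable_funB; exact: brownian_meas. Qed.

Lemma ge0_integral_increment s t (f : R -> R) : 0 <= s -> s < t ->
  measurable_fun setT f -> (forall x, 0 <= f x) ->
  (\int[Pr]_w (f (W t w - W s w))%:E =
   \int[normal_prob 0 (Num.sqrt (t - s))]_x (f x)%:E)%E.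
Proof.
move=> s0 st mf f0; have t0 : 0 <= t by rewrite (le_trans s0) ?ltW.
have mX : @measurable_fun _ _ Omega (measurableTypeR R) setT (fun w => W t w - W s w).
  exact: increment_meas.
pose X : {RV Pr >-> measurableTypeR R} :=
  @mfun_Sub _ _ Omega (measurableTypeR R) _ (mem_set mX).
transitivity (\int[distribution Pr X]_x (f x)%:E)%E.
  by rewrite ge0_integral_distribution//; exact/measurable_EFinP.
apply: eq_measure_integral => A mA _.
by have [_ _ _ _ law] := hW; exact: law.
Qed.

Lemma increment_sqr s t : 0 <= s -> s < t ->
  (\int[Pr]_w ((W t w - W s w) ^+ 2)%:E = (kappa * (t - s))%:E)%E.
Proof.
move=> s0 st; rewrite (ge0_integral_increment (f := fun x => x ^+ 2))//.
- by rewrite normal_varE ?sqrtr_gt0 ?subr_gt0// sqr_sqrtr// subr_ge0 ltW.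
- by move=> x; exact: sqr_ge0.
Qed.

Lemma increment_sqint s t : 0 <= s -> s < t ->
  sqint Pr setT (fun w => W t w - W s w).
Proof.
move=> s0 st; split; last by rewrite increment_sqr// ltry.
by apply: increment_meas => //; rewrite (le_trans s0) ?ltW.
Qed.

Lemma increment_mean s t : 0 <= s -> s < t -> \int[Pr]_w (W t w - W s w) = 0.
Proof.
move=> s0 st; have h : 0 < Num.sqrt (t - s) by rewrite sqrtr_gt0 subr_gt0.
rewrite -(Rintegral_normal_prob_id (lt0r_neq0 h)) /Rintegral; congr fine.
rewrite integralE [RHS]integralE; congr (_ - _)%E.
- transitivity (\int[Pr]_w (Num.max (W t w - W s w) 0)%:E)%E.
    by apply: eq_integral => w _; rewrite funeposE EFin_max.
  rewrite (ge0_integral_increment (f := fun x => Num.max x 0))//.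
  + by apply: eq_integral => w _; rewrite funeposE EFin_max.
  + exact: measurable_maxr.
  + by move=> x; rewrite le_max lexx orbT.
- transitivity (\int[Pr]_w (Num.max (- (W t w - W s w)) 0)%:E)%E.
    by apply: eq_integral => w _; rewrite funenegE EFin_max.
  rewrite (ge0_integral_increment (f := fun x => Num.max (- x) 0))//.
  + by apply: eq_integral => w _; rewrite funenegE EFin_max.
  + exact: measurable_maxr.
  + by move=> x; rewrite le_max lexx orbT.
Qed.

Lemma Rintegral_mul_increment_indep s t (xi : Omega -> R) : 0 <= s -> s < t ->
  sqint Pr setT xi ->
  (forall A B, sigma_gen [set W t \- W s] A -> measurable B ->
     Pr (A `&` xi @^-1` B) = (Pr A * Pr (xi @^-1` B))%E) ->
  \int[Pr]_w ((W t w - W s w) * xi w) = 0.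
Proof.
move=> s0 st sxi ind; have Poo : (Pr setT < +oo)%E by rewrite [X in (X < _)%E]probability_setT ltry.
have sI := increment_sqint s0 st.
rewrite Rintegral_mul_indep ?increment_mean ?mul0r//.
- exact: sI.1.
- exact: sxi.1.
- exact: sqint_integrable.
- exact: sqint_integrable.
- by move=> A B mA mB; apply: ind => //; exact: (sigma_gen_preimage (X := W t \- W s)).
Qed.

Lemma brownian0_ae : {ae Pr, forall w, W 0 w = 0}.
Proof. by have [] := hW. Qed.

Lemma brownian_sqr t : 0 <= t -> (\int[Pr]_w (W t w ^+ 2)%:E = (kappa * t)%:E)%E.
Proof.
rewrite le_eqVlt => /predU1P[<-|t0].
  rewrite (ae_eq_integral (cst 0%E))//; first by rewrite integral0 mulr0.
  - by apply/measurable_EFinP; apply: measurable_funX; exact: brownian_meas.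
  - by apply: filterS brownian0_ae => w -> _; rewrite expr0n.
rewrite -[in RHS](subr0 t) -increment_sqr//; apply: ae_eq_integral => //.
- by apply/measurable_EFinP; apply: measurable_funX; exact: brownian_meas (ltW t0).
- by apply/measurable_EFinP; apply: measurable_funX; apply: increment_meas => //; exact: ltW.
- by apply: filterS brownian0_ae => w -> _; rewrite subr0.
Qed.

Lemma brownian_sqint t : 0 <= t -> sqint Pr setT (W t).
Proof. by move=> t0; split; [exact: brownian_meas|rewrite brownian_sqr// ltry]. Qed.

(** For [p <= q], write [W q] as [W p] plus an increment that is centered and independent of
    [W p]. *)
Lemma brownian_cov p q : 0 <= p -> 0 <= q ->
  \int[Pr]_w (W p w * W q w) = kappa * Num.min p q.
Proof.
wlog pq : p q / p <= q => [h p0 q0|].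
  have [pq|qp] := leP p q; first by rewrite h// min_l.
  have hq := h q p (ltW qp) q0 p0; rewrite min_l ?(ltW qp)// in hq.
  by rewrite -hq; apply: eq_Rintegral => w _; exact: mulrC.
move=> p0 q0; rewrite min_l//.
have pp : \int[Pr]_w (W p w * W p w) = kappa * p by rewrite /Rintegral brownian_sqr.
move: pq; rewrite le_eqVlt => /predU1P[<-//|pq].
have sp := brownian_sqint p0; have sq := brownian_sqint q0.
have sI := increment_sqint p0 pq.
transitivity (\int[Pr]_w ((W q w - W p w) * W p w + W p w * W p w)).
  by apply: eq_Rintegral => w _; ring.
rewrite RintegralD//; [|exact: sqint_mul..].
rewrite Rintegral_mul_increment_indep// ?add0r// => A B sA mB.
have [_ _ _ ind _] := hW; apply: (ind p q) => //.
by apply: sigma_gen_preimage => //; exists p => //=; rewrite in_itv/= p0 lexx.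
Qed.

Lemma brownian_mean t : 0 <= t -> \int[Pr]_w W t w = 0.
Proof.
rewrite le_eqVlt => /predU1P[<-|t0].
  rewrite /Rintegral (ae_eq_integral (cst 0%E))//; first by rewrite integral0.
  - by apply/measurable_EFinP; exact: brownian_meas.
  - by apply: filterS brownian0_ae => w -> _.
rewrite -(increment_mean (lexx 0) t0) /Rintegral; congr fine; apply: ae_eq_integral => //.
- by apply/measurable_EFinP; exact: brownian_meas (ltW t0).
- by apply/measurable_EFinP; apply: increment_meas => //; exact: ltW.
- by apply: filterS brownian0_ae => w -> _; rewrite subr0.
Qed.

End brownian_moments.

Section step_integral_theory.
Context d (Omega : measurableType d) (R : realType) (Pr : probability Omega R).
Variable W : R -> Omega -> R.
Hypothesis hW : brownian_motion Pr W.
Notation kappa := (normal_var R).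
Notation leb := (@lebesgue_measure R).
Implicit Types phi : seq (R * R * R).

(** Each step on []a, b]] becomes a step on []0, b]] minus one on []0, a]], cut at [t]. Steps may
    overlap, which is harmless in this form: the integral is a combination of values [W p], whose
    covariance [min p q], up to the factor [kappa], is the inner product of the indicators of []0,
    p]] and []0, q]]. *)
Let points phi (t : R) : seq (R * R) :=
  flatten [seq [:: (q.2, Num.min q.1.2 t); (- q.2, Num.min q.1.1 t)] | q <- phi].

Let step_integralE phi t w :
  step_integral W phi t w = \sum_(x <- points phi t) x.1 * W x.2 w.
Proof.
rewrite /step_integral; elim: phi => [|q phi ih]; first by rewrite !big_nil.
by rewrite /points/= !big_cons/= -/(points phi t) -ih; ring.
Qed.

Let points_itv phi t x : step_ok phi -> 0 <= t -> x \in points phi t ->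
  0 <= x.2 <= t.
Proof.
move=> ok t0; elim: phi ok => // q phi ih /= /andP[/andP[q0 qq] ok].
rewrite /points/= !in_cons -/(points phi t) => /orP[/eqP->|/orP[/eqP->|/ih]] /=.
- by rewrite le_min ge_min lexx orbT t0 (le_trans q0)//.
- by rewrite le_min ge_min lexx orbT t0 q0.
- exact.
Qed.

Let step_funE phi t s : step_ok phi -> 0 <= t -> 0 <= s ->
  \sum_(x <- points phi t) x.1 * \1_(`]0, x.2] : set R) s =
  if s <= t then step_fun phi s else 0.
Proof.
move=> + t0 s0; rewrite /step_fun; elim: phi => [_|q phi ih /= /andP[/andP[q0 qq] ok]].
  by rewrite !big_nil if_same.
rewrite /points/= !big_cons/= -/(points phi t) ih// !indicE !mem_setE !in_itv/=.
rewrite !le_min.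
have [st|ts] := leP s t; last by rewrite !andbF !mulr0 !addr0.
rewrite !andbT addrA; congr (_ + _).
(* At time 0 every indicator vanishes, the intervals being open on the left. *)
have [s00|sp] := eqVneq s 0.
  by rewrite s00 ltxx/= ltNge q0/=; rewrite !mulr0 addr0.
have -> : 0 < s by rewrite lt_def sp.
rewrite /=; have [sa|as_] := leP s q.1.1.
  by rewrite (le_trans sa qq)/= mulr1 mulr0 mulNr mulr1 subrr.
by rewrite mulr0 addr0.
Qed.

Lemma step_integral_sqint phi t : step_ok phi -> 0 <= t ->
  sqint Pr setT (step_integral W phi t).
Proof.
move=> ok t0; apply: (@eq_sqint _ _ _ _ _
  (fun w => \sum_(x <- points phi t) x.1 * W x.2 w)).
  by move=> w _; rewrite step_integralE.
under eq_fun do rewrite big_seq.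
apply: sqint_sum => // x xJ; apply: sqintZ => //; apply: brownian_sqint => //.
by have /andP[] := points_itv ok t0 xJ.
Qed.

Lemma step_fun_measurable phi (D : set (measurableTypeR R)) :
  measurable_fun D (step_fun phi : measurableTypeR R -> R).
Proof. by apply: measurable_sum => q; exact: measurable_funM. Qed.

Lemma step_fun_sqint phi T : sqint leb `[0, T] (step_fun phi).
Proof.
apply: sqint_sum => // q _; apply: sqintZ => //.
apply: (@sqint_bounded _ _ _ _ _ _ 1) => //.
- exact: lebesgue_itv0_lty.
- by move=> s _; rewrite indicE; case: (_ \in _); rewrite ?normr1 ?normr0.
Qed.

(** Itô's isometry for step integrands: both squares are expanded over the same points and the
    coefficients match term by term. It becomes an inequality because the time integral is extended
    from [t] to [T]. *)
Lemma step_integral_sqr_le phi t T : step_ok phi -> 0 <= t -> t <= T ->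
  (\int[Pr]_w (step_integral W phi t w ^+ 2)%:E <=
   kappa%:E * \int[leb]_(s in `[0%R, T]) (step_fun phi s ^+ 2)%:E)%E.
Proof.
move=> ok t0 tT.
rewrite -EFin_Rintegral_sqr//; last exact: step_integral_sqint.
rewrite -EFin_Rintegral_sqr//; last exact: step_fun_sqint.
rewrite -EFinM lee_fin.
set J := points phi t; pose I p : R -> R := \1_(`]0, p] : set R).
have sI p : sqint leb `[0, T] (I p).
  apply: (@sqint_bounded _ _ _ _ _ _ 1) => //.
  - exact: lebesgue_itv0_lty.
  - exact: measurable_indic.
  - by move=> s _; rewrite /I indicE; case: (_ \in _); rewrite ?normr1 ?normr0.
have -> : \int[Pr]_w (step_integral W phi t w ^+ 2) =
    kappa * \int[leb]_(s in `[0, T]) ((\sum_(x <- J) x.1 * I x.2 s) ^+ 2).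
  under eq_Rintegral do rewrite step_integralE.
  rewrite !Rintegral_sum_sqr//; last first.
    by move=> x xJ; apply: brownian_sqint => //; have /andP[] := points_itv ok t0 xJ.
  rewrite mulr_sumr [LHS]big_seq [RHS]big_seq; apply: eq_bigr => x xJ.
  rewrite mulr_sumr [LHS]big_seq [RHS]big_seq; apply: eq_bigr => y yJ.
  have /andP[x0 xt] := points_itv ok t0 xJ; have /andP[y0 yt] := points_itv ok t0 yJ.
  rewrite brownian_cov// mulrCA; congr (_ * _); congr (_ * _).
  transitivity (\int[leb]_(s in `[0, T]) (I (Num.min x.2 y.2) s)); last first.
    apply: eq_Rintegral => s _; rewrite /I !indicE !mem_setE !in_itv/= le_min.
    by case: (0 < s); case: (s <= x.2); case: (s <= y.2); rewrite /= ?mulr0 ?mulr1 ?mul0r.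
  rewrite /Rintegral integral_indic//.
  have -> : (`]0, Num.min x.2 y.2]%classic : set R) `&` `[0, T]%classic = `]0, Num.min x.2 y.2]%classic.
    apply/seteqP; split => s /=; first by case.
    move=> sI'; split => //; move: sI'; rewrite !in_itv/= => /andP[/ltW -> sm]/=.
    by rewrite (le_trans sm)// ge_min (le_trans xt).
  transitivity (fine (@lebesgue_measure R `]0, Num.min x.2 y.2]%classic)) => //.
  rewrite lebesgue_measure_itv/= lte_fin; case: ifPn => [_|]; first by rewrite -EFinB/= subr0.
  by rewrite -leNgt => m0; apply/eqP; rewrite eq_le m0 le_min x0.
rewrite ler_wpM2l ?normal_var_ge0//.
have E s : `[0, T]%classic s -> \sum_(x <- J) x.1 * I x.2 s = if s <= t then step_fun phi s else 0.
  by rewrite /= in_itv/= => /andP[s0 sT]; exact: step_funE.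
apply: le_Rintegral => //.
- apply: sqint_sqr => //; apply: sqint_sum => // x _.
  exact: sqintZ.
- by apply: sqint_sqr => //; exact: step_fun_sqint.
- by move=> s sT; rewrite E//; case: ifP => // _; rewrite expr0n/= sqr_ge0.
Qed.

Lemma Rintegral_step_integral phi t (xi : Omega -> R) : step_ok phi -> 0 <= t ->
  sqint Pr setT xi ->
  \int[Pr]_w (step_integral W phi t w * xi w) =
  \sum_(q <- phi) q.2 * (\int[Pr]_w (W (Num.min q.1.2 t) w * xi w)
                        - \int[Pr]_w (W (Num.min q.1.1 t) w * xi w)).
Proof.
move=> ok t0 sxi.
have I q : q \in phi -> 0 <= Num.min q.1.1 t /\ 0 <= Num.min q.1.2 t.
  move=> /(allP ok)/andP[q0 qq]; rewrite !le_min q0 t0; split => //.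
  by rewrite (le_trans q0).
have I1 q : q \in phi -> Pr.-integrable setT (EFin \o (fun w => W (Num.min q.1.1 t) w * xi w)).
  by move=> /I[? ?]; apply: sqint_mul => //; exact: brownian_sqint.
have I2 q : q \in phi -> Pr.-integrable setT (EFin \o (fun w => W (Num.min q.1.2 t) w * xi w)).
  by move=> /I[? ?]; apply: sqint_mul => //; exact: brownian_sqint.
have IB q : q \in phi -> Pr.-integrable setT (EFin \o (fun w =>
    W (Num.min q.1.2 t) w * xi w - W (Num.min q.1.1 t) w * xi w)).
  by move=> qphi; exact: (integrableB _ (I2 _ qphi) (I1 _ qphi)).
transitivity (\int[Pr]_w (\sum_(q <- phi) q.2 *
    (W (Num.min q.1.2 t) w * xi w - W (Num.min q.1.1 t) w * xi w))).
  apply: eq_Rintegral => w _; rewrite /step_integral big_distrl/=.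
  by apply: eq_bigr => q _; ring.
have [|_ ->] := @Rintegral_sum _ _ _ Pr setT _ phi (fun q w => q.2 *
    (W (Num.min q.1.2 t) w * xi w - W (Num.min q.1.1 t) w * xi w)) measurableT.
  by move=> q qphi; exact: (integrableZl _ q.2 (IB _ qphi)).
rewrite [LHS]big_seq [RHS]big_seq; apply: eq_bigr => q qphi.
by rewrite RintegralZl//; [rewrite RintegralB//; [exact: I2|exact: I1]|exact: IB].
Qed.

End step_integral_theory.

Section wiener.
Context d (Omega : measurableType d) (R : realType) (Pr : probability Omega R).
Variable W : R -> Omega -> R.
Hypothesis hW : brownian_motion Pr W.
Notation kappa := (normal_var R).
Notation leb := (@lebesgue_measure R).
Variables (T : R) (g : R -> R).
Hypothesis sg : sqint leb `[0, T] g.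

Let cvg_lin (k : R) (u : nat -> \bar R) : (u @ \oo --> 0)%E ->
  ((fun m => k%:E * u m) @ \oo --> 0)%E.
Proof. by move=> u0; rewrite -[X in _ --> X](mule0 k%:E); apply: cvgeZl. Qed.

Let cvg_add (u v : nat -> \bar R) : (u @ \oo --> 0)%E -> (v @ \oo --> 0)%E ->
  ((fun m => u m + v m) @ \oo --> 0)%E.
Proof. by move=> u0 v0; rewrite -[X in _ --> X](adde0 0%E); apply: cvgeD. Qed.

(** [Y t] is compared with a step integral, and the step function with [g]; each comparison costs a
    factor 2, hence the 4. *)
Lemma wiener_sqr_le Y t : wiener_integral Pr T W g Y -> t \in `[0, T] ->
  measurable_fun setT (Y t) ->
  (\int[Pr]_w (Y t w ^+ 2)%:E <=
   (4 * kappa)%:E * \int[leb]_(s in `[0%R, T]) (g s ^+ 2)%:E)%E.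
Proof.
move=> [phi [ok cphi cY]] tT mY; have := tT; rewrite in_itv/= => /andP[t0 tT'].
have kap := normal_var_ge0 R.
apply: (@lee_vanishing _ _ _ (fun m => 2%:E * \int[Pr]_w
    ((Y t w - step_integral W (phi m) t w) ^+ 2)%:E + (4 * kappa)%:E *
    \int[leb]_(s in `[0%R, T]) ((step_fun (phi m) s - g s) ^+ 2)%:E)%E).
  by apply: cvg_add; apply: cvg_lin => //; exact: cY.
move=> m; set S := step_integral W (phi m) t.
have sS : sqint Pr setT S by exact: step_integral_sqint.
apply: (@le_trans _ _ (\int[Pr]_w (((Y t w - S w) + S w) ^+ 2)%:E)%E).
  by rewrite le_eqVlt; apply/orP; left; apply/eqP; apply: eq_integral => w _; rewrite subrK.
apply: (le_trans (integral_sqrD_le Pr measurableT _ _)).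
- by apply: measurable_funB => //; exact: sS.1.
- exact: sS.1.
rewrite -addeA; apply: leeD => //.
have h1 : (\int[Pr]_w (S w ^+ 2)%:E <=
    kappa%:E * \int[leb]_(s in `[0%R, T]) (step_fun (phi m) s ^+ 2)%:E)%E.
  exact: step_integral_sqr_le.
have h2 : (\int[leb]_(s in `[0%R, T]) (step_fun (phi m) s ^+ 2)%:E <=
    2%:E * \int[leb]_(s in `[0%R, T]) ((step_fun (phi m) s - g s) ^+ 2)%:E +
    2%:E * \int[leb]_(s in `[0%R, T]) (g s ^+ 2)%:E)%E.
  apply: (@le_trans _ _ (\int[leb]_(s in `[0%R, T])
     (((step_fun (phi m) s - g s) + g s) ^+ 2)%:E)%E).
    by rewrite le_eqVlt; apply/orP; left; apply/eqP; apply: eq_integral => w _; rewrite subrK.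
  apply: integral_sqrD_le => //; last exact: sg.1.
  by apply: measurable_funB; [exact: step_fun_measurable|exact: sg.1].
apply: (@le_trans _ _ (2%:E * (kappa%:E * \int[leb]_(s in `[0%R, T]) (step_fun (phi m) s ^+ 2)%:E)))%E.
  by apply: lee_wpmul2l.
rewrite muleA -EFinM.
apply: (le_trans (lee_wpmul2l _ h2)); first by rewrite lee_fin mulr_ge0.
rewrite muleDr//; last first.
  apply: ge0_adde_def; rewrite inE; apply: mule_ge0 => //;
    by apply: integral_ge0 => s _; rewrite lee_fin sqr_ge0.
rewrite !muleA -!EFinM.
by rewrite (_ : 2 * kappa * 2 = 4 * kappa)//; ring.
Qed.

(** The two approximating sequences may be unrelated. The difference of their step integrals is
    itself a step integral, of an integrand that tends to 0 in [L^2(0, T)], so the isometry bound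
    forces the limits to agree. *)
Lemma wiener_unique Y Y' t : wiener_integral Pr T W g Y ->
  wiener_integral Pr T W g Y' -> t \in `[0, T] ->
  measurable_fun setT (Y t) -> measurable_fun setT (Y' t) ->
  {ae Pr, forall w, Y t w - Y' t w = 0}.
Proof.
move=> [phi [ok cphi cY]] [phi' [ok' cphi' cY']] tT mY mY'.
have := tT; rewrite in_itv/= => /andP[t0 tT'].
have kap := normal_var_ge0 R.
have mD2 : measurable_fun setT (fun w => ((Y t w - Y' t w) ^+ 2)%:E).
  by apply/measurable_EFinP; apply: measurable_funX; exact: measurable_funB.
suff : (\int[Pr]_w ((Y t w - Y' t w) ^+ 2)%:E <= 0)%E.
  move=> le0; have eq0 : (\int[Pr]_w `|((Y t w - Y' t w) ^+ 2)%:E| = 0)%E.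
    apply/eqP; rewrite eq_le integral_ge0 ?andbT//.
    by under eq_integral do rewrite gee0_abs ?lee_fin ?sqr_ge0//.
  have := (ae_eq_integral_abs Pr measurableT mD2).1 eq0; apply: filterS => w /(_ I)/= [] /eqP.
  by rewrite sqrf_eq0 => /eqP.
pose a m := (\int[Pr]_w ((Y t w - step_integral W (phi m) t w) ^+ 2)%:E)%E.
pose a' m := (\int[Pr]_w ((Y' t w - step_integral W (phi' m) t w) ^+ 2)%:E)%E.
pose b m := (\int[leb]_(s in `[0%R, T]) ((step_fun (phi m) s - g s) ^+ 2)%:E)%E.
pose b' m := (\int[leb]_(s in `[0%R, T]) ((step_fun (phi' m) s - g s) ^+ 2)%:E)%E.
apply: (@lee_vanishing _ _ _ (fun m => (2%:E * a m + (4%:E * a' m +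
  ((4 * kappa * 2)%:E * b m + (4 * kappa * 2)%:E * b' m))))%E).
  apply: cvg_add; first by apply: cvg_lin; exact: cY.
  apply: cvg_add; first by apply: cvg_lin; exact: cY'.
  by apply: cvg_add; apply: cvg_lin.
move=> m; rewrite adde0.
set S := step_integral W (phi m) t; set S' := step_integral W (phi' m) t.
have sS : sqint Pr setT S by exact: step_integral_sqint.
have sS' : sqint Pr setT S' by exact: step_integral_sqint.
apply: (@le_trans _ _ (\int[Pr]_w (((Y t w - S w) + ((S' w - Y' t w) + (S w - S' w))) ^+ 2)%:E)%E).
  by rewrite le_eqVlt; apply/orP; left; apply/eqP; apply: eq_integral => w _; congr EFin; ring.
have mYS : measurable_fun setT (fun w => Y t w - S w).
  by apply: measurable_funB => //; exact: sS.1.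
have mYS' : measurable_fun setT (fun w => S' w - Y' t w).
  by apply: measurable_funB => //; exact: sS'.1.
have mSS' : measurable_fun setT (fun w => S w - S' w).
  by apply: measurable_funB; [exact: sS.1|exact: sS'.1].
apply: (le_trans (integral_sqrD_le Pr measurableT mYS (measurable_funD mYS' mSS'))).
apply: leeD => //.
apply: (@le_trans _ _ (2%:E * (2%:E * a' m + 2%:E * \int[Pr]_w ((S w - S' w) ^+ 2)%:E)))%E.
  apply: lee_wpmul2l => //; apply: (le_trans (integral_sqrD_le Pr measurableT mYS' mSS')).
  apply: leeD => //; apply: lee_wpmul2l => //.
  rewrite le_eqVlt; apply/orP; left; apply/eqP; apply: eq_integral => w _.
  by congr EFin; rewrite -sqrrN opprB.
have ge0i (f : Omega -> R) : (0 <= \int[Pr]_w (f w ^+ 2)%:E)%E.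
  by apply: integral_ge0 => w _; rewrite lee_fin sqr_ge0.
have ge0l (f : R -> R) : (0 <= \int[leb]_(s in `[0%R, T]) (f s ^+ 2)%:E)%E.
  by apply: integral_ge0 => w _; rewrite lee_fin sqr_ge0.
rewrite ge0_muleDr ?mule_ge0//; last exact: ge0i.
rewrite !muleA -!EFinM (_ : 2 * 2 = 4 :> R); last by ring.
apply: leeD => //.
(* Concatenation presents the difference as a single step integrand; overlapping intervals are
   allowed. *)
pose psi := phi m ++ [seq (q.1, - q.2) | q <- phi' m].
have psiok : step_ok psi.
  rewrite /step_ok all_cat all_map; apply/andP; split; first exact: ok.
  exact: (ok' m).
have SS w : S w - S' w = step_integral W psi t w.
  rewrite /step_integral big_cat/= big_map/=; congr (_ + _).
  by rewrite -sumrN; apply: eq_bigr => q _; rewrite mulNr.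
have ff s : step_fun psi s = step_fun (phi m) s - step_fun (phi' m) s.
  rewrite /step_fun big_cat/= big_map/=; congr (_ + _).
  by rewrite -sumrN; apply: eq_bigr => q _; rewrite mulNr.
under eq_integral do rewrite SS.
apply: (@le_trans _ _ (4%:E * (kappa%:E * (2%:E * b m + 2%:E * b' m))))%E.
  apply: lee_wpmul2l => //.
  apply: (le_trans (step_integral_sqr_le hW psiok t0 tT')).
  apply: lee_wpmul2l; first by rewrite lee_fin.
  under eq_integral do rewrite ff.
  apply: (@le_trans _ _ (\int[leb]_(s in `[0%R, T])
     (((step_fun (phi m) s - g s) + (g s - step_fun (phi' m) s)) ^+ 2)%:E)%E).
    by rewrite le_eqVlt; apply/orP; left; apply/eqP; apply: eq_integral => w _; congr EFin; ring.
  apply: le_trans; first apply: integral_sqrD_le => //.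
  - by apply: measurable_funB; [exact: step_fun_measurable|exact: sg.1].
  - by apply: measurable_funB; [exact: sg.1|exact: step_fun_measurable].
  apply: leeD => //; apply: lee_wpmul2l => //.
  rewrite le_eqVlt; apply/orP; left; apply/eqP; apply: eq_integral => w _.
  by congr EFin; rewrite -sqrrN opprB.
rewrite muleA -EFinM ge0_muleDr ?mule_ge0//; [|exact: ge0l|exact: ge0l].
by rewrite !muleA -!EFinM.
Qed.

Lemma wiener_sqint Y t : wiener_integral Pr T W g Y -> t \in `[0, T] ->
  measurable_fun setT (Y t) -> sqint Pr setT (Y t).
Proof.
move=> wY tT mY; split => //; apply: le_lt_trans (wiener_sqr_le wY tT mY) _.
by rewrite -EFin_Rintegral_sqr// -EFinM ltry.
Qed.

(** A step integral up to [t] is a combination of values [W p] with [p <= t]; orthogonality to these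
    passes to the limit. *)
Lemma wiener_orth_limit Y t (xi : Omega -> R) : wiener_integral Pr T W g Y ->
  t \in `[0, T] -> measurable_fun setT (Y t) -> sqint Pr setT xi ->
  (forall p, 0 <= p -> p <= t -> \int[Pr]_w (W p w * xi w) = 0) ->
  \int[Pr]_w (Y t w * xi w) = 0.
Proof.
move=> wY tT mY sxi h; have sY := wiener_sqint wY tT mY.
have := tT; rewrite in_itv/= => /andP[t0 tT'].
have [phi [ok cphi cY]] := wY.
apply: (@Rintegral_orth_limit _ _ _ _ _ _ (fun m => step_integral W (phi m) t)) => //.
- by move=> m; exact: step_integral_sqint.
- exact: cY.
- move=> m; rewrite Rintegral_step_integral// big_seq big1// => q qphi.
  have /andP[q0 qq] := allP (ok m) _ qphi.
  by rewrite !h ?subrr ?mulr0// ?ge_min ?lexx ?orbT// le_min t0 andbT// (le_trans q0).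
Qed.

Lemma wiener_increment_orth Y t (xi : Omega -> R) : wiener_integral Pr T W g Y ->
  t \in `[0, T] -> measurable_fun setT (Y t) -> measurable_fun setT (Y T) ->
  sqint Pr setT xi ->
  (forall p, t < p -> \int[Pr]_w ((W p w - W t w) * xi w) = 0) ->
  \int[Pr]_w ((Y T w - Y t w) * xi w) = 0.
Proof.
move=> wY tT mY mYT sxi h; have sY := wiener_sqint wY tT mY.
have := tT; rewrite in_itv/= => /andP[t0 tT'].
have T0 : 0 <= T by exact: le_trans tT'.
have TT : T \in `[0, T] by rewrite in_itv/= T0 lexx.
have sYT := wiener_sqint wY TT mYT.
have [phi [ok cphi cY]] := wY.
have sS m u : 0 <= u -> sqint Pr setT (step_integral W (phi m) u).
  by move=> u0; exact: step_integral_sqint.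
apply: (@Rintegral_orth_limit _ _ _ _ _ _ (fun m w =>
    step_integral W (phi m) T w - step_integral W (phi m) t w)) => //.
- exact: sqintB.
- by move=> m; apply: sqintB => //; exact: sS.
- apply: (@squeeze_cvge _ _ _ _ (fun=> 0%E) _
    (fun m => 2%:E * \int[Pr]_w ((Y T w - step_integral W (phi m) T w) ^+ 2)%:E +
      2%:E * \int[Pr]_w ((Y t w - step_integral W (phi m) t w) ^+ 2)%:E)%E).
  + near=> m; apply/andP; split.
      by apply: integral_ge0 => w _; rewrite lee_fin sqr_ge0.
    have mA : measurable_fun setT (fun w => Y T w - step_integral W (phi m) T w).
      by apply: measurable_funB => //; exact: (sS m T T0).1.
    have mB : measurable_fun setT (fun w => step_integral W (phi m) t w - Y t w).
      by apply: measurable_funB => //; exact: (sS m t t0).1.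
    apply: (@le_trans _ _ (\int[Pr]_w (((Y T w - step_integral W (phi m) T w) +
        (step_integral W (phi m) t w - Y t w)) ^+ 2)%:E)%E).
      by rewrite le_eqVlt; apply/orP; left; apply/eqP; apply: eq_integral => w _; congr EFin; ring.
    apply: (le_trans (integral_sqrD_le Pr measurableT mA mB)).
    apply: leeD => //; apply: lee_wpmul2l => //.
    rewrite le_eqVlt; apply/orP; left; apply/eqP; apply: eq_integral => w _.
    by congr EFin; rewrite -sqrrN opprB.
  + exact: cvg_cst.
  + by apply: cvg_add; apply: cvg_lin; exact: cY.
- move=> m; under eq_Rintegral do rewrite mulrBl.
  rewrite RintegralB//; [|by apply: sqint_mul => //; exact: sS..].
  rewrite !Rintegral_step_integral// -sumrB big_seq big1// => q qphi.
  have /andP[q0 qq] := allP (ok m) _ qphi.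
  (* A point [p <= t] contributes the same at both times; beyond [t], the contributions differ by an
     increment after [t], which is orthogonal to [xi]. *)
  have E p : 0 <= p -> \int[Pr]_w (W (Num.min p T) w * xi w) = \int[Pr]_w (W (Num.min p t) w * xi w).
    move=> p0; have [pt|tp] := leP p t; first by rewrite min_l// (le_trans pt).
    have pT0 : 0 <= Num.min p T by rewrite le_min p0.
    apply/eqP; rewrite -subr_eq0 -RintegralB//; last 2 first.
    - by apply: sqint_mul => //; exact: brownian_sqint.
    - by apply: sqint_mul => //; exact: brownian_sqint.
    under eq_Rintegral do rewrite -mulrBl.
    have [pT|Tp] := leP p T; first by rewrite h.
    move: tT'; rewrite le_eqVlt => /predU1P[->|tT'']; last by rewrite h.
    under eq_Rintegral do rewrite subrr mul0r.
    by rewrite Rintegral_cst// mul0r.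
  by rewrite !E// ?subrr// (le_trans q0).
Unshelve. all: by end_near. Qed.

End wiener.

Lemma ae_eq_Rintegral d (T : measurableType d) (R : realType)
    (mu : {measure set T -> \bar R}) (D : set T) (f g : T -> R) :
  measurable D -> measurable_fun D f -> measurable_fun D g ->
  {ae mu, forall x, D x -> f x = g x} ->
  \int[mu]_(x in D) f x = \int[mu]_(x in D) g x.
Proof.
move=> mD mf mg fg; congr fine; apply: ae_eq_integral => //.
- exact/measurable_EFinP.
- exact/measurable_EFinP.
- apply: (@filterS _ _ (ae_filter_ringOfSetsType mu) _ _ _ fg).
  by move=> x h Dx; rewrite h.
Qed.

(** * Duality and Gronwall, along paths and in the mean *)

Section pathwise.
Context (R : realType).
Notation Rm := (measurableTypeR R).
Notation leb := (@lebesgue_measure R).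
Variable T : R.
Hypothesis T0 : 0 <= T.
Notation IT := (`[0%R, T]%classic : set Rm).

Lemma sqint_itv_integrable (f : Rm -> R) : sqint leb IT f ->
  leb.-integrable IT (EFin \o f).
Proof. by move=> sf; apply: sqint_integrable => //; exact: lebesgue_itv0_lty. Qed.

Lemma lebesgue_itv0 (t : R) : 0 <= t -> leb (`[0%R, t]%classic : set Rm) = t%:E.
Proof.
move=> t0; have : @lebesgue_measure R `[0%R, t] = t%:E; last by [].
rewrite lebesgue_measure_itv/= lte_fin; case: ltP => [_|t0']; first by rewrite oppr0 adde0.
by congr EFin; apply/eqP; rewrite eq_le t0 t0'.
Qed.

(** With [B] the primitive of [b], the integral of [h b + h1 y] up to [t] is [h t * B t], and it
    vanishes at [T] because [h T = 0]. Hence the constant [X0] drops out, and integration by parts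
    transfers the derivative to the drift [bh]. The noise [M] is set aside, as it has no integral
    representation in time. *)
Lemma duality_path (h h1 x bh y b M : Rm -> R) (X0 c : R) :
  measurable_fun IT h -> measurable_fun IT h1 ->
  (forall t, IT t -> `|h t| <= c) -> (forall t, IT t -> `|h1 t| <= c) ->
  (forall t, IT t -> h t = h 0 + \int[leb]_(s in `[0, t]) h1 s) -> h T = 0 ->
  sqint leb IT bh -> sqint leb IT y -> sqint leb IT b ->
  (forall t, IT t -> x t = X0 + \int[leb]_(s in `[0, t]) bh s + M t) ->
  {ae leb, forall t, IT t -> y t - \int[leb]_(s in `[0, t]) b s = 0} ->
  \int[leb]_(t in IT) (h t * b t + h1 t * y t) = 0 /\
  \int[leb]_(t in IT) ((x t - M t) * (h t * b t + h1 t * y t)) =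
  \int[leb]_(t in IT) (- (bh t * (h t * y t))).
Proof.
move=> mh mh1 hc h1c hE hT sbh sy sb xE yE.
have Ib := sqint_itv_integrable sb; have Ibh := sqint_itv_integrable sbh.
have sh1 : sqint leb IT h1 by apply: (sqint_bounded _ _ mh1 h1c) => //; exact: lebesgue_itv0_lty.
have Ih1 := sqint_itv_integrable sh1.
pose B t := \int[leb]_(s in `[0, t]) b s.
pose H t := \int[leb]_(s in `[0, t]) h1 s.
pose beta t := h t * b t + h1 t * y t.
(* Version of [beta] in which [y] and [h] are replaced by their integral representations, ready for
   integration by parts. *)
pose beta' t := h 0 * b t + (h1 t * B t + b t * H t).
have shb : sqint leb IT (fun t => h t * b t) by exact: (sqintM _ mh hc sb).
have sh1y : sqint leb IT (fun t => h1 t * y t) by exact: (sqintM _ mh1 h1c sy).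
have sbeta : sqint leb IT beta by exact: sqintD.
have Ibeta := sqint_itv_integrable sbeta.
have [J1 J2 _] := Rintegral_prim_by_parts Ih1 Ib.
have Ihb : leb.-integrable IT (EFin \o (fun t => h 0 * b t)) by exact: (integrableZl _ (h 0) Ib).
have Ibeta' : leb.-integrable IT (EFin \o beta').
  exact: (integrableD _ Ihb (integrableD _ J1 J2)).
have bb : {ae leb, forall t, IT t -> beta t = beta' t}.
  apply: (@filterS _ _ (ae_filter_ringOfSetsType leb) _ _ _ yE) => t yt tI.
  have /eqP := yt tI; rewrite subr_eq0 => /eqP ytE.
  by rewrite /beta /beta' ytE hE// -/(H t) -/(B t); ring.
have sub t : IT t -> `[0, t]%classic `<=` IT.
  rewrite /= in_itv/= => /andP[_ tT].
  by apply: subset_itvl; rewrite bnd_simp.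
have intbeta t : IT t -> \int[leb]_(s in `[0, t]) beta s = h t * B t.
  move=> tI; have St := sub _ tI.
  have tT : t <= T by move: tI; rewrite /= in_itv/= => /andP[].
  transitivity (\int[leb]_(s in `[0, t]) beta' s).
    apply: ae_eq_Rintegral => //.
    - by apply: (measurable_funS _ St) => //; exact: sbeta.1.
    - apply: (measurable_funS _ St) => //.
      by apply/measurable_EFinP; exact: measurable_int Ibeta'.
    - apply: (@filterS _ _ (ae_filter_ringOfSetsType leb) _ _ _ bb) => s bs sI.
      by apply: bs; exact: St.
  have Ih1t := integrable_prim tT Ih1; have Ibt := integrable_prim tT Ib.
  have [K1 K2 KE] := Rintegral_prim_by_parts Ih1t Ibt.
  rewrite /beta' RintegralD//; last 2 first.
  - exact: (integrableZl _ (h 0) Ibt).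
  - exact: (integrableD _ K1 K2).
  rewrite RintegralZl// RintegralD// KE.
  by rewrite (hE t tI) -/(H t) -/(B t); ring.
have TI : IT T by rewrite /= in_itv/= T0 lexx.
have intT : \int[leb]_(t in IT) beta t = 0 by rewrite intbeta// hT mul0r.
split => //.
have [L1 L2 LE] := Rintegral_prim_by_parts Ibh Ibeta.
move: LE; rewrite -/beta intT mulr0 => /eqP; rewrite addrC addr_eq0 => /eqP LE.
transitivity (\int[leb]_(t in IT) (X0 * beta t + beta t * \int[leb]_(s in `[0, t]) bh s)).
  by apply: eq_Rintegral => t /set_mem tI; rewrite xE// /beta; set I0 := Rintegral _ _ _; ring.
rewrite RintegralD//; last exact: (integrableZl _ X0 Ibeta).
rewrite RintegralZl// intT mulr0 add0r LE -mulN1r -RintegralZl//.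
have mbh : measurable_fun IT bh by exact: sbh.1.
apply: ae_eq_Rintegral => //.
- apply: measurable_funM => //; apply/measurable_EFinP; exact: measurable_int L1.
- apply: measurableT_comp => //; apply: measurable_funM => //.
  by apply: measurable_funM => //; exact: sy.1.
- apply: (@filterS _ _ (ae_filter_ringOfSetsType leb) _ _ _ yE) => t yt tI.
  have /eqP := yt tI; rewrite subr_eq0 => /eqP ytE.
  by rewrite intbeta// mulN1r /B ytE.
Qed.

(** By Cauchy-Schwarz in time, [z^2 <= 2 c^2 + 2 T \int beta^2], and the bound on [beta] closes this
    for the sum over [k], though not for one component. The source [gam] is replaced by its total
    integral, a constant in time whose integration brings the second factor [T] of [2 * T ^+ 2]. *)
Lemma gronwall_system_path (I : finType) (z c beta : I -> Rm -> R) (gam : Rm -> R) (L : R) :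
  0 <= L ->
  (forall k, sqint leb IT (z k)) -> (forall k, measurable_fun IT (c k)) ->
  (forall k, measurable_fun IT (beta k)) -> measurable_fun IT gam ->
  (forall t, 0 <= gam t) ->
  (forall k, {ae leb, forall t, IT t ->
     z k t - c k t - \int[leb]_(s in `[0, t]) beta k s = 0}) ->
  (forall t, IT t -> \sum_k beta k t ^+ 2 <= L * \sum_k z k t ^+ 2 + gam t) ->
  (\int[leb]_(t in IT) (\sum_k z k t ^+ 2)%:E <=
   (2 * expR (2 * (2 * T * L + 1) * T) * (2 + 2 * T ^+ 2))%:E *
   (\int[leb]_(t in IT) (\sum_k c k t ^+ 2)%:E + \int[leb]_(t in IT) (gam t)%:E))%E.
Proof.
move=> L0 sz mc mb mg g0 zE bz.
(* The estimate yields [2 * T * L]; 1 is added because the scalar inequality asks for a positive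
   rate. *)
set C := 2 * T * L + 1.
have C0 : 0 < C by rewrite /C ltr_wpDl// !mulr_ge0.
have e0 : 0 < expR (2 * C * T) by exact: expR_gt0.
have K0 : 0 < 2 * expR (2 * C * T) * (2 + 2 * T ^+ 2).
  by rewrite !mulr_gt0// ltr_wpDr// mulr_ge0// sqr_ge0.
have c2 t : 0 <= \sum_k c k t ^+ 2 by apply: sumr_ge0 => k _; exact: sqr_ge0.
have z2 t : 0 <= \sum_k z k t ^+ 2 by apply: sumr_ge0 => k _; exact: sqr_ge0.
have ic0 : (0 <= \int[leb]_(t in IT) (\sum_k c k t ^+ 2)%:E)%E.
  by apply: integral_ge0 => t _; rewrite lee_fin.
have ig0 : (0 <= \int[leb]_(t in IT) (gam t)%:E)%E.
  by apply: integral_ge0 => t _; rewrite lee_fin.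
have [goo|goo] := eqVneq (\int[leb]_(t in IT) (gam t)%:E)%E +oo%E.
  rewrite goo addey; first by rewrite gt0_muley ?lte_fin// leey.
  by rewrite gt_eqF// (lt_le_trans _ ic0).
have Ig : leb.-integrable IT (EFin \o gam).
  by apply: ge0_integrable_lty => //; rewrite ltey.
have mphi : measurable_fun IT (fun t => \sum_k z k t ^+ 2).
  by apply: measurable_sum => k; apply: measurable_funX; exact: (sz k).1.
have Iphi : leb.-integrable IT (EFin \o (fun t => \sum_k z k t ^+ 2)).
  have J0 k : leb.-integrable IT (EFin \o (fun t => z k t ^+ 2)) by exact: sqint_sqr.
  have [//|J _] := @Rintegral_sum _ Rm _ leb IT _ (index_enum I) (fun k t => z k t ^+ 2) (measurable_itv _).
  exact: J.
have mc2 : measurable_fun IT (fun t => \sum_k c k t ^+ 2).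
  by apply: measurable_sum => k; exact: measurable_funX.
have ILg : leb.-integrable IT (EFin \o (fun t => L * \sum_k z k t ^+ 2 + gam t)).
  exact: (integrableD _ (integrableZl _ L Iphi) Ig).
have sb k : sqint leb IT (beta k).
  split => //; apply: le_lt_trans (integrable_lty _ ILg) => //.
  apply: ge0_le_integral => //.
  - by move=> t _; rewrite lee_fin sqr_ge0.
  - by apply/measurable_EFinP; apply: measurable_funX.
  - exact: measurable_int ILg.
  - move=> t tI; rewrite lee_fin; apply: le_trans (bz _ tI).
    by rewrite (bigD1 k)//= lerDl sumr_ge0// => j _; exact: sqr_ge0.
pose G := \int[leb]_(t in IT) gam t.
have G0 : 0 <= G by apply: Rintegral_ge0.
pose alpha t := 2 * \sum_k c k t ^+ 2 + 2 * T * G.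
have a0 t : 0 <= alpha t by rewrite addr_ge0// !mulr_ge0.
have malpha : measurable_fun IT alpha.
  by apply: measurable_funD => //; apply: measurable_funM.
have main : {ae leb, forall t, IT t -> \sum_k z k t ^+ 2 <=
    alpha t + C * \int[leb]_(s in `[0, t]) \sum_k z k s ^+ 2}.
  (* The exceptional times of the finitely many components are merged by numbering [I]. *)
  have zE' : {ae leb, forall t, forall k, IT t -> z k t - c k t - \int[leb]_(s in `[0, t]) beta k s = 0}.
    have := @ae_foralln _ _ _ leb (fun j t => forall k : I, enum_rank k = j :> nat -> IT t ->
        z k t - c k t - \int[leb]_(s in `[0, t]) beta k s = 0).
    move=> h; have {}h : {ae leb, forall t, forall j, forall k : I, enum_rank k = j :> nat -> IT t ->
        z k t - c k t - \int[leb]_(s in `[0, t]) beta k s = 0}.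
      apply: h => j; have [jI|jI] := ltnP j #|I|.
        apply: (@filterS _ _ (ae_filter_ringOfSetsType leb) _ _ _ (zE (enum_val (Ordinal jI)))).
        move=> t ht k kj; have -> : k = enum_val (Ordinal jI).
          by apply: (canRL (@enum_rankK I)); apply: val_inj.
        exact: ht.
      apply: aeW => t k kj; have := ltn_ord (enum_rank k).
      by rewrite kj ltnNge jI.
    apply: (@filterS _ _ (ae_filter_ringOfSetsType leb) _ _ _ h) => t ht k.
    exact: (ht (enum_rank k)).
  apply: (@filterS _ _ (ae_filter_ringOfSetsType leb) _ _ _ zE') => t zt tI.
  have := tI; rewrite /= in_itv/= => /andP[t0 tT].
  have Igt := integrable_prim tT Ig; have Iphit := integrable_prim tT Iphi.
  have Sub : `[0, t]%classic `<=` IT by apply: subset_itvl; rewrite bnd_simp.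
  have sbt k : sqint leb `[0, t] (beta k).
    exact: (@sqintS _ Rm R leb IT (`[0%R, t]%classic : set Rm) _ (measurable_itv _) (measurable_itv _) Sub (sb k)).
  have step1 k : z k t ^+ 2 <= 2 * c k t ^+ 2 + 2 * T * \int[leb]_(s in `[0, t]) (beta k s ^+ 2).
    have -> : z k t = c k t + \int[leb]_(s in `[0, t]) beta k s.
      by have /eqP := zt k tI; rewrite subr_eq0 subr_eq addrC => /eqP.
    set J := Rintegral _ _ _.
    have : J ^+ 2 <= T * \int[leb]_(s in `[0, t]) (beta k s ^+ 2).
      apply: le_trans (Rintegral_sqr_le _ _ (sbt k)) _ => //; first exact: lebesgue_itv0_lty.
      apply: ler_wpM2r; first by apply: Rintegral_ge0 => s _; exact: sqr_ge0.
      by rewrite [X in fine X](_ : _ = t%:E); [|exact: lebesgue_itv0].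
    have := sqr_ge0 (c k t - J); nra.
  apply: (@le_trans _ _ (\sum_k (2 * c k t ^+ 2 + 2 * T * \int[leb]_(s in `[0, t]) (beta k s ^+ 2)))).
    exact: ler_sum.
  rewrite big_split/= -!mulr_sumr /alpha -addrA lerD2l.
  have J0 k : leb.-integrable `[0, t] (EFin \o (fun t => beta k t ^+ 2)) by exact: sqint_sqr.
  have [//|J1 <-] := @Rintegral_sum _ Rm _ leb `[0, t] _ (index_enum I) (fun k t => beta k t ^+ 2) (measurable_itv _).
  have le1 : \int[leb]_(s in `[0, t]) (\sum_k beta k s ^+ 2) <=
      L * \int[leb]_(s in `[0, t]) (\sum_k z k s ^+ 2) + G.
    apply: (@le_trans _ _ (\int[leb]_(s in `[0, t]) (L * \sum_k z k s ^+ 2 + gam s))).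
      apply: le_Rintegral => //.
      - exact: (integrable_prim tT ILg).
      - by move=> s /Sub sI; exact: bz.
    rewrite RintegralD//; last exact: (integrableZl _ L Iphit).
    rewrite RintegralZl// lerD2l -lee_fin /G /Rintegral !fineK; last 2 first.
    - exact: integrable_fin_num.
    - exact: integrable_fin_num.
    apply: ge0_subset_integral => //; first exact: measurable_int Ig.
    by move=> s _; rewrite lee_fin.
  have P0 : 0 <= \int[leb]_(s in `[0, t]) (\sum_k z k s ^+ 2) by apply: Rintegral_ge0.
  apply: (le_trans (ler_wpM2l _ le1)); first by rewrite mulr_ge0.
  move: P0; set I0 := Rintegral _ _ _ => P0.
  by rewrite -subr_ge0 (_ : _ - _ = I0)// /C; ring.
apply: (le_trans (integral_gronwall T0 C0 z2 a0 malpha Iphi main)).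
rewrite [X in (_ <= X * _)%E]EFinM -muleA; apply: lee_wpmul2l; first by rewrite lee_fin mulr_ge0 ?expR_ge0.
rewrite /alpha; under eq_integral do rewrite EFinD EFinM.
rewrite ge0_integralD//; last 3 first.
- by move=> t _; rewrite -EFinM lee_fin mulr_ge0.
- by apply: measurable_funeM; apply/measurable_EFinP.
- by move=> t _; rewrite lee_fin !mulr_ge0.
rewrite ge0_integralZl//; [|by apply/measurable_EFinP|by move=> t _; rewrite lee_fin].
rewrite integral_cst//.
rewrite [X in (_ + _ * X <= _)%E](_ : _ = T%:E); last exact: lebesgue_itv0.
have GE : (\int[leb]_(t in IT) (gam t)%:E = G%:E)%E.
  by rewrite /G /Rintegral fineK//; exact: integrable_fin_num.
rewrite GE; suff fin (I1 : \bar R) : (0 <= I1 -> 2%:E * I1 + (2 * T * G)%:E * T%:E <=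
  (2 + 2 * T ^+ 2)%:E * (I1 + G%:E))%E by exact: (fin _ ic0).
move=> I10; rewrite ge0_muleDr ?lee_fin//; apply: leeD.
- by apply: lee_wpmul2r => //; rewrite lee_fin lerDl mulr_ge0 ?sqr_ge0.
- by rewrite -!EFinM lee_fin; have := mulr_ge0 T0 G0; have := sqr_ge0 T; nra.
Qed.

End pathwise.

Section process.
Context d (Omega : measurableType d) (R : realType) (Pr : probability Omega R).
Variable T : R.
Hypothesis T0 : 0 <= T.
Notation Rm := (measurableTypeR R).
Notation leb := (@lebesgue_measure R).
Notation mu := (leb \x Pr)%E.
Notation IT := (`[0%R, T]%classic : set Rm).
Notation strip := (@strip d Omega R T).

(* The martingale part [M] may be frozen at its terminal value, its increments being
   orthogonal to [h b + h1 y]; the latter is the derivative of [h y] along paths. *)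
Lemma duality_process (h h1 : Rm -> R) (x bh y b M : Rm * Omega -> R)
    (X0 : Omega -> R) (c : R) :
  measurable_fun IT h -> measurable_fun IT h1 ->
  (forall t, IT t -> `|h t| <= c) -> (forall t, IT t -> `|h1 t| <= c) ->
  (forall t, IT t -> h t = h 0 + \int[leb]_(s in `[0, t]) h1 s) -> h T = 0 ->
  sqint mu strip x -> sqint mu strip bh -> sqint mu strip y ->
  sqint mu strip b -> sqint mu strip M ->
  sqint Pr setT (fun w => M (T, w)) ->
  (forall t w, IT t -> x (t, w) = X0 w + \int[leb]_(s in `[0, t]) bh (s, w) + M (t, w)) ->
  {ae Pr, forall w, {ae leb, forall t, IT t ->
    y (t, w) - \int[leb]_(s in `[0, t]) b (s, w) = 0}} ->
  (forall t, IT t -> sqint Pr setT (fun w => h t * b (t, w) + h1 t * y (t, w)) ->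
     \int[Pr]_w ((M (T, w) - M (t, w)) * (h t * b (t, w) + h1 t * y (t, w))) = 0) ->
  \int[mu]_(p in strip) (x p * (h p.1 * b p + h1 p.1 * y p) + bh p * (h p.1 * y p)) = 0.
Proof.
move=> mh mh1 hc h1c hE hT sx sbh sy sb sM sMT xE yE orth.
have mst := @measurable_strip d Omega R T.
pose beta p := h p.1 * b p + h1 p.1 * y p.
have mh' : measurable_fun strip (fun p => h p.1) by exact: measurable_strip_det.
have mh1' : measurable_fun strip (fun p => h1 p.1) by exact: measurable_strip_det.
have sh (f : Rm * Omega -> R) : sqint mu strip f -> sqint mu strip (fun p => h p.1 * f p).
  by move=> sf; apply: (@sqintM _ _ _ _ _ _ _ c) => // p [pI _]; exact: hc.
have sbeta : sqint mu strip beta.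
  apply: sqintD => //; first exact: sh.
  by apply: (@sqintM _ _ _ _ _ _ _ c) => // p [pI _]; exact: h1c.
have sMT' : sqint mu strip (fun p => M (T, p.2)).
  exact: (sqint_strip_omega T sMT).
have I1 := sqint_mul mst sx sbeta.
have I2 := sqint_mul mst sbh (sh _ sy).
have I3 := sqint_mul mst sM sbeta.
have I4 := sqint_mul mst (sqintB mst sx sM) sbeta.
have I5 := sqint_mul mst sMT' sbeta.
have path : {ae Pr, forall w,
    \int[leb]_(t in IT) beta (t, w) = 0 /\
    \int[leb]_(t in IT) ((x (t, w) - M (t, w)) * beta (t, w)) =
    \int[leb]_(t in IT) (- (bh (t, w) * (h t * y (t, w))))}.
  have P1 := sqint_path sbh; have P2 := sqint_path sy; have P3 := sqint_path sb.
  near=> w.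
  apply: (@duality_path R T T0 h h1 (fun t => x (t, w)) (fun t => bh (t, w))
    (fun t => y (t, w)) (fun t => b (t, w)) (fun t => M (t, w)) (X0 w) c) => //.
  - by near: w.
  - by near: w.
  - by near: w.
  - by move=> t tI; exact: xE.
  - by near: w.
have E1 : \int[mu]_(p in strip) ((x p - M p) * beta p) =
    \int[mu]_(p in strip) (- (bh p * (h p.1 * y p))).
  apply: strip_eq_path => //.
  - exact: (integrableN I2).
  - by apply: filterS path => w [].
have E2 : \int[mu]_(p in strip) (M p * beta p) =
    \int[mu]_(p in strip) (M (T, p.2) * beta p).
  apply: strip_eq_time => //.
  have Q1 := sqint_time sM; have Q2 := sqint_time sbeta.
  apply: (@filterS2 _ _ (ae_filter_ringOfSetsType leb) _ _ _ _ Q1 Q2) => t S1 S2 tI.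
  have {}S1 := S1 tI; have {}S2 := S2 tI.
  apply/eqP; rewrite eq_sym -subr_eq0 -RintegralB//; last 2 first.
  - exact: sqint_mul.
  - exact: sqint_mul.
  under eq_Rintegral do rewrite -mulrBl.
  by rewrite orth.
have E3 : \int[mu]_(p in strip) (M (T, p.2) * beta p) = 0.
  rewrite (strip_eq_path (g := cst 0) I5).
  - by rewrite Rintegral_cst// mul0r.
  - by apply: sqint_integrable => //; [exact: strip_measure_lty|exact: sqint0].
  - have Q2 := sqint_path sbeta.
    near=> w; rewrite Rintegral_cst//= mul0r RintegralZl//.
      rewrite (_ : \int[leb]_(t in IT) beta (t, w) = 0) ?mulr0//.
      by near: w; apply: filterS path => w [].
    by apply: sqint_itv_integrable; near: w.
rewrite RintegralD//.
have -> : \int[mu]_(p in strip) (x p * (h p.1 * b p + h1 p.1 * y p)) =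
    \int[mu]_(p in strip) ((x p - M p) * beta p) + \int[mu]_(p in strip) (M p * beta p).
  rewrite -RintegralD//; apply: eq_Rintegral => p _; rewrite /beta; ring.
rewrite E2 E3 addr0 E1.
under eq_Rintegral do rewrite -mulN1r.
by rewrite RintegralZl// mulN1r addNr.
Unshelve. all: by end_near. Qed.

(** Paths are assumed square integrable almost surely, and both sides live in [[0, +oo]]: a finite
    right side then proves square integrability of [z] over the strip. *)
Lemma gronwall_process (I : finType) (z c beta : I -> Rm * Omega -> R)
    (gam : Rm * Omega -> R) (L : R) : 0 <= L ->
  (forall k, measurable_fun strip (z k)) -> (forall k, measurable_fun strip (c k)) ->
  (forall k, measurable_fun strip (beta k)) -> measurable_fun strip gam ->
  (forall p, 0 <= gam p) ->
  (forall k, {ae Pr, forall w, sqint leb IT (fun t => z k (t, w))}) ->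
  (forall k, {ae Pr, forall w, {ae leb, forall t, IT t ->
     z k (t, w) - c k (t, w) - \int[leb]_(s in `[0, t]) beta k (s, w) = 0}}) ->
  (forall p, strip p -> \sum_k beta k p ^+ 2 <= L * \sum_k z k p ^+ 2 + gam p) ->
  (\int[mu]_(p in strip) (\sum_k z k p ^+ 2)%:E <=
   (2 * expR (2 * (2 * T * L + 1) * T) * (2 + 2 * T ^+ 2))%:E *
   (\int[mu]_(p in strip) (\sum_k c k p ^+ 2)%:E +
    \int[mu]_(p in strip) (gam p)%:E))%E.
Proof.
move=> L0 mz mc mb mg g0 sz zE bz.
have ms (f : I -> Rm * Omega -> R) : (forall k, measurable_fun strip (f k)) ->
    measurable_fun strip (fun p => (\sum_k f k p ^+ 2)%:E).
  move=> mf; apply/measurable_EFinP; apply: measurable_sum => k.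
  exact: measurable_funX.
have p0 (f : I -> Rm * Omega -> R) p : (0 <= (\sum_k f k p ^+ 2)%:E)%E.
  by rewrite lee_fin; apply: sumr_ge0 => k _; exact: sqr_ge0.
have mg' : measurable_fun strip (fun p => (gam p)%:E) by exact/measurable_EFinP.
have mst := @measurable_strip d Omega R T.
rewrite -ge0_integralD//; last 2 first.
- exact: (ms _ mc).
- by move=> p _; rewrite lee_fin.
have mcg : measurable_fun strip (fun p => (\sum_k c k p ^+ 2)%:E + (gam p)%:E)%E.
  by apply: emeasurable_funD => //; exact: (ms _ mc).
have cg0 p : (0 <= (\sum_k c k p ^+ 2)%:E + (gam p)%:E)%E.
  by rewrite adde_ge0// lee_fin.
set K := 2 * _ * _.
have K0 : 0 <= K.
  by rewrite /K mulr_ge0// ?mulr_ge0 ?expR_ge0// addr_ge0// mulr_ge0// sqr_ge0.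
rewrite -ge0_integralZl//.
have mKcg : measurable_fun strip (fun p => K%:E * ((\sum_k c k p ^+ 2)%:E + (gam p)%:E))%E.
  exact: measurable_funeM.
have Kcg0 p : strip p -> (0 <= K%:E * ((\sum_k c k p ^+ 2)%:E + (gam p)%:E))%E.
  by move=> _; apply: mule_ge0; [rewrite lee_fin|exact: cg0].
rewrite (strip_tonelli_omega Pr (ms _ mz))// (strip_tonelli_omega Pr mKcg Kcg0).
have mL : measurable_fun setT (fun w => \int[leb]_(t in IT) (\sum_k z k (t, w) ^+ 2)%:E)%E.
  exact: (measurable_strip_int_omega (ms _ mz) (fun p _ => p0 _ p)).
have mR : measurable_fun setT (fun w => \int[leb]_(t in IT)
    (K%:E * ((\sum_k c k (t, w) ^+ 2)%:E + (gam (t, w))%:E)))%E.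
  exact: (measurable_strip_int_omega mKcg Kcg0).
apply: ae_ge0_le_integral => //.
- by move=> w _; apply: integral_ge0.
- move=> w _; apply: integral_ge0 => t _.
  by apply: mule_ge0; [rewrite lee_fin|exact: (cg0 (t, w))].
have szA : {ae Pr, forall w, forall k, sqint leb IT (fun t => z k (t, w))}.
  have := @filter_forall _ _ _ _ (ae_filter_ringOfSetsType Pr) sz.
  by apply: filterS.
have zEA : {ae Pr, forall w, forall k, {ae leb, forall t, IT t ->
     z k (t, w) - c k (t, w) - \int[leb]_(s in `[0, t]) beta k (s, w) = 0}}.
  have := @filter_forall _ _ _ _ (ae_filter_ringOfSetsType Pr) zE.
  by apply: filterS.
near=> w => _.
have mt (f : Rm * Omega -> R) : measurable_fun strip f ->
  measurable_fun IT (fun t => f (t, w)) by exact: measurable_strip_time.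
rewrite ge0_integralZl//; last first.
- by apply: (measurable_strip_time (F := fun p => (\sum_k c k p ^+ 2)%:E + (gam p)%:E)%E).
rewrite ge0_integralD//; last 3 first.
- exact: (measurable_strip_time (F := fun p => (\sum_k c k p ^+ 2)%:E) _ (ms _ mc)).
- by move=> t _; rewrite lee_fin.
- exact: (measurable_strip_time (F := fun p => (gam p)%:E) _ mg').
apply: (@gronwall_system_path R T T0 I (fun k t => z k (t, w))
  (fun k t => c k (t, w)) (fun k t => beta k (t, w)) (fun t => gam (t, w)) L) => //.
- by near: w; apply: szA.
- by move=> k; exact: mt.
- by move=> k; exact: mt.
- exact: mt.
- by near: w; apply: zEA.
- by move=> t tI; apply: bz.
Unshelve. all: by end_near. Qed.

End process.

(** * Primitives and the symmetry of Riccati solutions *)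

Section primitives.
Context (R : realType).
Notation Rm := (measurableTypeR R).
Notation leb := (@lebesgue_measure R).
Variable T : R.
Hypothesis T0 : 0 < T.
Notation IT := (`[0%R, T]%classic : set Rm).

(** Bounded rather than square integrable, in order to be stable under products. *)
Definition mbounded (f : Rm -> R) :=
  measurable_fun IT f /\ exists c : R, forall t, IT t -> `|f t| <= c.

Lemma mbounded_cst k : mbounded (fun=> k).
Proof. by split => //; exists `|k|. Qed.

Lemma mboundedD f g : mbounded f -> mbounded g -> mbounded (fun t => f t + g t).
Proof.
move=> [mf [c fc]] [mg [c' gc]]; split; first exact: measurable_funD.
exists (c + c') => t tI; apply: le_trans (ler_normD _ _) _.
by apply: lerD; [exact: fc|exact: gc].
Qed.

Lemma mboundedM f g : mbounded f -> mbounded g -> mbounded (fun t => f t * g t).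
Proof.
move=> [mf [c fc]] [mg [c' gc]]; split; first exact: measurable_funM.
by exists (c * c') => t tI; rewrite normrM ler_pM//; [exact: fc|exact: gc].
Qed.

Lemma mbounded_integrable f : mbounded f -> leb.-integrable IT (EFin \o f).
Proof.
move=> [mf [c fc]]; apply: sqint_itv_integrable.
by apply: (sqint_bounded _ _ mf fc) => //; exact: lebesgue_itv0_lty.
Qed.

Lemma within_mbounded (f : R -> R) : {within `[0, T], continuous f} -> mbounded f.
Proof.
move=> cf; split.
  exact: subspace_continuous_measurable_fun.
have /compact_bounded[M [_ mrt]] := continuous_compact cf (@segment_compact _ 0 T).
exists (M + 1) => t tI; apply: (mrt (M + 1)) => //; first by rewrite ltrDl.
Qed.

(* Derivatives are only used through primitives: products are differentiated by
   Fubini, and the end points need no care. *)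
Definition prim (F f : Rm -> R) := [/\ mbounded F, mbounded f &
  forall t, IT t -> F t = F 0 + \int[leb]_(s in `[0, t]) f s].

Lemma prim_FTC (F f : R -> R) : {within `[0, T], continuous F} ->
  {within `[0, T], continuous f} ->
  (forall t, t \in `]0, T[ -> derivable F t 1 /\ F^`()%classic t = f t) -> prim F f.
Proof.
move=> cF cf dF; split; [exact: within_mbounded..|].
move=> t; rewrite /= in_itv/= => /andP[]; rewrite le_eqVlt => /predU1P[<- _|t0 tT].
  rewrite set_itv1 /Rintegral integral_set1 ?addr0//.
have sub : `[0, t]%classic `<=` (`[0, T]%classic : set R).
  by apply: subset_itvl; rewrite bnd_simp.
have cFt := continuous_subspaceW sub cF.
have cft := continuous_subspaceW sub cf.
have dFt s : s \in `]0, t[ -> derivable F s 1 /\ F^`()%classic s = f s.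
  rewrite in_itv/= => /andP[s0 st]; apply: dF.
  by rewrite in_itv/= s0 (lt_le_trans st).
have -> : \int[leb]_(s in `[0, t]) f s = F t - F 0; last by rewrite addrC subrK.
rewrite /Rintegral (continuous_FTC2 (F := F) t0 cft)//.
- have /(continuous_within_itvP _ t0)[_ F0 Ft] := cFt.
  by split => // s /dFt[].
- by move=> s /dFt[].
Qed.

Lemma prim_cst k : prim (fun=> k) (fun=> 0).
Proof.
split; [exact: mbounded_cst..|] => t tI.
by rewrite Rintegral_cst//= mul0r addr0.
Qed.

Let sub_itv t : IT t -> t <= T.
Proof. by rewrite /= in_itv/= => /andP[]. Qed.

Let mbounded_integrable_itv f t : mbounded f -> IT t ->
  leb.-integrable `[0, t] (EFin \o f).
Proof. by move=> bf /sub_itv tT; apply: (integrable_prim tT); exact: mbounded_integrable. Qed.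

Lemma primD F f G g : prim F f -> prim G g -> prim (fun t => F t + G t) (fun t => f t + g t).
Proof.
move=> [bF bf FE] [bG bg GE]; split; [exact: mboundedD..|] => t tI.
rewrite RintegralD//; [|exact: mbounded_integrable_itv..].
by rewrite FE// (GE t)// addrACA.
Qed.

Lemma primM F f G g : prim F f -> prim G g ->
  prim (fun t => F t * G t) (fun t => f t * G t + F t * g t).
Proof.
move=> [bF bf FE] [bG bg GE].
split; [exact: mboundedM|by apply: mboundedD; exact: mboundedM|] => t tI.
have If := mbounded_integrable_itv bf tI; have Ig := mbounded_integrable_itv bg tI.
have [J1 J2 JE] := Rintegral_prim_by_parts If Ig.
have tT := sub_itv tI.
have subt s : `[0, t]%classic s -> IT s.
  by rewrite /= !in_itv/= => /andP[-> st]; rewrite (le_trans st).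
transitivity (F 0 * G 0 + \int[leb]_(s in `[0, t])
   ((G 0 * f s + F 0 * g s) + (f s * \int[leb]_(r in `[0, s]) g r +
     g s * \int[leb]_(r in `[0, s]) f r))); last first.
  congr (_ + _); apply: eq_Rintegral => s /set_mem/subt sI.
  by rewrite (FE s)// (GE s)//; set I1 := Rintegral _ _ _; set I2 := Rintegral _ _ _; ring.
have I1 : leb.-integrable `[0, t] (EFin \o (fun s => G 0 * f s)).
  exact: (integrableZl _ (G 0) If).
have I2 : leb.-integrable `[0, t] (EFin \o (fun s => F 0 * g s)).
  exact: (integrableZl _ (F 0) Ig).
have I12 : leb.-integrable `[0, t] (EFin \o (fun s => G 0 * f s + F 0 * g s)).
  exact: (integrableD _ I1 I2).
have J12 : leb.-integrable `[0, t] (EFin \o (fun s => f s * \int[leb]_(r in `[0, s]) g r +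
     g s * \int[leb]_(r in `[0, s]) f r)) by exact: (integrableD _ J1 J2).
rewrite (RintegralD _ I12 J12)// (RintegralD _ I1 I2)// (RintegralD _ J1 J2)// JE.
rewrite !RintegralZl// (FE t)// (GE t)//.
by set K1 := Rintegral _ _ _; set K2 := Rintegral _ _ _; ring.
Qed.

Lemma prim_sum (I : Type) (s : seq I) (F f : I -> Rm -> R) :
  (forall i, prim (F i) (f i)) ->
  prim (fun t => \sum_(i <- s) F i t) (fun t => \sum_(i <- s) f i t).
Proof.
move=> h; elim: s => [|i s ih].
  have -> : (fun t => \sum_(j <- [::]) F j t) = fun=> 0.
    by apply/funext => t; rewrite big_nil.
  have -> : (fun t => \sum_(j <- [::]) f j t) = fun=> 0.
    by apply/funext => t; rewrite big_nil.
  exact: prim_cst.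
have E (f' : I -> Rm -> R) :
    (fun t => \sum_(j <- i :: s) f' j t) = fun t => f' i t + \sum_(j <- s) f' j t.
  by apply/funext => t; rewrite big_cons.
by rewrite !E; exact: primD.
Qed.

Lemma primZ k F f : prim F f -> prim (fun t => k * F t) (fun t => k * f t).
Proof.
move=> pF; have := primM (prim_cst k) pF.
by congr prim; apply/funext => t; rewrite mul0r add0r.
Qed.

Lemma primB F f G g : prim F f -> prim G g -> prim (fun t => F t - G t) (fun t => f t - g t).
Proof.
move=> pF pG; have := primD pF (primZ (-1) pG).
by congr prim; apply/funext => t; rewrite mulN1r.
Qed.

Lemma continuous_expR_lin k : continuous (fun t : R => expR (k * t)).
Proof.
move=> t; apply: continuous_comp; last exact: continuous_expR.
by apply: cvgM; [exact: cvg_cst|exact: cvg_id].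
Qed.

Lemma prim_expR k : prim (fun t => expR (k * t)) (fun t => k * expR (k * t)).
Proof.
have c1 := @continuous_expR_lin k.
apply: prim_FTC.
- exact: continuous_subspaceT.
- by apply: continuous_subspaceT => t; apply: cvgM; [exact: cvg_cst|exact: c1].
- move=> t _.
  have h : is_derive t 1 (fun t : R => expR (k * t)) (k * expR (k * t)).
    have h1 : is_derive t 1 (fun s : R => k * s) k.
      by have := is_deriveZ k (is_derive_id t 1); rewrite /GRing.scale/= mulr1.
    by rewrite mulrC; exact: (is_derive1_comp (is_derive_expR (k * t)) h1).
  by split; [exact: ex_derive|rewrite derive1E derive_val].
Qed.

Lemma prim_mono F f : prim F f -> (forall t, IT t -> 0 <= f t) ->
  forall t, IT t -> F t <= F T.
Proof.
move=> [bF bf FE] f0 t tI.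
have TI : IT T by rewrite /= in_itv/= ltW//= lexx.
rewrite (FE t)// (FE T)// lerD2l.
have E s : IT s -> (\int[leb]_(r in `[0, s]) f r)%:E = (\int[leb]_(r in `[0%R, s]) (f r)%:E)%E.
  by move=> sI; rewrite /Rintegral fineK//; apply: integrable_fin_num => //;
    exact: (mbounded_integrable_itv bf sI).
rewrite -lee_fin !E//; apply: ge0_subset_integral => //.
- exact: measurable_int (mbounded_integrable bf).
- by apply: subset_itvl; rewrite bnd_simp (sub_itv tI).
Qed.

End primitives.

Section matrix_primitives.
Context (R : realType).
Notation Rm := (measurableTypeR R).
Notation leb := (@lebesgue_measure R).
Variable T : R.
Hypothesis T0 : 0 < T.
Notation IT := (`[0%R, T]%classic : set Rm).

Definition mx_continuous m n (F : R -> 'M[R]_(m, n)) :=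
  forall i j, {within `[0, T], continuous (fun t => F t i j)}.

Lemma within_mx_continuous m n (F : R -> 'M[R]_(m, n)) (D : set R) :
  `[0, T] `<=` D -> {within D, continuous F} -> mx_continuous F.
Proof.
move=> TD /(continuous_subspaceW TD) cF i j t.
by apply: (@cvg_comp _ _ _ F (fun M : 'M[R]_(m, n) => M i j)) (cF t) _;
  exact: coord_continuous.
Qed.

Lemma mx_continuous_cst m n (M : 'M[R]_(m, n)) : mx_continuous (fun=> M).
Proof. by move=> i j t; exact: cvg_cst. Qed.

Lemma mx_continuousD m n (F G : R -> 'M[R]_(m, n)) :
  mx_continuous F -> mx_continuous G -> mx_continuous (fun t => F t + G t).
Proof.
move=> cF cG i j; have -> : (fun t => (F t + G t) i j) = (fun t => F t i j + G t i j).
  by apply/funext => t; rewrite mxE.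
by move=> t; apply: cvgD; [exact: cF|exact: cG].
Qed.

Lemma mx_continuousN m n (F : R -> 'M[R]_(m, n)) :
  mx_continuous F -> mx_continuous (fun t => - F t).
Proof.
move=> cF i j; have -> : (fun t => (- F t) i j) = (fun t => - F t i j).
  by apply/funext => t; rewrite mxE.
by move=> t; apply: cvgN; exact: cF.
Qed.

Lemma mx_continuousZ m n k (F : R -> 'M[R]_(m, n)) :
  mx_continuous F -> mx_continuous (fun t => k *: F t).
Proof.
move=> cF i j; have -> : (fun t => (k *: F t) i j) = (fun t => k * F t i j).
  by apply/funext => t; rewrite mxE.
by move=> t; apply: cvgM; [exact: cvg_cst|exact: cF].
Qed.

Lemma mx_continuousT m n (F : R -> 'M[R]_(m, n)) :
  mx_continuous F -> mx_continuous (fun t => (F t)^T).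
Proof.
move=> cF i j; have -> : (fun t => (F t)^T i j) = (fun t => F t j i).
  by apply/funext => t; rewrite mxE.
exact: cF.
Qed.

Lemma mx_continuousM m n p (F : R -> 'M[R]_(m, n)) (G : R -> 'M[R]_(n, p)) :
  mx_continuous F -> mx_continuous G -> mx_continuous (fun t => F t *m G t).
Proof.
move=> cF cG i j.
have -> : (fun t => (F t *m G t) i j) = (fun t => \sum_k F t i k * G t k j).
  by apply/funext => t; rewrite mxE.
elim: (index_enum _) => [|k s ih].
  have -> : (fun t => \sum_(k <- [::]) F t i k * G t k j) = fun=> 0.
    by apply/funext => t; rewrite big_nil.
  by move=> t; exact: cvg_cst.
have -> : (fun t => \sum_(l <- k :: s) F t i l * G t l j) =
    fun t => F t i k * G t k j + \sum_(l <- s) F t i l * G t l j.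
  by apply/funext => t; rewrite big_cons.
by move=> t; apply: cvgD; [apply: cvgM; [exact: cF|exact: cG]|exact: ih].
Qed.

Lemma mx_continuous_mbounded m n (F : R -> 'M[R]_(m, n)) i j :
  mx_continuous F -> mbounded T (fun t => F t i j).
Proof. by move=> cF; exact: within_mbounded. Qed.

Definition mx_prim m n (F f : R -> 'M[R]_(m, n)) :=
  forall i j, prim T (fun t => F t i j) (fun t => f t i j).

Lemma mx_prim_FTC m n (F f : R -> 'M[R]_(m, n)) :
  {within `[0, T], continuous F} -> mx_continuous f ->
  (forall t, t \in `]0, T[ -> derivable F t 1 /\ derive1 F t = f t) -> mx_prim F f.
Proof.
move=> cF cf dF i j; apply: prim_FTC => //.
  exact: (within_mx_continuous (@subset_refl _ _) cF).
move=> t /dF[dFt <-]; split; first exact: (derivable_mxP _ _ _).1.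
by rewrite !derive1E derive_mx// mxE.
Qed.

Lemma mx_primD m n (F f G g : R -> 'M[R]_(m, n)) : mx_prim F f -> mx_prim G g ->
  mx_prim (fun t => F t + G t) (fun t => f t + g t).
Proof.
move=> pF pG i j; have := primD (pF i j) (pG i j).
by congr (prim T); apply/funext => t; rewrite mxE.
Qed.

Lemma mx_primM m n p (F f : R -> 'M[R]_(m, n)) (G g : R -> 'M[R]_(n, p)) :
  mx_prim F f -> mx_prim G g ->
  mx_prim (fun t => F t *m G t) (fun t => f t *m G t + F t *m g t).
Proof.
move=> pF pG i j.
have := prim_sum (index_enum 'I_n) (fun k => primM (pF i k) (pG k j)).
by congr (prim T); apply/funext => t; rewrite !mxE// -big_split.
Qed.

Lemma mx_prim_expRZ m n k (F f : R -> 'M[R]_(m, n)) : mx_prim F f ->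
  mx_prim (fun t => expR (k * t) *: F t) (fun t => expR (k * t) *: (f t + k *: F t)).
Proof.
move=> pF i j; have := primM (prim_expR T k) (pF i j).
by congr (prim T); apply/funext => t; rewrite !mxE//; ring.
Qed.

(* Uniqueness for the linear equation satisfied by [F - F^T]: the weighted energy
   [expR (C t) * \sum (F - F^T)_ij^2] is nondecreasing and vanishes at [T]. *)
Lemma mx_prim_sym n (F f U V : R -> 'M[R]_n) : mx_prim F f -> F T = 0 ->
  mx_continuous U -> mx_continuous V ->
  (forall t, IT t -> f t - (f t)^T = U t *m (F t - (F t)^T) + (F t - (F t)^T) *m V t) ->
  forall t, IT t -> (F t)^T = F t.
Proof.
move=> pF FT cU cV fE.
pose D t i j := F t i j - F t j i.
pose D' t i j := f t i j - f t j i.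
have pD i j : prim T (fun t => D t i j) (fun t => D' t i j).
  by exact: primB.
have [c cUV] : exists2 c : R, 0 <= c & forall t i j, IT t -> `|U t i j| <= c /\ `|V t i j| <= c.
  have bU (G : R -> 'M[R]_n) : mx_continuous G ->
      exists2 c : R, 0 <= c & forall t i j, IT t -> `|G t i j| <= c.
    move=> cG; have /choice[c Gc] : forall ij : 'I_n * 'I_n, exists c : R, forall t, IT t -> `|G t ij.1 ij.2| <= c.
      by move=> ij; have [_] := mx_continuous_mbounded ij.1 ij.2 cG.
    exists (\sum_ij `|c ij|); first exact: sumr_ge0.
    move=> t i j tI; apply: le_trans (Gc (i, j) t tI) _.
    rewrite (bigD1 (i, j))//=; apply: le_trans (ler_norm _) _.
    by rewrite lerDl; exact: sumr_ge0.
  have [c1 c10 H1] := bU _ cU; have [c2 c20 H2] := bU _ cV.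
  exists (c1 + c2); first exact: addr_ge0.
  move=> t i j tI; split.
    by apply: le_trans (H1 t i j tI) _; rewrite lerDl.
  by apply: le_trans (H2 t i j tI) _; rewrite lerDr.
move=> c0.
pose E t := \sum_ij D t ij.1 ij.2 ^+ 2.
(* Each of the two products with [U] and [V] contributes [2 n c E]: their entries are bounded by [c]
   and [2 |x y|] by [x^2 + y^2], summed over three indices. *)
pose C := 4 * n%:R * c.
have energy t : IT t -> 0 <= C * E t + \sum_ij (2 * (D t ij.1 ij.2 * D' t ij.1 ij.2)).
  move=> tI; have key (a x y : R) : `|a| <= c -> - (c * (x ^+ 2 + y ^+ 2)) <= 2 * (x * (a * y)).
    rewrite ler_norml => /andP[a1 a2].
    have := mulr_ge0 (_ : 0 <= c + a) (sqr_ge0 (x + y)).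
    have := mulr_ge0 (_ : 0 <= c - a) (sqr_ge0 (x - y)).
    move=> /(_ ltac:(lra)) h1 /(_ ltac:(lra)) h2; nra.
  have D'E i j : D' t i j = \sum_k U t i k * D t k j + \sum_k V t k j * D t i k.
    have := congr1 (fun M : 'M[R]_n => M i j) (fE t tI); rewrite !mxE /D' => ->.
    by congr (_ + _); apply: eq_bigr => k _; rewrite !mxE// mulrC.
  have Esum : E t = \sum_i \sum_j D t i j ^+ 2 by rewrite /E pair_big.
  have S1 : \sum_i \sum_j \sum_k (c * (D t i j ^+ 2 + D t k j ^+ 2)) = 2 * n%:R * c * E t.
    have -> : \sum_i \sum_j \sum_k (c * (D t i j ^+ 2 + D t k j ^+ 2)) =
        \sum_i \sum_j \sum_(k < n) (c * (D t i j ^+ 2)) + \sum_(i < n) \sum_j \sum_k (c * D t k j ^+ 2).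
      rewrite -big_split; apply: eq_bigr => i _; rewrite -big_split; apply: eq_bigr => j _.
      by rewrite -big_split; apply: eq_bigr => k _ /=; ring.
    have -> : \sum_(i < n) \sum_j \sum_k (c * D t k j ^+ 2) = n%:R * c * E t.
      rewrite sumr_const card_ord exchange_big/= Esum -[LHS]mulr_natl -mulrA; congr (_ * _).
      by rewrite mulr_sumr; apply: eq_bigr => i _; rewrite mulr_sumr.
    have -> : \sum_i \sum_j \sum_(k < n) (c * (D t i j ^+ 2)) = n%:R * c * E t.
      rewrite Esum !mulr_sumr; apply: eq_bigr => i _; rewrite mulr_sumr; apply: eq_bigr => j _.
      by rewrite sumr_const card_ord -[LHS]mulr_natl mulrA.
    ring.
  have S2 : \sum_i \sum_j \sum_k (c * (D t i j ^+ 2 + D t i k ^+ 2)) = 2 * n%:R * c * E t.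
    have -> : \sum_i \sum_j \sum_k (c * (D t i j ^+ 2 + D t i k ^+ 2)) =
        \sum_i \sum_j \sum_(k < n) (c * (D t i j ^+ 2)) + \sum_i \sum_(j < n) \sum_k (c * D t i k ^+ 2).
      rewrite -big_split; apply: eq_bigr => i _; rewrite -big_split; apply: eq_bigr => j _.
      by rewrite -big_split; apply: eq_bigr => k _ /=; ring.
    have -> : \sum_i \sum_(j < n) \sum_k (c * D t i k ^+ 2) = n%:R * c * E t.
      rewrite Esum mulr_sumr; apply: eq_bigr => i _.
      by rewrite sumr_const card_ord -[LHS]mulr_natl -mulrA; congr (_ * _); rewrite mulr_sumr.
    have -> : \sum_i \sum_j \sum_(k < n) (c * (D t i j ^+ 2)) = n%:R * c * E t.
      rewrite Esum !mulr_sumr; apply: eq_bigr => i _; rewrite mulr_sumr; apply: eq_bigr => j _.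
      by rewrite sumr_const card_ord -[LHS]mulr_natl mulrA.
    ring.
  have -> : \sum_ij (2 * (D t ij.1 ij.2 * D' t ij.1 ij.2)) =
      \sum_i \sum_j \sum_k (2 * (D t i j * (U t i k * D t k j))) +
      \sum_i \sum_j \sum_k (2 * (D t i j * (V t k j * D t i k))).
    rewrite -(pair_big xpredT xpredT (fun i j => 2 * (D t i j * D' t i j)))/= -big_split; apply: eq_bigr => i _.
    rewrite -big_split; apply: eq_bigr => j _ /=.
    by rewrite D'E mulrDr mulrDr !mulr_sumr.
  have L1 : - (2 * n%:R * c * E t) <= \sum_i \sum_j \sum_k (2 * (D t i j * (U t i k * D t k j))).
    rewrite -S1 -sumrN; apply: ler_sum => i _; rewrite -sumrN; apply: ler_sum => j _.
    by rewrite -sumrN; apply: ler_sum => k _; apply: key; exact: (c0 t i k tI).1.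
  have L2 : - (2 * n%:R * c * E t) <= \sum_i \sum_j \sum_k (2 * (D t i j * (V t k j * D t i k))).
    rewrite -S2 -sumrN; apply: ler_sum => i _; rewrite -sumrN; apply: ler_sum => j _.
    by rewrite -sumrN; apply: ler_sum => k _; apply: key; exact: (c0 t k j tI).2.
  by rewrite /C; lra.
have pE : prim T (fun t => expR (C * t) * E t) (fun t => expR (C * t) *
    (C * E t + \sum_ij (2 * (D t ij.1 ij.2 * D' t ij.1 ij.2)))).
  have := primM (prim_expR T C) (prim_sum (index_enum ('I_n * 'I_n)%type)
    (fun ij => primM (pD ij.1 ij.2) (pD ij.1 ij.2))).
  congr (prim T); apply/funext => t.
  rewrite [RHS]mulrDr; congr (_ + _); first by rewrite mulrA (mulrC (expR _)).
  by congr (_ * _); apply: eq_bigr => ij _; ring.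
move=> t tI.
have E0 : expR (C * t) * E t <= 0.
  apply: le_trans (prim_mono T0 pE _ tI) _.
    by move=> s sI; rewrite mulr_ge0 ?expR_ge0// energy.
  rewrite /E big1 ?mulr0// => ij _.
  by rewrite /D FT !mxE subrr expr0n.
have {}E0 : E t = 0.
  apply/eqP; rewrite eq_le sumr_ge0 ?andbT; last by move=> ij _; exact: sqr_ge0.
  by rewrite -(pmulr_rle0 _ (expR_gt0 (C * t))).
apply/matrixP => i j; rewrite mxE.
have /(_ (i, j) isT) := psumr_eq0P (fun ij _ => sqr_ge0 (D t ij.1 ij.2)) E0.
by move=> /eqP; rewrite sqrf_eq0 subr_eq0 => /eqP/= ->.
Qed.

End matrix_primitives.

(** * The algebra of the cross term *)

Section dot_product.
Context (R : realType).

Definition dot n (u v : 'cV[R]_n) : R := (u^T *m v) 0 0.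

Lemma dotE n (u v : 'cV[R]_n) : dot u v = \sum_k u k 0 * v k 0.
Proof. by rewrite /dot mxE; apply: eq_bigr => k _; rewrite mxE. Qed.

Lemma dotC n (u v : 'cV[R]_n) : dot u v = dot v u.
Proof. by rewrite !dotE; apply: eq_bigr => k _; rewrite mulrC. Qed.

Lemma dotDl n (u v w : 'cV[R]_n) : dot (u + v) w = dot u w + dot v w.
Proof. by rewrite /dot linearD/= mulmxDl mxE. Qed.

Lemma dotNl n (u w : 'cV[R]_n) : dot (- u) w = - dot u w.
Proof. by rewrite /dot linearN/= mulNmx mxE. Qed.

Lemma dotZl n k (u w : 'cV[R]_n) : dot (k *: u) w = k * dot u w.
Proof. by rewrite /dot linearZ/= -scalemxAl mxE. Qed.

Lemma dotDr n (u v w : 'cV[R]_n) : dot w (u + v) = dot w u + dot w v.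
Proof. by rewrite dotC dotDl !(dotC w). Qed.

Lemma dotNr n (u w : 'cV[R]_n) : dot w (- u) = - dot w u.
Proof. by rewrite dotC dotNl dotC. Qed.

Lemma dotZr n k (u w : 'cV[R]_n) : dot w (k *: u) = k * dot w u.
Proof. by rewrite dotC dotZl dotC. Qed.

Lemma dot_sumr n (I : Type) (s : seq I) (u : I -> 'cV[R]_n) w :
  dot w (\sum_(i <- s) u i) = \sum_(i <- s) dot w (u i).
Proof. by rewrite /dot mulmx_sumr summxE. Qed.

Lemma dot_mulmxr m n (M : 'M[R]_(m, n)) (u : 'cV[R]_m) (w : 'cV[R]_n) :
  dot u (M *m w) = dot (M^T *m u) w.
Proof. by rewrite /dot trmx_mul trmxK mulmxA. Qed.

(** Used to prove vector identities: paired with an arbitrary [w], all products become scalars,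
    which [ring] treats as atoms. *)
Lemma dot_inj n (u v : 'cV[R]_n) : (forall w, dot u w = dot v w) -> u = v.
Proof.
move=> uv; apply/matrixP => i j; rewrite ord1.
have E (z : 'cV[R]_n) : dot z (delta_mx i 0) = z i 0.
  rewrite dotE (bigD1 i)//= mxE !eqxx mulr1 big1 ?addr0// => k ki.
  by rewrite mxE (negPf ki) mulr0.
by rewrite -!E.
Qed.

Lemma dot_sqnorm n (u : 'cV[R]_n) : dot u u = sqnorm u.
Proof. by rewrite dotE; apply: eq_bigr => k _; rewrite expr2. Qed.

Lemma quad_dot n (M : 'M[R]_n) u : quad M u = dot (M^T *m u) u.
Proof. by rewrite /quad /dot trmx_mul trmxK. Qed.

Lemma sqnorm_ge0 n (u : 'cV[R]_n) : 0 <= sqnorm u.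
Proof. by apply: sumr_ge0 => k _; exact: sqr_ge0. Qed.

Lemma quadD n (M : 'M[R]_n) (u v : 'cV[R]_n) : sym_mx M ->
  quad M (u + v) = quad M u + 2 * dot (M *m u) v + quad M v.
Proof.
move=> sM; rewrite !quad_dot sM mulmxDr !dotDl !dotDr (dotC (M *m v) u) dot_mulmxr sM.
ring.
Qed.

(** The form is nonnegative on [u + k v] for every [k]. When [quad M v] vanishes and [b] does not,
    [k = - (a + 1) / (2 b)] would give the value -1. *)
Lemma quad_Cauchy_Schwarz n (M : 'M[R]_n) (u v : 'cV[R]_n) : sym_mx M -> psd_mx M ->
  dot (M *m u) v ^+ 2 <= quad M u * quad M v.
Proof.
move=> sM pM; set a := quad M u; set b := dot _ _; set c := quad M v.
have c0 : 0 <= c by exact: pM.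
have key k : 0 <= a + 2 * k * b + k ^+ 2 * c.
  have := pM (u + k *: v); rewrite quadD// dotZr [quad M (k *: v)]quad_dot sM.
  by rewrite -scalemxAr dotZl dotZr -/b /a /c (quad_dot M v) sM => h; nra.
have [c_eq0|c_neq0] := eqVneq c 0.
  rewrite c_eq0 mulr0; have [->|b0] := eqVneq b 0; first by rewrite expr0n.
  have := key (- (a + 1) / (2 * b)); rewrite c_eq0 mulr0 addr0.
  have -> : 2 * (- (a + 1) / (2 * b)) * b = - (a + 1) by field.
  by have := pM u; rewrite -/a; lra.
have cp : 0 < c by rewrite lt_def c_neq0.
have := key (- b / c); have -> : a + 2 * (- b / c) * b + (- b / c) ^+ 2 * c = (a * c - b ^+ 2) / c by field.
by rewrite pmulr_lge0 ?invr_gt0// subr_ge0.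
Qed.

Lemma pd_psd n (M : 'M[R]_n) : pd_mx M -> psd_mx M.
Proof.
move=> pM z; have [->|/pM/ltW//] := eqVneq z 0.
by rewrite /quad mulmx0 mxE.
Qed.

Lemma pd_unitmx n (M : 'M[R]_n) : pd_mx M -> M \in unitmx.
Proof.
move=> pM; rewrite unitmxE unitfE; apply/negP => /det0P[v v0 vM].
have v0' : v^T != 0 by apply: contra_neq v0 => /(congr1 trmx); rewrite trmxK trmx0.
by have := pM v^T v0'; rewrite /quad trmxK vM mul0mx mxE ltxx.
Qed.

(** The coordinate [z k] is the pairing of [z] with [M^-1 delta_k] in the form [M], so
    Cauchy-Schwarz for that form bounds its square by [quad M (e k) * quad M z]. The 1 added to
    [kap] keeps the quotient meaningful in dimension 0. *)
Lemma pd_coercive n (M : 'M[R]_n) : sym_mx M -> pd_mx M ->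
  exists2 lam : R, 0 < lam & forall z, lam * sqnorm z <= quad M z.
Proof.
move=> sM pM; have psM := pd_psd pM; have uM := pd_unitmx pM.
pose e k : 'cV[R]_n := invmx M *m delta_mx k 0.
pose kap := \sum_k quad M (e k).
have kap0 : 0 <= kap by apply: sumr_ge0 => k _; exact: psM.
exists (kap + 1)^-1; first by rewrite invr_gt0 ltr_wpDl.
move=> z; rewrite ler_pdivrMl ?ltr_wpDl//; apply: (@le_trans _ _ (kap * quad M z)).
  rewrite /sqnorm /kap mulr_suml; apply: ler_sum => k _.
  have -> : z k 0 = dot (M *m e k) z.
    rewrite /e mulmxA mulmxV// mul1mx dotE (bigD1 k)//= mxE !eqxx mul1r big1 ?addr0// => j jk.
    by rewrite mxE (negPf jk) mul0r.
  exact: quad_Cauchy_Schwarz.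
by rewrite mulrDl mul1r lerDl; exact: psM.
Qed.

Lemma sum_Cauchy_Schwarz (I : finType) (a b : I -> R) :
  (\sum_i a i * b i) ^+ 2 <= (\sum_i a i ^+ 2) * \sum_i b i ^+ 2.
Proof.
rewrite expr2 !mulr_suml.
have -> : \sum_i a i * b i * (\sum_j a j * b j) = \sum_i \sum_j (a i * b j) * (a j * b i).
  by apply: eq_bigr => i _; rewrite mulr_sumr; apply: eq_bigr => j _; ring.
have E : \sum_i a i ^+ 2 * (\sum_j b j ^+ 2) = \sum_i \sum_j (a i * b j) ^+ 2.
  by apply: eq_bigr => i _; rewrite mulr_sumr; apply: eq_bigr => j _; rewrite exprMn.
have E' : \sum_i \sum_j (a i * b j) ^+ 2 = \sum_i \sum_j (a j * b i) ^+ 2.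
  by rewrite exchange_big.
rewrite E -(ler_pM2l (_ : 0 < 2))// mulr_natl [X in _ <= X]mulr_natl [X in _ <= X]mulr2n {2}E'.
rewrite -mulr_natl mulr_sumr -big_split; apply: ler_sum => i _.
rewrite mulr_sumr -big_split; apply: ler_sum => j _ /=.
by have := sqr_ge0 (a i * b j - a j * b i); nra.
Qed.

Lemma sqnorm_mulmx_le m n (M : 'M[R]_(m, n)) (c : R) (u : 'cV[R]_n) :
  (forall i j, M i j ^+ 2 <= c) -> sqnorm (M *m u) <= (m * n)%:R * c * sqnorm u.
Proof.
move=> Mc; rewrite {1}/sqnorm; apply: (@le_trans _ _ (\sum_(k < m) (n%:R * c * sqnorm u))).
  apply: ler_sum => k _; rewrite mxE; apply: (le_trans (sum_Cauchy_Schwarz _ _)).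
  apply: ler_wpM2r; first exact: sqnorm_ge0.
  apply: (@le_trans _ _ (\sum_(j < n) c)); first exact: ler_sum.
  by rewrite sumr_const card_ord mulr_natl.
by rewrite sumr_const card_ord -[leLHS]mulr_natl natrM !mulrA.
Qed.

Lemma sqnormD_le n (u v : 'cV[R]_n) : sqnorm (u + v) <= 2 * sqnorm u + 2 * sqnorm v.
Proof.
rewrite /sqnorm !mulr_sumr -big_split; apply: ler_sum => k _ /=; rewrite mxE.
by have := sqr_ge0 (u k 0 - v k 0); nra.
Qed.

Lemma sqnorm_mean_le n (N : nat) (z : 'I_N -> 'cV[R]_n) : (0 < N)%N ->
  sqnorm (N%:R^-1 *: \sum_(j < N) z j) <= N%:R^-1 * \sum_(j < N) sqnorm (z j).
Proof.
move=> N0; have N0' : 0 < N%:R :> R by rewrite ltr0n.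
rewrite /sqnorm exchange_big mulr_sumr; apply: ler_sum => k _ /=.
rewrite mxE summxE exprMn expr2 -mulrA; apply: ler_wpM2l; first by rewrite invr_ge0 ltW.
rewrite ler_pdivrMl//; have := sum_Cauchy_Schwarz (fun i => z i k 0) (fun=> 1).
rewrite [X in _ * X](eq_bigr (fun=> 1)) => [|i _]; last by rewrite expr1n.
by rewrite sumr_const card_ord mulrC; congr (_ ^+ 2 <= _); apply: eq_bigr => i _; rewrite mulr1.
Qed.

(** Duality is available for products of a deterministic primitive, a scalar process and a component
    of [y]; the right side is the left one cut into such pieces. The process [x k] goes with the
    coefficient [P l k], and the vector [c] with the constant process 1, of zero drift. *)
Lemma costate_entries n (e rho : R) (P Pd : 'M[R]_n) (c cd x bx b y : 'cV[R]_n) :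
  e * (dot (P *m x + c) b
       + dot ((Pd - rho *: P) *m x + P *m bx + (cd - rho *: c)) y) =
  \sum_l (\sum_k (x k 0 * ((e *: P) l k * b l 0 + (e *: (Pd + (- rho) *: P)) l k * y l 0)
                  + bx k 0 * ((e *: P) l k * y l 0))
    + (1 * ((e *: c) l 0 * b l 0 + (e *: (cd + (- rho) *: c)) l 0 * y l 0)
       + 0 * ((e *: c) l 0 * y l 0))).
Proof.
rewrite !dotE -big_split mulr_sumr; apply: eq_bigr => l _ /=.
have -> : (P *m x + c) l 0 = \sum_k P l k * x k 0 + c l 0 by rewrite !mxE.
have -> : ((Pd - rho *: P) *m x + P *m bx + (cd - rho *: c)) l 0 =
    \sum_k ((Pd l k - rho * P l k) * x k 0 + P l k * bx k 0) + (cd l 0 - rho * c l 0).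
  rewrite !mxE big_split/=; congr (_ + _ + _).
  by apply: eq_bigr => k _; rewrite !mxE.
transitivity (\sum_k e * (P l k * x k 0 * b l 0 +
    ((Pd l k - rho * P l k) * x k 0 + P l k * bx k 0) * y l 0) +
    e * (c l 0 * b l 0 + (cd l 0 - rho * c l 0) * y l 0)).
  by rewrite -mulr_sumr [X in _ = e * X + _]big_split/= -!mulr_suml; ring.
congr (_ + _); last by rewrite !mxE; ring.
by apply: eq_bigr => k _; rewrite !mxE; ring.
Qed.

Lemma dot_Young n (u v : 'cV[R]_n) (del : R) : 0 < del ->
  - (del^-1 * sqnorm u + del * sqnorm v) <= 2 * dot u v.
Proof.
move=> d0; rewrite dotE /sqnorm !mulr_sumr -big_split -sumrN; apply: ler_sum => k _ /=.
have := mulr_ge0 (ltW d0) (sqr_ge0 (v k 0 + del^-1 * u k 0)).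
have -> : del * (v k 0 + del^-1 * u k 0) ^+ 2 =
  del * v k 0 ^+ 2 + 2 * (u k 0 * v k 0) + del^-1 * u k 0 ^+ 2.
  by field; rewrite gt_eqF.
lra.
Qed.

End dot_product.

Section cross_term.
Context (R : realType) (n r : nat) (rho : R) (A G Gam Q : 'M[R]_n)
  (B : 'M[R]_(n, r)) (Rw : 'M[R]_r) (eta : 'cV[R]_n).
Hypotheses (Q_sym : sym_mx Q) (Rw_sym : sym_mx Rw) (Rw_unit : Rw \in unitmx).
Variables (P Pd K Kd : 'M[R]_n) (xb xbd s sd f : 'cV[R]_n).
Hypotheses (P_sym : sym_mx P) (K_sym : sym_mx K).
Hypothesis P_eq : rho *: P = Pd + A^T *m P + P *m A
  - P *m B *m invmx Rw *m B^T *m P + Q.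
Hypothesis K_eq : rho *: K = Kd + (A + G)^T *m K + K *m (A + G)
  - P *m B *m invmx Rw *m B^T *m K - K *m B *m invmx Rw *m B^T *m P
  + G^T *m P + P *m G - K *m B *m invmx Rw *m B^T *m K - Q_Gamma Gam Q.
Hypothesis s_eq : rho *: s = sd
  + (A + G - B *m invmx Rw *m B^T *m (P + K))^T *m s
  + (P + K) *m f - eta_bar Gam Q eta.
Hypothesis xbar_eq : xbd = (A + G) *m xb
  - B *m invmx Rw *m B^T *m ((P + K) *m xb + s) + f.

Variables (N : nat) (x y : 'I_N -> 'cV[R]_n) (v : 'I_N -> 'cV[R]_r).
Hypothesis N_gt0 : (0 < N)%N.
Let mean (z : 'I_N -> 'cV[R]_n) := N%:R^-1 *: \sum_(j < N) z j.
(** Part of the costate [P x_i + c] that is common to all agents; [cd] is its derivative. *)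
Let c := K *m xb + s.
Let cd := Kd *m xb + K *m xbd + sd.
Let b i := A *m y i + B *m v i + G *m mean y.
Let bh i := (A - B *m invmx Rw *m B^T *m P) *m x i
  - B *m invmx Rw *m B^T *m (K *m xb + s) + G *m mean x + f.
Let u i := - (invmx Rw *m B^T *m (P *m x i + K *m xb + s)).

Let S := B *m invmx Rw *m B^T.
Let S_sym : S^T = S.
Proof. by rewrite /S !trmx_mul trmxK trmx_inv Rw_sym mulmxA. Qed.

Let dot_sum_mean (w : 'cV[R]_n) (z : 'I_N -> 'cV[R]_n) :
  \sum_i dot w (z i) = N%:R * dot w (mean z).
Proof.
rewrite -dot_sumr /mean dotZr mulrA divff ?mul1r// pnatr_eq0 -lt0n//.
Qed.

(** The control is tied to the costate by [Rw u_i = - B^T (P x_i + c)], which cancels the term of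
    [B v_i]. The equation of [P] then removes every pairing of [x_i] with [y_i]: what [y_i] meets is
    common to all agents, and [x_i] meets only the mean of [y]. *)
Let crossterm_i i :
  dot (Q *m (x i - Gam *m mean x - eta)) (y i - Gam *m mean y) + dot (Rw *m u i) (v i)
  + (dot (P *m x i + c) (b i)
     + dot ((Pd - rho *: P) *m x i + P *m bh i + (cd - rho *: c)) (y i)) =
  dot (A^T *m c - P *m S *m c + P *m G *m mean x + P *m f + (cd - rho *: c)
       - Q *m Gam *m mean x - Q *m eta) (y i)
  + dot (G^T *m P *m x i + G^T *m c - Gam^T *m Q *m x i + Gam^T *m Q *m Gam *m mean x
       + Gam^T *m Q *m eta) (mean y).
Proof.
have -> : Rw *m u i = - (B^T *m (P *m x i + c)).
  by rewrite /u mulmxN !mulmxA mulmxV// mul1mx addrA.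
have -> : Pd - rho *: P = P *m S *m P - A^T *m P - P *m A - Q.
  rewrite P_eq /S !mulmxA !opprD opprK; apply/matrixP => k l.
  move: (P *m B *m invmx Rw *m B^T *m P) (A^T *m P) (P *m A) => M1 M2 M3.
  by rewrite !mxE; ring.
rewrite /b /bh -/S -/c.
set cr := cd - rho *: c.
rewrite !(dotDr, dotNr) !dot_mulmxr !(mulmxDr, mulmxDl, mulmxN, mulNmx) !mulmxA.
rewrite !(dotDl, dotNl); ring.
Qed.

(** This is what the equations of [K] and [s] are made for. Symmetry of [P] and [K] enters through
    the transposed feedback matrix in the equation of [s]. *)
Let cr_eq : (A + G)^T *m c - P *m S *m c + P *m f + (cd - rho *: c) - eta_bar Gam Q eta =
  - (P *m G + G^T *m P - Q_Gamma Gam Q) *m xb.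
Proof.
have trD (M1 M2 : 'M[R]_n) : (M1 + M2)^T = M1^T + M2^T by exact: linearD.
have -> : cd - rho *: c = (Kd - rho *: K) *m xb + K *m xbd + (sd - rho *: s).
  apply: dot_inj => w; rewrite /cd /c mulmxDl mulNmx -scalemxAl.
  by rewrite scalerDr !(dotDl, dotNl); ring.
have -> : sd - rho *: s = - ((A + G)^T *m s) + (P + K) *m S *m s - (P + K) *m f
    + eta_bar Gam Q eta.
  have -> : (P + K) *m S = (S *m (P + K))^T by rewrite trmx_mul S_sym trD P_sym K_sym.
  rewrite s_eq -/S trD linearN/=; apply: dot_inj => w; rewrite trD.
  move: (eta_bar Gam Q eta) => eb.
  by rewrite !(mulmxDl, mulNmx) !(dotDl, dotNl); ring.
have KE : (Kd - rho *: K) *m xb = - ((A + G)^T *m K *m xb) - K *m (A + G) *m xb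
    + P *m S *m K *m xb + K *m S *m P *m xb - G^T *m P *m xb - P *m G *m xb
    + K *m S *m K *m xb + Q_Gamma Gam Q *m xb.
  rewrite K_eq /S; apply: dot_inj => w; move: (Q_Gamma Gam Q) => QG; rewrite !mulmxA.
  by rewrite !(mulmxDl, mulNmx) !(dotDl, dotNl); ring.
rewrite KE xbar_eq -/S /c; move: (Q_Gamma Gam Q) (eta_bar Gam Q eta) => QG eb.
apply: dot_inj => w; rewrite trD.
rewrite !(mulmxDr, mulmxDl, mulmxN, mulNmx) !mulmxA !(dotDl, dotNl); ring.
Qed.

(** After summation only means are paired. The terms carrying the mean of [x] assemble the same
    matrix that the common terms apply, with opposite sign, to [xb]; hence the deviation
    [mean x - xb]. *)
Lemma cross_term_identity :
  \sum_i (dot (Q *m (x i - Gam *m mean x - eta)) (y i - Gam *m mean y)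
          + dot (Rw *m u i) (v i))
  + \sum_i (dot (P *m x i + c) (b i)
     + dot ((Pd - rho *: P) *m x i + P *m bh i + (cd - rho *: c)) (y i)) =
  N%:R * dot ((P *m G + G^T *m P - Q_Gamma Gam Q) *m (mean x - xb)) (mean y).
Proof.
rewrite -big_split/= (eq_bigr _ (fun i _ => crossterm_i i)) big_split/= dot_sum_mean.
set q := G^T *m c + Gam^T *m Q *m Gam *m mean x + Gam^T *m Q *m eta.
have -> : \sum_i dot (G^T *m P *m x i + G^T *m c - Gam^T *m Q *m x i + Gam^T *m Q *m Gam *m mean x
       + Gam^T *m Q *m eta) (mean y) =
   N%:R * dot (q + (G^T *m P - Gam^T *m Q) *m mean x) (mean y).
  have -> : N%:R * dot (q + (G^T *m P - Gam^T *m Q) *m mean x) (mean y) =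
      \sum_(i < N) dot q (mean y) + \sum_i dot ((G^T *m P - Gam^T *m Q)^T *m mean y) (x i).
    rewrite dot_sum_mean sumr_const card_ord dotDl -[dot q _ *+ _]mulr_natl mulrDr; congr (_ + _ * _).
    by rewrite dotC dot_mulmxr.
  rewrite -big_split; apply: eq_bigr => i _ /=.
  rewrite -dot_mulmxr (dotC (mean y)) /q mulmxDl mulNmx !(dotDl, dotNl); ring.
rewrite -mulrDr; congr (_ * _); rewrite -dotDl; congr (dot _ _).
have trD : (A + G)^T = A^T + G^T by exact: linearD.
have -> : A^T *m c - P *m S *m c + P *m G *m mean x + P *m f + (cd - rho *: c)
    - Q *m Gam *m mean x - Q *m eta = ((A + G)^T *m c - P *m S *m c + P *m f
    + (cd - rho *: c) - eta_bar Gam Q eta) - G^T *m c - Gam^T *m Q *m eta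
    + P *m G *m mean x - Q *m Gam *m mean x.
  apply: dot_inj => w; rewrite trD /eta_bar.
  by rewrite !(mulmxDl, mulNmx) !(dotDl, dotNl); ring.
rewrite cr_eq /q /Q_Gamma; apply: dot_inj => w.
rewrite !(mulmxDr, mulmxDl, mulmxN, mulNmx) !mulmxA !(dotDl, dotNl); ring.
Qed.

End cross_term.

(** * Processes *)

(* The same closure lemmas serve square integrable processes, measurable
   processes and random variables measurable for the past. *)
Section linear_class.
Context (U : Type) (R : realType) (C P : set (U -> R)).
Hypothesis P0 : P (fun=> 0).
Hypothesis PD : forall f g, P f -> P g -> P (fun p => f p + g p).
Hypothesis PM : forall h f, C h -> P f -> P (fun p => h p * f p).
Hypothesis Ccst : forall k, C (fun=> k).

Definition vec n (z : U -> 'cV[R]_n) := forall k, P (fun p => z p k 0).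

Definition coef m n (M : U -> 'M[R]_(m, n)) := forall i j, C (fun p => M p i j).

Lemma class_sum (I : Type) (s : seq I) (f : I -> U -> R) :
  (forall i, P (f i)) -> P (fun p => \sum_(i <- s) f i p).
Proof.
move=> h; elim: s => [|i s ih].
  have -> : (fun p => \sum_(j <- [::]) f j p) = fun=> 0.
    by apply/funext => p; rewrite big_nil.
  exact: P0.
have -> : (fun p => \sum_(j <- i :: s) f j p) = fun p => f i p + \sum_(j <- s) f j p.
  by apply/funext => p; rewrite big_cons.
exact: PD.
Qed.

Lemma vecD n (y z : U -> 'cV[R]_n) : vec y -> vec z -> vec (fun p => y p + z p).
Proof.
move=> hy hz k; have -> : (fun p => (y p + z p) k 0) = fun p => y p k 0 + z p k 0.
  by apply/funext => p; rewrite mxE.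
exact: PD.
Qed.

Lemma vecZ n a (z : U -> 'cV[R]_n) : vec z -> vec (fun p => a *: z p).
Proof.
move=> hz k; have -> : (fun p => (a *: z p) k 0) = fun p => a * z p k 0.
  by apply/funext => p; rewrite mxE.
exact: (PM (Ccst a)).
Qed.

Lemma vecN n (z : U -> 'cV[R]_n) : vec z -> vec (fun p => - z p).
Proof.
by move=> hz; have := vecZ (-1) hz; congr vec; apply/funext => p; rewrite scaleN1r.
Qed.

Lemma vec_sum n (I : Type) (s : seq I) (z : I -> U -> 'cV[R]_n) :
  (forall i, vec (z i)) -> vec (fun p => \sum_(i <- s) z i p).
Proof.
move=> hz k; have -> : (fun p => (\sum_(i <- s) z i p) k 0) = fun p => \sum_(i <- s) z i p k 0.
  by apply/funext => p; rewrite summxE.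
by apply: class_sum => i; exact: hz.
Qed.

Lemma vec_mulmx m n (M : U -> 'M[R]_(m, n)) (z : U -> 'cV[R]_n) :
  coef M -> vec z -> vec (fun p => M p *m z p).
Proof.
move=> hM hz k; have -> : (fun p => (M p *m z p) k 0) = fun p => \sum_j M p k j * z p j 0.
  by apply/funext => p; rewrite mxE.
by apply: class_sum => j; exact: PM.
Qed.

Lemma vec_mulmxc m n (M : 'M[R]_(m, n)) (z : U -> 'cV[R]_n) :
  vec z -> vec (fun p => M *m z p).
Proof. by apply: vec_mulmx => i j; exact: Ccst. Qed.

End linear_class.

Section processes.
Context d (Omega : measurableType d) (R : realType) (Pr : probability Omega R).
Variable T : R.
Hypothesis T0 : 0 < T.
Notation Rm := (measurableTypeR R).
Notation leb := (@lebesgue_measure R).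
Notation mu := (leb \x Pr)%E.
Notation IT := (`[0%R, T]%classic : set Rm).
Notation strip := (@strip d Omega R T).
Notation U := (Rm * Omega)%type.

(** Multipliers that preserve square integrability: bounded functions of time alone, such as the
    entries of [P] and [K]. *)
Definition det_coef : set (U -> R) :=
  [set g | exists h, mbounded T h /\ g = fun p => h p.1].

Lemma det_coef_cst k : det_coef (fun=> k).
Proof. by exists (fun=> k); split => //; exact: mbounded_cst. Qed.

Lemma det_coefP h : mbounded T h -> det_coef (fun p => h p.1).
Proof. by exists h. Qed.

Definition meas_proc : set (U -> R) := [set f | measurable_fun strip f].
Definition sq_proc : set (U -> R) := [set f | sqint mu strip f].

Lemma meas_proc0 : meas_proc (fun=> 0). Proof. exact: measurable_cst. Qed.

Lemma meas_procD f g : meas_proc f -> meas_proc g -> meas_proc (fun p => f p + g p).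
Proof. exact: measurable_funD. Qed.

Lemma meas_procM h f : det_coef h -> meas_proc f -> meas_proc (fun p => h p * f p).
Proof.
by move=> [g [[mg _] ->]] mf; apply: measurable_funM => //; exact: measurable_strip_det.
Qed.

Lemma sq_proc0 : sq_proc (fun=> 0).
Proof. by apply: sqint0; exact: measurable_strip. Qed.

Lemma sq_procD f g : sq_proc f -> sq_proc g -> sq_proc (fun p => f p + g p).
Proof. by apply: sqintD; exact: measurable_strip. Qed.

Lemma sq_procM h f : det_coef h -> sq_proc f -> sq_proc (fun p => h p * f p).
Proof.
move=> [g [[mg [c gc]] ->]] sf; apply: (@sqintM _ _ _ _ _ _ _ c) => //.
- exact: measurable_strip.
- exact: measurable_strip_det.
- by move=> p [pI _]; exact: gc.
Qed.

Lemma det_coef_sq h : det_coef h -> sq_proc h.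
Proof.
move=> [g [[mg [c gc]] ->]]; apply: (@sqint_bounded _ _ _ _ _ _ c) => //.
- exact: measurable_strip.
- exact: strip_measure_lty.
- exact: measurable_strip_det.
- by move=> p [pI _]; exact: gc.
Qed.

Definition mvec n := @vec U R meas_proc n.
Definition svec n := @vec U R sq_proc n.

(** The relation [z = c + \int b], kept as a triple so that linear operations act on the three parts
    at once. Integrability of [b] belongs to it because integrals of sums get split; the noise stays
    inside [c]. *)
Definition path_int (z c b : U -> R) := {ae Pr, forall w,
  leb.-integrable IT (EFin \o (fun t => b (t, w))) /\
  {ae leb, forall t, IT t ->
     z (t, w) - c (t, w) - \int[leb]_(s in `[0, t]) b (s, w) = 0}}.

Lemma path_intD z c b z' c' b' : path_int z c b -> path_int z' c' b' ->
  path_int (fun p => z p + z' p) (fun p => c p + c' p) (fun p => b p + b' p).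
Proof.
apply: filterS2 => w [Ib h] [Ib' h']; split; first exact: (integrableD _ Ib Ib').
apply: (@filterS2 _ _ (ae_filter_ringOfSetsType leb) _ _ _ _ h h') => t E E' tI.
have tT : t <= T by move: tI; rewrite /= in_itv/= => /andP[].
rewrite RintegralD//; [|exact: (integrable_prim tT)..].
by have := E tI; have := E' tI; lra.
Qed.

Lemma path_intZ k z c b : path_int z c b ->
  path_int (fun p => k * z p) (fun p => k * c p) (fun p => k * b p).
Proof.
apply: filterS => w [Ib h]; split; first exact: (integrableZl _ k Ib).
apply: (@filterS _ _ (ae_filter_ringOfSetsType leb) _ _ _ h) => t E tI.
have tT : t <= T by move: tI; rewrite /= in_itv/= => /andP[].
rewrite RintegralZl//; last exact: (integrable_prim tT).
by rewrite -!mulrBr E// mulr0.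
Qed.

Lemma path_int0 : path_int (fun=> 0) (fun=> 0) (fun=> 0).
Proof.
apply: aeW => w; split; first exact: integrable0.
by apply: aeW => t tI; rewrite Rintegral_cst//= mul0r !subr0.
Qed.

Lemma path_int_sum (I : Type) (s : seq I) (z c b : I -> U -> R) :
  (forall i, path_int (z i) (c i) (b i)) ->
  path_int (fun p => \sum_(i <- s) z i p) (fun p => \sum_(i <- s) c i p)
    (fun p => \sum_(i <- s) b i p).
Proof.
move=> h; elim: s => [|i s ih].
  have E (f : I -> U -> R) : (fun p => \sum_(j <- [::]) f j p) = fun=> 0.
    by apply/funext => p; rewrite big_nil.
  by rewrite !E; exact: path_int0.
have E (f : I -> U -> R) :
    (fun p => \sum_(j <- i :: s) f j p) = fun p => f i p + \sum_(j <- s) f j p.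
  by apply/funext => p; rewrite big_cons.
by rewrite !E; exact: path_intD.
Qed.

Lemma path_intB z c b z' c' b' : path_int z c b -> path_int z' c' b' ->
  path_int (fun p => z p - z' p) (fun p => c p - c' p) (fun p => b p - b' p).
Proof.
move=> h h'; have := path_intD h (path_intZ (-1) h').
by congr path_int; apply/funext => p; rewrite mulN1r.
Qed.

Lemma path_int_prim (F f : Rm -> R) : prim T F f ->
  path_int (fun p => F p.1) (fun=> F 0) (fun p => f p.1).
Proof.
move=> [bF bf FE]; apply: aeW => w; split; first exact: mbounded_integrable.
by apply: aeW => t tI; have /= -> := FE t tI; set I1 := Rintegral _ _ _; ring.
Qed.

Lemma path_int_congr z c c' b : path_int z c b ->
  {ae Pr, forall w, {ae leb, forall t, IT t -> c (t, w) - c' (t, w) = 0}} ->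
  path_int z c' b.
Proof.
apply: filterS2 => w [Ib h] h'; split => //.
apply: (@filterS2 _ _ (ae_filter_ringOfSetsType leb) _ _ _ _ h h') => t E E' tI.
by have := E tI; have := E' tI; lra.
Qed.

End processes.

(** * The martingale part of a strong solution *)

Section ito.
Context d (Omega : measurableType d) (R : realType) (Pr : probability Omega R).
Variable T : R.
Hypothesis T0 : 0 < T.
Notation Rm := (measurableTypeR R).
Notation leb := (@lebesgue_measure R).
Notation mu := (leb \x Pr)%E.
Notation IT := (`[0%R, T]%classic : set Rm).
Notation strip := (@strip d Omega R T).
Notation U := (Rm * Omega)%type.
Context (n : nat) (F : R -> set (set Omega)) (W : R -> Omega -> R)
  (x0 : Omega -> 'cV[R]_n) (sigma : R -> 'cV[R]_n).
Hypothesis hW : brownian_motion Pr W.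
Hypothesis x0_meas : forall k, measurable_fun setT (fun w => x0 w k 0).
Hypothesis ssigma : forall k, sqint leb IT (fun t => sigma t k 0).

(** Recovered from the state by subtraction, hence defined for any pair of processes; the equation
    says that it is the Wiener integral of [sigma]. *)
Definition ito_martingale (b x : R -> Omega -> 'cV[R]_n) k (t : R) w : R :=
  x t w k 0 - x0 w k 0 - \int[leb]_(s in `[0%R, t]) b s w k 0.

Notation proc x := (fun p : U => x p.1 p.2).

Section solution.
Variables b x : R -> Omega -> 'cV[R]_n.
Hypothesis xsol : ito_solution Pr T F W x0 b sigma x.
Hypothesis mb : mvec T (proc b).
Notation M := (ito_martingale b x).

Lemma ito_mvec : mvec T (proc x).
Proof. by case: xsol. Qed.

Lemma ito_martingale_strip k : meas_proc T (proc (M k)).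
Proof.
apply: measurable_funB; first apply: measurable_funB.
- exact: ito_mvec.
- by apply: measurable_funTS; apply: (measurableT_comp (x0_meas k)); exact: measurable_snd.
- exact: (measurable_strip_primitive (mb k)).
Qed.

Lemma ito_martingale_meas k t : IT t -> measurable_fun setT (M k t).
Proof. by move=> tI; have := measurable_strip_omega tI (ito_martingale_strip k). Qed.

Lemma ito_wiener k : wiener_integral Pr T W (fun t => sigma t k 0) (M k).
Proof. by case: xsol => _ _ _ /(_ k). Qed.

Lemma ito_martingale_sqint k t : IT t -> sqint Pr setT (M k t).
Proof.
move=> tI; exact: (wiener_sqint hW (ssigma k) (ito_wiener k) tI (ito_martingale_meas k tI)).
Qed.

Lemma ito_martingale_sqr_le k t : IT t ->
  (\int[Pr]_w (M k t w ^+ 2)%:E <= (4 * normal_var R)%:E *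
   \int[leb]_(s in `[0%R, T]) (sigma s k 0 ^+ 2)%:E)%E.
Proof.
move=> tI.
exact: (wiener_sqr_le hW (ssigma k) (ito_wiener k) tI (ito_martingale_meas k tI)).
Qed.

Lemma ito_martingale_sq_proc k : sq_proc Pr T (proc (M k)).
Proof.
split; first exact: ito_martingale_strip.
have c0 : (0 <= (4 * normal_var R)%:E * \int[leb]_(s in `[0%R, T]) (sigma s k 0 ^+ 2)%:E)%E.
  apply: mule_ge0; first by rewrite lee_fin mulr_ge0// normal_var_ge0.
  by apply: integral_ge0 => s _; rewrite lee_fin sqr_ge0.
apply: le_lt_trans (strip_sq_le (ito_martingale_strip k) _ c0) _.
  by move=> t tI; exact: ito_martingale_sqr_le.
rewrite lte_mul_pinfty//; last exact: lebesgue_itv0_lty.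
by rewrite fin_numM// ge0_fin_numE ?(ssigma k).2//;
  apply: integral_ge0 => s _; rewrite lee_fin sqr_ge0.
Qed.

Lemma ito_source_svec : (forall k, sqint Pr setT (fun w => x0 w k 0)) ->
  svec Pr T (fun p : U => (\col_k (x0 p.2 k 0 + M k p.1 p.2) : 'cV[R]_n)).
Proof.
move=> sx0 k.
have -> : (fun p : U => (\col_k (x0 p.2 k 0 + M k p.1 p.2) : 'cV[R]_n) k 0) =
    fun p => x0 p.2 k 0 + M k p.1 p.2.
  by apply/funext => p; rewrite mxE.
apply: sq_procD; first exact: (sqint_strip_omega T (sx0 k)).
exact: ito_martingale_sq_proc.
Qed.

(** Continuous paths are bounded on [[0, T]]: the finiteness that Gronwall's inequality asks for
    along paths, before any moment is known. *)
Lemma ito_sqint_path k : {ae Pr, forall w, sqint leb IT (fun t => x t w k 0)}.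
Proof.
have [_ _ cx _] := xsol.
apply: (@filterS _ _ (ae_filter_ringOfSetsType Pr) _ _ _ cx) => w cw.
have cc : mx_continuous T (fun t => x t w).
  exact: (within_mx_continuous (@subset_refl _ `[0%R, T]%classic) cw).
have [mx [c xc]] := within_mbounded (cc k 0).
by apply: (sqint_bounded _ _ mx xc) => //; exact: lebesgue_itv0_lty.
Qed.

End solution.

(** Uniqueness of the Wiener integral at each time holds off a null set depending on that time;
    joint measurability turns it into a statement about almost every path. *)
Lemma ito_martingale_indistinguishable b x b' x' k :
  ito_solution Pr T F W x0 b sigma x -> ito_solution Pr T F W x0 b' sigma x' ->
  mvec T (proc b) -> mvec T (proc b') ->
  {ae Pr, forall w, {ae leb, forall t, IT t ->
    ito_martingale b x k t w - ito_martingale b' x' k t w = 0}}.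
Proof.
move=> sx sx' mb mb'.
apply: (strip_ae_path (f := fun p => ito_martingale b x k p.1 p.2 -
  ito_martingale b' x' k p.1 p.2)).
  apply: measurable_funB; exact: ito_martingale_strip.
move=> t tI; apply: (wiener_unique hW (ssigma k) (ito_wiener sx k) (ito_wiener sx' k) tI).
- exact: ito_martingale_meas.
- exact: ito_martingale_meas.
Qed.

End ito.

(** * Orthogonality between agents *)

(** The off-diagonal terms of the square vanish, and [N] terms of size at most [m / N^2] remain. *)
Lemma mean_sqr_le d (Omega : measurableType d) (R : realType)
    (Pr : probability Omega R) (N : nat) (X : 'I_N -> Omega -> R) (m : R) :
  (0 < N)%N -> (forall i, sqint Pr setT (X i)) ->
  (forall i, \int[Pr]_w (X i w ^+ 2) <= m) ->
  (forall i j, i != j -> \int[Pr]_w (X i w * X j w) = 0) ->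
  (\int[Pr]_w ((N%:R^-1 * \sum_i X i w) ^+ 2)%:E <= (m / N%:R)%:E)%E.
Proof.
move=> N0 sX Xm orth; have N0' : N%:R != 0 :> R by rewrite pnatr_eq0 -lt0n.
have sS : sqint Pr setT (fun w => N%:R^-1 * \sum_i X i w).
  by apply: sqintZ => //; exact: sqint_sum.
rewrite -EFin_Rintegral_sqr// lee_fin.
under eq_Rintegral do rewrite mulr_sumr.
rewrite (@Rintegral_sum_sqr _ _ _ Pr setT _ (index_enum 'I_N) (fun=> N%:R^-1) X)//.
apply: (@le_trans _ _ (\sum_(i < N) N%:R^-1 * N%:R^-1 * m)).
  apply: ler_sum => i _; rewrite (bigD1 i)//= big1 ?addr0 => [|j ji].
    apply: ler_wpM2l; first by rewrite mulr_ge0// invr_ge0.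
    by apply: le_trans (Xm i); rewrite le_eqVlt; apply/orP; left; apply/eqP;
      apply: eq_Rintegral => w _; rewrite expr2.
  by rewrite orth ?mulr0// eq_sym.
by rewrite sumr_const card_ord -[leLHS]mulr_natl mulrA mulrA divff// mul1r mulrC.
Qed.

Lemma mutual_indep_pair d (Omega : measurableType d) (R : realType)
    (Pr : probability Omega R) (I : choiceType) (F : I -> set (set Omega))
    (i j : I) (A B : set Omega) :
  mutual_indep Pr F -> i != j -> F i A -> F j B -> Pr (A `&` B) = (Pr A * Pr B)%E.
Proof.
move=> indF ij FA FB; pose D l := if l == i then A else B.
have Di : D i = A by rewrite /D eqxx.
have Dj : D j = B by rewrite /D eq_sym (negPf ij).
have uij : uniq [:: i; j] by rewrite /= inE ij.
have FD l : l \in [:: i; j] -> F l (D l).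
  by rewrite !inE => /orP[/eqP ->|/eqP ->]; rewrite ?Di ?Dj.
have := indF _ D uij FD; rewrite !big_cons big_nil mule1 Di Dj => <-.
congr (Pr _); apply/seteqP; split => [w [wA wB] l|w h].
  by rewrite /= !inE => /orP[/eqP ->|/eqP ->]; rewrite ?Di ?Dj.
split.
  by have := h i; rewrite /= !inE eqxx Di => /(_ isT).
by have := h j; rewrite /= !inE eqxx orbT Dj => /(_ isT).
Qed.

Section agents.
Context d (Omega : measurableType d) (R : realType) (Pr : probability Omega R).
Notation Rm := (measurableTypeR R).
Notation leb := (@lebesgue_measure R).
Context (n : nat) (W : nat -> R -> Omega -> R) (x0 : nat -> Omega -> 'cV[R]_n).
Hypothesis W_brownian : forall i, brownian_motion Pr (W i).
Hypothesis W_indep : mutual_indep Pr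
  (fun i => sigma_gen [set W i t | t in `[0, +oo[]).
Hypothesis x0_meas : forall i k, measurable_fun setT (fun w => x0 i w k 0).
Hypothesis x0_W_indep : indep2 Pr
  (sigma_gen (\bigcup_i coords (x0 i)))
  (sigma_gen (\bigcup_i [set W i t | t in `[0, +oo[])).

Definition past_meas N t : set (Omega -> R) :=
  [set X | forall B, measurable B -> joint_filtration x0 W N t (X @^-1` B)].

Let past_measP N t X : past_meas N t X <->
  measurable_fun setT (X : g_sigma_algebraType
    (\bigcup_(i in [set i | (i < N)%N]) agent_filtration (x0 i) (W i) t) -> R).
Proof.
split=> [h _ B mB|h B mB]; first by rewrite setTI; exact: h.
by rewrite -[X in joint_filtration _ _ _ _ X]setTI; exact: h.
Qed.

Lemma past_meas_cst N t k : past_meas N t (fun=> k).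
Proof. by apply/past_measP; exact: measurable_cst. Qed.

Lemma past_measD N t X Y : past_meas N t X -> past_meas N t Y ->
  past_meas N t (fun w => X w + Y w).
Proof.
move=> /past_measP mX /past_measP mY; apply/past_measP; exact: measurable_funD.
Qed.

Lemma past_measZ N t k X : past_meas N t X -> past_meas N t (fun w => k * X w).
Proof. by move=> /past_measP mX; apply/past_measP; exact: measurable_funM. Qed.

Lemma adapted_past_meas m N T (z : R -> Omega -> 'cV[R]_m) t k :
  adapted T (joint_filtration x0 W N) z -> t \in `[0, T] ->
  past_meas N t (fun w => z t w k 0).
Proof.
move=> az tT B mB; apply: (az t tT); apply: sigma_gen_preimage => //.
by exists k.
Qed.

Lemma past_meas_adapted m N T (z : R -> Omega -> 'cV[R]_m) :
  (forall t k, t \in `[0, T] -> past_meas N t (fun w => z t w k 0)) ->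
  adapted T (joint_filtration x0 W N) z.
Proof.
move=> h t tT; apply: sigma_gen_sub => X B [k ->] mB.
exact: h.
Qed.

Lemma brownian_cross i j p q : i != j -> 0 <= p -> 0 <= q ->
  \int[Pr]_w (W i p w * W j q w) = 0.
Proof.
move=> ij p0 q0.
rewrite (Rintegral_mul_indep (X := W i p) (Y := W j q)).
- by rewrite (brownian_mean (W_brownian i) p0) mul0r.
- exact: brownian_meas.
- exact: brownian_meas.
- by apply: sqint_integrable => //; [rewrite [X in (X < _)%E]probability_setT ltry|exact: brownian_sqint].
- by apply: sqint_integrable => //; [rewrite [X in (X < _)%E]probability_setT ltry|exact: brownian_sqint].
- move=> A B mA mB.
  apply: (mutual_indep_pair W_indep ij); apply: sigma_gen_preimage => //.
  + by exists p => //=; rewrite in_itv/= p0.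
  + by exists q => //=; rewrite in_itv/= q0.
Qed.

Section wiener_orthogonality.
Variables (T : R) (g : R -> R).
Hypothesis sg : sqint leb `[0, T] g.

(** The test variable may depend on the past of all [N] agents, as a competitor's control does, and
    not just on that of agent [i]. *)
Lemma wiener_past_orth N (i : 'I_N) Y t (xi : Omega -> R) :
  wiener_integral Pr T (W i) g Y -> t \in `[0, T] ->
  measurable_fun setT (Y t) -> measurable_fun setT (Y T) ->
  sqint Pr setT xi -> past_meas N t xi ->
  \int[Pr]_w ((Y T w - Y t w) * xi w) = 0.
Proof.
move=> wY tT mY mYT sxi pxi.
apply: (wiener_increment_orth (W_brownian i) sg wY tT mY mYT sxi) => p tp.
have t0 : 0 <= t by move: tT; rewrite in_itv/= => /andP[].
apply: (Rintegral_mul_increment_indep (W_brownian i)) => // A B sA mB.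
apply: (brownian_increment_indep_joint W_brownian W_indep x0_meas x0_W_indep (ltn_ord i) t0 tp sA).
exact: pxi.
Qed.

(** The limit argument is applied twice: it reduces [Y] to values of [W i], then [Y'] to values of
    [W j], where independence of the two noises concludes. *)
Lemma wiener_cross i j g' Y Y' t : sqint leb `[0, T] g' -> i != j ->
  wiener_integral Pr T (W i) g Y -> wiener_integral Pr T (W j) g' Y' ->
  t \in `[0, T] -> measurable_fun setT (Y t) -> measurable_fun setT (Y' t) ->
  \int[Pr]_w (Y t w * Y' t w) = 0.
Proof.
move=> sg' ij wY wY' tT mY mY'.
apply: (wiener_orth_limit (W_brownian i) sg wY tT mY).
  exact: (wiener_sqint (W_brownian j) sg' wY' tT mY').
move=> p p0 pt; under eq_Rintegral do rewrite mulrC.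
apply: (wiener_orth_limit (W_brownian j) sg' wY' tT mY').
  exact: brownian_sqint.
by move=> q q0 qt; rewrite brownian_cross// eq_sym.
Qed.

End wiener_orthogonality.

Hypothesis x0_indep : mutual_indep Pr (fun i => sigma_gen (coords (x0 i))).
Variable xbar0 : 'cV[R]_n.
Hypothesis x0_mean : forall i k, ('E_Pr[fun w => x0 i w k 0%R])%E = (xbar0 k 0)%:E.
Variable C0 : R.
Hypothesis x0_L2 : forall i, (\int[Pr]_w (sqnorm (x0 i w))%:E < C0%:E)%E.

Lemma initial_sqr_le i k : (\int[Pr]_w (x0 i w k 0 ^+ 2)%:E <= C0%:E)%E.
Proof.
apply: le_trans (ltW (x0_L2 i)).
have m2 l : measurable_fun setT (fun w => x0 i w l 0 ^+ 2) by exact: measurable_funX.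
apply: ge0_le_integral => //.
- by move=> w _; rewrite lee_fin sqr_ge0.
- exact/measurable_EFinP.
- by apply/measurable_EFinP; exact: measurable_sum.
- move=> w _; rewrite lee_fin /sqnorm (bigD1 k)//= lerDl.
  by apply: sumr_ge0 => l _; exact: sqr_ge0.
Qed.

Lemma initial_sqint i k : sqint Pr setT (fun w => x0 i w k 0).
Proof. by split => //; apply: le_lt_trans (initial_sqr_le i k) (ltry _). Qed.

Lemma initial_centered_sqint i k : sqint Pr setT (fun w => x0 i w k 0 - xbar0 k 0).
Proof.
apply: sqintB => //; first exact: initial_sqint.
by apply: sqint_cst => //; rewrite [X in (X < _)%E]probability_setT ltry.
Qed.

Let Pr_setT : Pr setT = 1%E. Proof. exact: probability_setT. Qed.
Let Pr_lty : (Pr setT < +oo)%E. Proof. by rewrite Pr_setT ltry. Qed.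

Lemma initial_centered_mean i k : \int[Pr]_w (x0 i w k 0 - xbar0 k 0) = 0.
Proof.
rewrite RintegralB//.
- rewrite Rintegral_cst//= /Rintegral.
  have := x0_mean i k; rewrite unlock => ->.
  by rewrite [X in _ * fine X](_ : _ = 1%E)//= mulr1 subrr.
- by apply: sqint_integrable => //; exact: initial_sqint.
- by apply: sqint_integrable => //; exact: sqint_cst.
Qed.

Lemma initial_cross i j k : i != j ->
  \int[Pr]_w ((x0 i w k 0 - xbar0 k 0) * (x0 j w k 0 - xbar0 k 0)) = 0.
Proof.
move=> ij.
rewrite (Rintegral_mul_indep (X := fun w => x0 i w k 0 - xbar0 k 0)
  (Y := fun w => x0 j w k 0 - xbar0 k 0)).
- by rewrite initial_centered_mean mul0r.
- exact: (initial_centered_sqint i k).1.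
- exact: (initial_centered_sqint j k).1.
- by apply: sqint_integrable => //; exact: initial_centered_sqint.
- by apply: sqint_integrable => //; exact: initial_centered_sqint.
- move=> A B mA mB.
  have gen l (D : set R) : measurable D ->
      sigma_gen (coords (x0 l)) ((fun w => x0 l w k 0 - xbar0 k 0) @^-1` D).
    move=> mD; have mD' : measurable ((fun x : R => x - xbar0 k 0) @^-1` D).
      rewrite -[X in measurable X]setTI.
      by apply: measurable_funB => //; exact: measurable_cst.
    by apply: (sigma_gen_preimage (X := fun w => x0 l w k 0) _ mD'); exists k.
  by apply: (mutual_indep_pair x0_indep ij); exact: gen.
Qed.

Lemma initial_mean_sqr_le N k : (0 < N)%N ->
  (\int[Pr]_w ((N%:R^-1 * \sum_(i < N) (x0 i w k 0 - xbar0 k 0)) ^+ 2)%:E <=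
   (2 * (C0 + xbar0 k 0 ^+ 2) / N%:R)%:E)%E.
Proof.
move=> N0; apply: mean_sqr_le => //.
- by move=> i; exact: initial_centered_sqint.
- move=> i; rewrite -lee_fin EFin_Rintegral_sqr//; last exact: initial_centered_sqint.
  apply: (le_trans (integral_sqrD_le Pr measurableT (x0_meas i k) (measurable_cst (- xbar0 k 0)))).
  have -> : ((2 * (C0 + xbar0 k 0 ^+ 2))%:E =
      2%:E * C0%:E + 2%:E * (xbar0 k 0 ^+ 2)%:E)%E by rewrite -!EFinM -EFinD mulrDr.
  apply: leeD; apply: lee_wpmul2l => //.
    exact: initial_sqr_le.
  under eq_integral do rewrite /cst sqrrN.
  by rewrite integral_cst// [X in (_ * X <= _)%E](_ : _ = 1%E)// mule1.
- by move=> i j ij; exact: initial_cross.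
Qed.

End agents.

(** * Comparison with a competitor *)

Section bounds.
Context d (Omega : measurableType d) (R : realType) (Pr : probability Omega R).
Variable T : R.
Hypothesis T0 : 0 < T.
Notation Rm := (measurableTypeR R).
Notation leb := (@lebesgue_measure R).
Notation mu := (leb \x Pr)%E.
Notation IT := (`[0%R, T]%classic : set Rm).
Notation strip := (@strip d Omega R T).
Notation U := (Rm * Omega)%type.

Definition gronwall_cst (L : R) : R :=
  2 * expR (2 * (2 * T * L + 1) * T) * (2 + 2 * T ^+ 2).

Lemma gronwall_cst_ge0 L : 0 <= gronwall_cst L.
Proof.
by rewrite /gronwall_cst mulr_ge0// ?mulr_ge0 ?expR_ge0// addr_ge0// mulr_ge0// sqr_ge0.
Qed.

Lemma mx_continuous_bound m n (M : R -> 'M[R]_(m, n)) : mx_continuous T M ->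
  exists2 c : R, 0 <= c & forall t u, IT t -> sqnorm (M t *m u) <= c * sqnorm u.
Proof.
move=> cM; have /choice[c Mc] : forall ij : 'I_m * 'I_n, exists c : R,
    forall t, IT t -> `|M t ij.1 ij.2| <= c.
  by move=> ij; have [_] := mx_continuous_mbounded ij.1 ij.2 cM.
exists ((m * n)%:R * \sum_ij c ij ^+ 2).
  by rewrite mulr_ge0// sumr_ge0// => ij _; exact: sqr_ge0.
move=> t u tI; apply: sqnorm_mulmx_le => i j.
rewrite (bigD1 (i, j))//=; apply: (@le_trans _ _ (c (i, j) ^+ 2)).
  have Mcij := Mc (i, j) t tI.
  by rewrite -real_normK ?num_real// ler_sqr ?nnegrE// (le_trans _ Mcij).
by rewrite lerDl sumr_ge0// => ij _; exact: sqr_ge0.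
Qed.

Lemma mx_bound m n (M : 'M[R]_(m, n)) :
  exists2 c : R, 0 <= c & forall u, sqnorm (M *m u) <= c * sqnorm u.
Proof.
have [c c0 Mc] := mx_continuous_bound (@mx_continuous_cst R T m n M).
by exists c => // u; apply: (Mc 0); rewrite /= in_itv/= lexx ltW.
Qed.

Lemma mvec_sqnorm n (z : U -> 'cV[R]_n) : mvec T z ->
  measurable_fun strip (fun p => sqnorm (z p)).
Proof. by move=> mz; apply: measurable_sum => k; apply: measurable_funX; exact: mz. Qed.

Lemma svec_mvec n (z : U -> 'cV[R]_n) : svec Pr T z -> mvec T z.
Proof. by move=> sz k; case: (sz k). Qed.

Lemma svec_sqnorm_lty n (z : U -> 'cV[R]_n) : svec Pr T z ->
  (\int[mu]_(p in strip) (sqnorm (z p))%:E < +oo)%E.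
Proof.
move=> sz; have mst := @measurable_strip d Omega R T.
under eq_integral do rewrite /sqnorm -sumEFin.
rewrite ge0_integral_sum//; last 2 first.
- by move=> k; apply/measurable_EFinP; apply: measurable_funX; exact: (sz k).1.
- by move=> k p _; rewrite lee_fin sqr_ge0.
by apply: lte_sum_pinfty => k _; exact: (sz k).2.
Qed.

Lemma sqnorm_lty_svec n (z : U -> 'cV[R]_n) : mvec T z ->
  (\int[mu]_(p in strip) (sqnorm (z p))%:E < +oo)%E -> svec Pr T z.
Proof.
move=> mz zoo k; split; first exact: mz.
have mst := @measurable_strip d Omega R T.
apply: le_lt_trans zoo; apply: ge0_le_integral => //.
- by move=> p _; rewrite lee_fin sqr_ge0.
- by apply/measurable_EFinP; apply: measurable_funX; exact: mz.
- by apply/measurable_EFinP; exact: mvec_sqnorm.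
- move=> p _; rewrite lee_fin /sqnorm (bigD1 k)//= lerDl.
  by apply: sumr_ge0 => l _; exact: sqr_ge0.
Qed.

Lemma gronwall_vec n (z c b : U -> 'cV[R]_n) (gam : U -> R) (L : R) : 0 <= L ->
  mvec T z -> mvec T c -> mvec T b -> measurable_fun strip gam ->
  (forall p, 0 <= gam p) ->
  (forall k, {ae Pr, forall w, sqint leb IT (fun t => z (t, w) k 0)}) ->
  (forall k, path_int Pr T (fun p => z p k 0) (fun p => c p k 0) (fun p => b p k 0)) ->
  (forall p, strip p -> sqnorm (b p) <= L * sqnorm (z p) + gam p) ->
  (\int[mu]_(p in strip) (sqnorm (z p))%:E <= (gronwall_cst L)%:E *
   (\int[mu]_(p in strip) (sqnorm (c p))%:E + \int[mu]_(p in strip) (gam p)%:E))%E.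
Proof.
move=> L0 mz mc mb mg g0 sz zE bz.
apply: (gronwall_process (beta := fun k p => b p k 0) (ltW T0) L0) => //.
by move=> k; apply: filterS (zE k) => w [].
Qed.

(** All [N n] components are estimated together, because the agents are coupled through their mean.
    Only finiteness is drawn from the bound. *)
Lemma gronwall_family_sq (N n : nat) (z c b : 'I_N -> U -> 'cV[R]_n) (gam : U -> R) (L : R) :
  0 <= L -> (forall i, mvec T (z i)) -> (forall i, svec Pr T (c i)) ->
  (forall i, mvec T (b i)) -> measurable_fun strip gam -> (forall p, 0 <= gam p) ->
  (\int[mu]_(p in strip) (gam p)%:E < +oo)%E ->
  (forall i k, {ae Pr, forall w, sqint leb IT (fun t => z i (t, w) k 0)}) ->
  (forall i k, {ae Pr, forall w, {ae leb, forall t, IT t ->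
     z i (t, w) k 0 - c i (t, w) k 0 - \int[leb]_(s in `[0, t]) b i (s, w) k 0 = 0}}) ->
  (forall p, strip p -> \sum_i sqnorm (b i p) <= L * \sum_i sqnorm (z i p) + gam p) ->
  forall i, svec Pr T (z i).
Proof.
move=> L0 mz sc mb mg g0 goo sz zE bz i k; split; first exact: mz.
have mst := @measurable_strip d Omega R T.
have pairE (y : 'I_N -> U -> 'cV[R]_n) p :
    \sum_(l : 'I_N * 'I_n) y l.1 p l.2 0 ^+ 2 = \sum_j sqnorm (y j p).
  by rewrite /sqnorm pair_big.
have := gronwall_process (z := fun l p => z l.1 p l.2 0) (c := fun l p => c l.1 p l.2 0)
  (beta := fun l p => b l.1 p l.2 0) (gam := gam) (ltW T0) L0
  (fun l => mz l.1 l.2) (fun l => (sc l.1 l.2).1) (fun l => mb l.1 l.2) mg g0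
  (fun l => sz l.1 l.2) (fun l => zE l.1 l.2).
have -> : (forall p, strip p -> \sum_(l : 'I_N * 'I_n) b l.1 p l.2 0 ^+ 2 <=
    L * (\sum_(l : 'I_N * 'I_n) z l.1 p l.2 0 ^+ 2) + gam p) = True.
  by apply/propext; split => // _ p pS; rewrite !pairE; exact: bz.
move=> /(_ I) h.
apply: le_lt_trans (le_lt_trans h _).
  apply: ge0_le_integral => //.
  - by move=> p _; rewrite lee_fin sqr_ge0.
  - by apply/measurable_EFinP; apply: measurable_funX; exact: mz.
  - apply/measurable_EFinP; apply: measurable_sum => l; apply: measurable_funX; exact: mz.
  - move=> p _; rewrite lee_fin (bigD1 (i, k))//= lerDl.
    by apply: sumr_ge0 => l _; exact: sqr_ge0.
have coo : (\int[mu]_(p in strip) (\sum_(l : 'I_N * 'I_n) c l.1 p l.2 0 ^+ 2)%:E < +oo)%E.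
  under eq_integral do rewrite -sumEFin.
  rewrite ge0_integral_sum//; last 2 first.
  - by move=> l; apply/measurable_EFinP; apply: measurable_funX; exact: (sc l.1 l.2).1.
  - by move=> l p _; rewrite lee_fin sqr_ge0.
  by apply: lte_sum_pinfty => l _; exact: (sc l.1 l.2).2.
rewrite lte_mul_pinfty//.
- by rewrite lee_fin; exact: gronwall_cst_ge0.
- exact: lte_add_pinfty.
Qed.

Lemma mvec_mean N n (z : 'I_N -> R -> Omega -> 'cV[R]_n) :
  (forall i, mvec T (fun p : U => z i p.1 p.2)) ->
  mvec T (fun p : U => mean_field z p.1 p.2).
Proof.
move=> mz; apply: (vecZ (C := det_coef T)).
- exact: meas_procM.
- exact: det_coef_cst.
- by apply: vec_sum => //; [exact: meas_proc0|exact: meas_procD].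
Qed.

Lemma svec_mean N n (z : 'I_N -> R -> Omega -> 'cV[R]_n) :
  (forall i, svec Pr T (fun p : U => z i p.1 p.2)) ->
  svec Pr T (fun p : U => mean_field z p.1 p.2).
Proof.
move=> mz; apply: (vecZ (C := det_coef T)).
- exact: sq_procM.
- exact: det_coef_cst.
- by apply: vec_sum => //; [exact: sq_proc0|exact: sq_procD].
Qed.

Lemma mvecD n (y z : U -> 'cV[R]_n) : mvec T y -> mvec T z -> mvec T (fun p => y p + z p).
Proof. by apply: vecD; exact: meas_procD. Qed.

Lemma svecD n (y z : U -> 'cV[R]_n) : svec Pr T y -> svec Pr T z ->
  svec Pr T (fun p => y p + z p).
Proof. by apply: vecD; exact: sq_procD. Qed.

Lemma svecN n (z : U -> 'cV[R]_n) : svec Pr T z -> svec Pr T (fun p => - z p).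
Proof.
apply: (vecN (C := det_coef T)); [exact: sq_procM|exact: det_coef_cst].
Qed.

Lemma mvecN n (z : U -> 'cV[R]_n) : mvec T z -> mvec T (fun p => - z p).
Proof.
apply: (vecN (C := det_coef T)); [exact: meas_procM|exact: det_coef_cst].
Qed.

Lemma mvec_mulmx m n (M : R -> 'M[R]_(m, n)) (z : U -> 'cV[R]_n) :
  mx_continuous T M -> mvec T z -> mvec T (fun p => M p.1 *m z p).
Proof.
move=> cM; apply: (vec_mulmx (C := det_coef T)).
- exact: meas_proc0.
- exact: meas_procD.
- exact: meas_procM.
- by move=> i j; exists (fun t => M t i j); split => //; exact: mx_continuous_mbounded.
Qed.

Lemma svec_mulmx m n (M : R -> 'M[R]_(m, n)) (z : U -> 'cV[R]_n) :
  mx_continuous T M -> svec Pr T z -> svec Pr T (fun p => M p.1 *m z p).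
Proof.
move=> cM; apply: (vec_mulmx (C := det_coef T)).
- exact: sq_proc0.
- exact: sq_procD.
- exact: sq_procM.
- by move=> i j; exists (fun t => M t i j); split => //; exact: mx_continuous_mbounded.
Qed.

Lemma svec_mulmxc m n (M : 'M[R]_(m, n)) (z : U -> 'cV[R]_n) :
  svec Pr T z -> svec Pr T (fun p => M *m z p).
Proof. exact: (svec_mulmx (@mx_continuous_cst R T m n M)). Qed.

Lemma mvec_mulmxc m n (M : 'M[R]_(m, n)) (z : U -> 'cV[R]_n) :
  mvec T z -> mvec T (fun p => M *m z p).
Proof. exact: (mvec_mulmx (@mx_continuous_cst R T m n M)). Qed.

Lemma svec_det n (g : R -> 'cV[R]_n) : mx_continuous T g -> svec Pr T (fun p => g p.1).
Proof.
move=> cg k; apply: det_coef_sq; exists (fun t => g t k 0); split => //.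
exact: mx_continuous_mbounded.
Qed.

End bounds.

Ltac mx_cont := lazymatch goal with
  | |- mx_continuous _ (fun t => @?F t + @?G t) => apply: mx_continuousD; mx_cont
  | |- mx_continuous _ (fun t => - @?F t) => apply: mx_continuousN; mx_cont
  | |- mx_continuous _ (fun t => _ *: @?F t) => apply: mx_continuousZ; mx_cont
  | |- mx_continuous _ (fun t => @?F t *m @?G t) => apply: mx_continuousM; mx_cont
  | |- mx_continuous _ (fun t => trmx (@?F t)) => apply: mx_continuousT; mx_cont
  | |- mx_continuous _ (fun _ => ?M) => exact: mx_continuous_cst
  | |- _ => assumption
  end.

(** * A priori square integrability of families coupled through their mean *)

Section affine.
Context d (Omega : measurableType d) (R : realType) (Pr : probability Omega R).
Variable T : R.
Hypothesis T0 : 0 < T.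
Notation Rm := (measurableTypeR R).
Notation leb := (@lebesgue_measure R).
Notation mu := (leb \x Pr)%E.
Notation IT := (`[0%R, T]%classic : set Rm).
Notation strip := (@strip d Omega R T).
Notation U := (Rm * Omega)%type.
Notation proc x := (fun p : U => x p.1 p.2).

(** Serves the feedback states and the competitor's states alike. The constants 4 come from
    splitting a square twice, and the mean is controlled by [N |mean|^2 <= \sum_i |x_i|^2]. *)
Lemma affine_family_sq N n (M : R -> 'M[R]_n) (G : 'M[R]_n)
    (x : 'I_N -> R -> Omega -> 'cV[R]_n) (c g : 'I_N -> U -> 'cV[R]_n) :
  (0 < N)%N -> mx_continuous T M -> (forall i, mvec T (proc (x i))) ->
  (forall i, svec Pr T (c i)) -> (forall i, svec Pr T (g i)) ->
  (forall i k, {ae Pr, forall w, sqint leb IT (fun t => x i t w k 0)}) ->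
  (forall i k, {ae Pr, forall w, {ae leb, forall t, IT t ->
     x i t w k 0 - c i (t, w) k 0 - \int[leb]_(s in `[0, t])
       (M s *m x i s w + G *m mean_field x s w + g i (s, w)) k 0 = 0}}) ->
  forall i, svec Pr T (proc (x i)).
Proof.
move=> N0 cM mx sc sg sx xE.
have mst := @measurable_strip d Omega R T.
have [cm cm0 Mc] := mx_continuous_bound cM; have [cg cg0 Gc] := mx_bound T0 G.
have mgi i : measurable_fun strip (fun p => sqnorm (g i p)).
  by apply: mvec_sqnorm; apply: svec_mvec; exact: sg.
apply: (@gronwall_family_sq _ _ _ _ _ T0 _ _ (fun i => proc (x i)) c
  (fun i p => M p.1 *m x i p.1 p.2 + G *m mean_field x p.1 p.2 + g i p)
  (fun p => 2 * \sum_i sqnorm (g i p)) (4 * cm + 4 * cg)) => //.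
- by rewrite addr_ge0// mulr_ge0.
- move=> i; apply: mvecD; first apply: mvecD.
  + exact: mvec_mulmx.
  + by apply: mvec_mulmxc => //; exact: mvec_mean.
  + by apply: svec_mvec; exact: sg.
- by apply: measurable_funM => //; exact: measurable_sum.
- by move=> p; rewrite mulr_ge0// sumr_ge0// => i _; exact: sqnorm_ge0.
- under eq_integral do rewrite EFinM -sumEFin.
  rewrite ge0_integralZl//; last 2 first.
  + by apply: emeasurable_sum => i; exact/measurable_EFinP.
  + by move=> p _; apply: sume_ge0 => i _; rewrite lee_fin sqnorm_ge0.
  rewrite ge0_integral_sum//; last 2 first.
  + by move=> i; exact/measurable_EFinP.
  + by move=> i p _; rewrite lee_fin sqnorm_ge0.
  rewrite lte_mul_pinfty ?lee_fin//.
  by apply: lte_sum_pinfty => i _; exact: svec_sqnorm_lty.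
- move=> p [pI _].
  have step i : sqnorm (M p.1 *m x i p.1 p.2 + G *m mean_field x p.1 p.2 + g i p) <=
      4 * cm * sqnorm (x i p.1 p.2) + 4 * cg * sqnorm (mean_field x p.1 p.2) + 2 * sqnorm (g i p).
    apply: (le_trans (sqnormD_le _ _)); rewrite lerD2r.
    have := sqnormD_le (M p.1 *m x i p.1 p.2) (G *m mean_field x p.1 p.2).
    have := Mc _ (x i p.1 p.2) pI; have := Gc (mean_field x p.1 p.2).
    lra.
  apply: (le_trans (ler_sum _ (fun i _ => step i))).
  have -> : \sum_i (4 * cm * sqnorm (x i p.1 p.2) +
        4 * cg * sqnorm (mean_field x p.1 p.2) + 2 * sqnorm (g i p)) =
      4 * cm * (\sum_i sqnorm (x i p.1 p.2)) +
      4 * cg * (sqnorm (mean_field x p.1 p.2) * N%:R) + 2 * \sum_i sqnorm (g i p).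
    by rewrite !big_split/= -!mulr_sumr sumr_const card_ord -[_ *+ N]mulr_natr.
  have := sqnorm_mean_le (fun i => x i p.1 p.2) N0; rewrite -/(mean_field x p.1 p.2).
  rewrite mulrC ler_pdivlMr ?ltr0n// => h.
  have := ler_wpM2l (mulr_ge0 (ler0n R 4) cg0) h; lra.
Qed.

Lemma svec_path_integrable n (b : U -> 'cV[R]_n) k : svec Pr T b ->
  {ae Pr, forall w, leb.-integrable IT (EFin \o (fun t => b (t, w) k 0))}.
Proof.
move=> sb; apply: (ae_integrable_path (f := fun p => b p k 0)).
apply: sqint_integrable; [exact: measurable_strip|exact: strip_measure_lty|exact: sb].
Qed.

End affine.

(** * The closed loop: derivatives of the coefficients and symmetry of [P] and [K] *)

Section closed_loop.
Context (R : realType) (d : measure_display)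
    (Omega : measurableType d) (Pr : probability Omega R) (n r : nat)
    (T rho : R) (T_gt0 : 0 < T) (rho_gt0 : 0 < rho)
    (A G Gam Q : 'M[R]_n) (B : 'M[R]_(n, r)) (Rw : 'M[R]_r) (eta : 'cV[R]_n)
    (Q_sym : sym_mx Q) (Rw_sym : sym_mx Rw) (Rw_pd : pd_mx Rw)
    (f sigma : R -> 'cV[R]_n)
    (f_cont : {within `[0, +oo[, continuous f})
    (sigma_cont : {within `[0, +oo[, continuous sigma})
    (W : nat -> R -> Omega -> R) (x0 : nat -> Omega -> 'cV[R]_n)
    (W_brownian : forall i, brownian_motion Pr (W i))
    (W_indep : mutual_indep Pr
       (fun i => sigma_gen [set W i t | t in `[0, +oo[]))
    (x0_meas : forall i k, measurable_fun setT (fun w => x0 i w k 0))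
    (x0_indep : mutual_indep Pr (fun i => sigma_gen (coords (x0 i))))
    (xbar0 : 'cV[R]_n)
    (x0_mean : forall i k, ('E_Pr[fun w => x0 i w k 0%R])%E = (xbar0 k 0)%:E)
    (C0 : R)
    (x0_L2 : forall i, (\int[Pr]_w (sqnorm (x0 i w))%:E < C0%:E)%E)
    (x0_W_indep : indep2 Pr
       (sigma_gen (\bigcup_i coords (x0 i)))
       (sigma_gen (\bigcup_i [set W i t | t in `[0, +oo[])))
    (Q_psd : psd_mx Q)
    (P K : R -> 'M[R]_n) (s xbar : R -> 'cV[R]_n)
    (P_cont : {within `[0, T], continuous P})
    (P_eq : forall t, t \in `]0, T[ -> derivable P t 1 /\
       rho *: P t = derive1 P t + A^T *m P t + P t *m A
         - P t *m B *m invmx Rw *m B^T *m P t + Q)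
    (P_T : P T = 0)
    (K_cont : {within `[0, T], continuous K})
    (K_eq : forall t, t \in `]0, T[ -> derivable K t 1 /\
       rho *: K t = derive1 K t + (A + G)^T *m K t + K t *m (A + G)
         - P t *m B *m invmx Rw *m B^T *m K t
         - K t *m B *m invmx Rw *m B^T *m P t
         + G^T *m P t + P t *m G
         - K t *m B *m invmx Rw *m B^T *m K t - Q_Gamma Gam Q)
    (K_T : K T = 0)
    (s_cont : {within `[0, T], continuous s})
    (s_eq : forall t, t \in `]0, T[ -> derivable s t 1 /\
       rho *: s t = derive1 s t
         + (A + G - B *m invmx Rw *m B^T *m (P t + K t))^T *m s t
         + (P t + K t) *m f t - eta_bar Gam Q eta)
    (s_T : s T = 0)
    (xbar_cont : {within `[0, T], continuous xbar})
    (xbar_eq : forall t, t \in `]0, T[ -> derivable xbar t 1 /\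
       derive1 xbar t = (A + G) *m xbar t
         - B *m invmx Rw *m B^T *m ((P t + K t) *m xbar t + s t) + f t)
    (xbar_0 : xbar 0 = xbar0).
Notation Rm := (measurableTypeR R).
Notation leb := (@lebesgue_measure R).
Notation mu := (leb \x Pr)%E.
Notation IT := (`[0%R, T]%classic : set Rm).
Notation strip := (@strip d Omega R T).
Notation U := (Rm * Omega)%type.
Notation proc x := (fun p : U => x p.1 p.2).
Notation S := (B *m invmx Rw *m B^T).

Let within_line (g : R -> 'cV[R]_n) : {within `[0, +oo[, continuous g} -> mx_continuous T g.
Proof. by apply: within_mx_continuous; apply: subset_itvl; rewrite bnd_simp. Qed.

Let cf : mx_continuous T f. Proof. exact: within_line. Qed.

Let ssigma k : sqint leb IT (fun t => sigma t k 0).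
Proof.
have [ms [c sc]] := mx_continuous_mbounded k 0 (within_line sigma_cont).
by apply: (sqint_bounded _ _ ms sc) => //; exact: lebesgue_itv0_lty.
Qed.

Let cP : mx_continuous T P.
Proof. by apply: within_mx_continuous P_cont; exact: subset_refl. Qed.
Let cK : mx_continuous T K.
Proof. by apply: within_mx_continuous K_cont; exact: subset_refl. Qed.
Let cs : mx_continuous T s.
Proof. by apply: within_mx_continuous s_cont; exact: subset_refl. Qed.
Let cxb : mx_continuous T xbar.
Proof. by apply: within_mx_continuous xbar_cont; exact: subset_refl. Qed.
(** The derivatives are defined by solving the equations for them, which makes them continuous on
    the closed interval; the equations themselves are given in its interior. *)
Let Pd t := rho *: P t - A^T *m P t - P t *m A
  + P t *m B *m invmx Rw *m B^T *m P t - Q.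
Let Kd t := rho *: K t - (A + G)^T *m K t - K t *m (A + G)
  + P t *m B *m invmx Rw *m B^T *m K t + K t *m B *m invmx Rw *m B^T *m P t
  - G^T *m P t - P t *m G + K t *m B *m invmx Rw *m B^T *m K t + Q_Gamma Gam Q.
Let sd t := rho *: s t - (A + G - S *m (P t + K t))^T *m s t
  - (P t + K t) *m f t + eta_bar Gam Q eta.
Let xbd t := (A + G) *m xbar t - S *m ((P t + K t) *m xbar t + s t) + f t.

Let pP : mx_prim T P Pd.
Proof.
apply: mx_prim_FTC => //; first by rewrite /Pd; mx_cont.
move=> t /P_eq[dP E]; split => //; rewrite /Pd E; apply/matrixP => k l.
move: (A^T *m P t) (P t *m A) (P t *m B *m _ *m _ *m _) => M1 M2 M3.
by rewrite !mxE; ring.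
Qed.

Let pK : mx_prim T K Kd.
Proof.
apply: mx_prim_FTC => //; first by rewrite /Kd; mx_cont.
move=> t /K_eq[dK E]; split => //; rewrite /Kd E; apply/matrixP => k l.
move: (_^T *m K t) (K t *m (A + G)) (P t *m B *m _ *m _ *m K t)
  (K t *m B *m _ *m _ *m P t) (G^T *m P t) (P t *m G) (K t *m B *m _ *m _ *m K t)
  (Q_Gamma Gam Q) => M1 M2 M3 M4 M5 M6 M7 M8.
by rewrite !mxE; ring.
Qed.

Let ps : mx_prim T s sd.
Proof.
apply: mx_prim_FTC => //; first by rewrite /sd; mx_cont.
move=> t /s_eq[ds E]; split => //; rewrite /sd E; apply/matrixP => k l.
move: (_^T *m s t) ((P t + K t) *m f t) (eta_bar _ _ _) => M1 M2 M3.
by rewrite !mxE; ring.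
Qed.

Let pxb : mx_prim T xbar xbd.
Proof.
by apply: mx_prim_FTC => //; rewrite /xbd; mx_cont.
Qed.

Let S_sym : S^T = S.
Proof. by rewrite !trmx_mul trmxK trmx_inv Rw_sym mulmxA. Qed.

Let trD k l (M1 M2 : 'M[R]_(k, l)) : (M1 + M2)^T = M1^T + M2^T.
Proof. exact: linearD. Qed.
Let trN k l (M1 : 'M[R]_(k, l)) : (- M1)^T = - M1^T.
Proof. exact: linearN. Qed.
Let trZ k l c (M1 : 'M[R]_(k, l)) : (c *: M1)^T = c *: M1^T.
Proof. exact: linearZ. Qed.

Let mulmx_inj (M1 M2 : 'M[R]_n) : (forall u : 'cV[R]_n, M1 *m u = M2 *m u) -> M1 = M2.
Proof.
move=> h; apply/matrixP => i j; have := congr1 (fun M : 'cV[R]_n => M i 0) (h (delta_mx j 0)).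
have E (M : 'M[R]_n) : (M *m (delta_mx j 0 : 'cV[R]_n)) i 0 = M i j.
  rewrite mxE (bigD1 j)//= mxE !eqxx mulr1 big1 ?addr0// => k kj.
  by rewrite mxE (negPf kj) mulr0.
by rewrite !E.
Qed.

Let P_sym t : IT t -> sym_mx (P t).
Proof.
(* The quadratic term splits as [P S P - P^T S P^T = P S (P - P^T) + (P - P^T) S P^T]. *)
apply: (mx_prim_sym T_gt0 pP P_T (U := fun t => rho%:M - A^T + P t *m S)
  (V := fun t => - A + S *m (P t)^T)) => {t}.
- by mx_cont.
- by mx_cont.
move=> t _; rewrite /Pd; apply: mulmx_inj => u; apply: dot_inj => w.
have -> : P t *m B *m invmx Rw *m B^T *m P t = P t *m S *m P t by rewrite !mulmxA.
move: S_sym; set S0 := (B *m invmx Rw *m B^T); move: S0 => S0 S0_sym.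
rewrite !(trD, trN, trZ) !trmx_mul S0_sym trmxK Q_sym.
rewrite !(mulmxDr, mulmxDl, mulmxN, mulNmx) !mulmxA -!(scalemxAl, mul_scalar_mx).
rewrite !mul_scalar_mx -?scalemxAl !(dotDl, dotNl, dotZl); ring.
Qed.

Let K_sym t : IT t -> sym_mx (K t).
Proof.
(* The same splitting for [K S K]; the mixed terms contribute [P S] on the left and [S P] on the
   right because [P] is already symmetric. *)
apply: (mx_prim_sym T_gt0 pK K_T (U := fun t => rho%:M - (A + G)^T + P t *m S + K t *m S)
  (V := fun t => - (A + G) + S *m P t + S *m (K t)^T)) => {t}.
- by mx_cont.
- by mx_cont.
move=> t tI; have Ps := P_sym tI; rewrite /Kd; apply: mulmx_inj => u; apply: dot_inj => w.
have E (M1 M2 : 'M[R]_n) : M1 *m B *m invmx Rw *m B^T *m M2 = M1 *m S *m M2 by rewrite !mulmxA.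
rewrite !E /Q_Gamma.
move: S_sym; set S0 := (B *m invmx Rw *m B^T); move: S0 => S0 S0_sym.
move: (A + G) => AG.
rewrite !(trD, trN, trZ) !trmx_mul S0_sym !trmxK Q_sym Ps.
rewrite !(mulmxDr, mulmxDl, mulmxN, mulNmx) !mulmxA -!(scalemxAl, mul_scalar_mx).
rewrite !mul_scalar_mx -?scalemxAl !(dotDl, dotNl, dotZl); ring.
Qed.

Let drift N (xh : 'I_N -> R -> Omega -> 'cV[R]_n) (i : 'I_N) t w : 'cV[R]_n :=
  (A - S *m P t) *m xh i t w - S *m (K t *m xbar t + s t)
  + G *m mean_field xh t w + f t.

(** * Fluctuation of the empirical mean of the feedback states around [xbar] *)

Section feedback.
Variables (N : nat) (xh : 'I_N -> R -> Omega -> 'cV[R]_n).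
Hypothesis N_gt0 : (0 < N)%N.
Hypothesis xh_sde : forall i : 'I_N, ito_solution Pr T (joint_filtration x0 W N)
  (W i) (x0 i) (drift xh i) sigma (xh i).
Let M (i : 'I_N) := ito_martingale (x0 i) (drift xh i) (xh i).

Let xh_mvec i : mvec T (proc (xh i)).
Proof. exact: (ito_mvec (xh_sde i)). Qed.

Let feedback_coef : mx_continuous T (fun t => A - S *m P t).
Proof. by mx_cont. Qed.

Let driftE i t w : drift xh i t w = (A - S *m P t) *m xh i t w
  + G *m mean_field xh t w + (f t - S *m (K t *m xbar t + s t)).
Proof. by rewrite /drift [RHS]addrA [RHS]addrAC; congr (_ + _); rewrite addrAC. Qed.

Let source_svec : svec Pr T (fun p => f p.1 - S *m (K p.1 *m xbar p.1 + s p.1)).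
Proof. by apply: (svec_det Pr (g := fun t => f t - S *m (K t *m xbar t + s t))); mx_cont. Qed.

Let drift_mvec i : mvec T (proc (drift xh i)).
Proof.
have -> : proc (drift xh i) = fun p => (A - S *m P p.1) *m xh i p.1 p.2
  + G *m mean_field xh p.1 p.2 + (f p.1 - S *m (K p.1 *m xbar p.1 + s p.1)).
  by apply/funext => p; exact: driftE.
apply: mvecD; first apply: mvecD.
- exact: (mvec_mulmx feedback_coef).
- by apply: mvec_mulmxc => //; exact: mvec_mean.
- exact: svec_mvec source_svec.
Qed.

Let c_ (i : 'I_N) (p : U) : 'cV[R]_n := \col_k (x0 i p.2 k 0 + M i k p.1 p.2).

Let c_svec i : svec Pr T (c_ i).
Proof.
apply: (ito_source_svec (W_brownian i) (x0_meas i) ssigma (xh_sde i) (drift_mvec i)) => k.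
exact: (initial_sqint x0_meas x0_L2).
Qed.

Lemma feedback_state_svec i : svec Pr T (proc (xh i)).
Proof.
apply: (affine_family_sq (G := G) T_gt0 N_gt0 feedback_coef xh_mvec c_svec (fun=> source_svec)) => j k.
  exact: (ito_sqint_path (xh_sde j)).
apply: aeW => w; apply: aeW => t _; rewrite mxE /M /ito_martingale.
under [X in _ - X = _]eq_Rintegral do rewrite -driftE.
by set I1 := Rintegral _ _ _; ring.
Qed.

Lemma feedback_drift_svec i : svec Pr T (proc (drift xh i)).
Proof.
have -> : proc (drift xh i) = fun p => (A - S *m P p.1) *m xh i p.1 p.2
  + G *m mean_field xh p.1 p.2 + (f p.1 - S *m (K p.1 *m xbar p.1 + s p.1)).
  by apply/funext => p; exact: driftE.
apply: svecD; first apply: svecD.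
- exact: (svec_mulmx feedback_coef (feedback_state_svec i)).
- by apply: svec_mulmxc => //; apply: svec_mean => // j; exact: feedback_state_svec.
- exact: source_svec.
Qed.

Lemma feedback_path_int i k : path_int Pr T (fun p => xh i p.1 p.2 k 0)
  (fun p => x0 i p.2 k 0 + M i k p.1 p.2) (fun p => drift xh i p.1 p.2 k 0).
Proof.
have := svec_path_integrable k (feedback_drift_svec i).
apply: filterS => w Iw; split => //.
apply: aeW => t _; rewrite /M /ito_martingale /=.
by set I1 := Rintegral _ _ _; ring.
Qed.

Lemma feedback_martingale_cross i j k t : i != j -> IT t ->
  \int[Pr]_w (M i k t w * M j k t w) = 0.
Proof.
move=> ij tI.
apply: (wiener_cross W_brownian W_indep (ssigma k) (ssigma k) _
  (ito_wiener (xh_sde i) k) (ito_wiener (xh_sde j) k) tI) => //.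
- exact: (ito_martingale_meas (x0_meas i) (xh_sde i) (drift_mvec i)).
- exact: (ito_martingale_meas (x0_meas j) (xh_sde j) (drift_mvec j)).
Qed.

(** Second moment bound for one component of one agent's martingale; it involves neither the agent
    nor [N]. *)
Let csig k := 4 * normal_var R * \int[leb]_(t in IT) (sigma t k 0 ^+ 2).

Lemma feedback_martingale_mean_sqr k t : IT t ->
  (\int[Pr]_w ((N%:R^-1 * \sum_i M i k t w) ^+ 2)%:E <= (csig k / N%:R)%:E)%E.
Proof.
move=> tI; have sM i : sqint Pr setT (M i k t).
  exact: (ito_martingale_sqint (W_brownian i) (x0_meas i) ssigma (xh_sde i) (drift_mvec i)).
apply: mean_sqr_le => //.
- move=> i; rewrite -lee_fin EFin_Rintegral_sqr// /csig EFinM EFin_Rintegral_sqr//.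
  exact: (ito_martingale_sqr_le (W_brownian i) (x0_meas i) ssigma (xh_sde i) (drift_mvec i)).
- by move=> i j ij; apply: feedback_martingale_cross.
Qed.

Let dev (p : U) := mean_field xh p.1 p.2 - xbar p.1.
(** Source of the equation of [dev]: what remains of the initial states and of the noise after
    averaging and subtracting [xbar0]. *)
Let cdev (p : U) : 'cV[R]_n := \col_k (N%:R^-1 * (\sum_(i < N) (x0 i p.2 k 0 - xbar0 k 0))
  + N%:R^-1 * \sum_i M i k p.1 p.2).

Let N_neq0 : N%:R != 0 :> R. Proof. by rewrite pnatr_eq0 -lt0n. Qed.

Let sum_cst (v : 'cV[R]_n) : \sum_(i < N) v = N%:R *: v.
Proof. by rewrite sumr_const card_ord scaler_nat. Qed.

(** When the equation of [xbar] is subtracted from the averaged closed loop, the inputs [K xbar],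
    [s] and [f] cancel, so that [dev] obeys a linear equation of its own. *)
Lemma deviation_path_int k : path_int Pr T (fun p => dev p k 0) (fun p => cdev p k 0)
  (fun p => ((A + G - S *m P p.1) *m dev p) k 0).
Proof.
have := path_intB (path_intZ N%:R^-1 (path_int_sum (index_enum 'I_N)
  (fun i => feedback_path_int i k))) (path_int_prim Pr (pxb k 0)).
congr path_int; apply/funext => p.
- by rewrite /dev /mean_field !mxE summxE.
- rewrite mxE xbar_0 sumrB sumr_const card_ord big_split/= mulrBr mulrDr.
  by rewrite -[xbar0 k 0 *+ N]mulr_natl mulrA mulVf// mul1r; ring.
- have -> : (A + G - S *m P p.1) *m dev p =
      N%:R^-1 *: (\sum_i drift xh i p.1 p.2) - xbd p.1.
    rewrite /drift /xbd !big_split/= -mulmx_sumr !sum_cst.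
    have E (v : 'cV[R]_n) : N%:R^-1 *: (N%:R *: v) = v by rewrite scalerA mulVf// scale1r.
    rewrite !scalerDr !E scalemxAr -/(mean_field xh p.1 p.2) /dev.
    move: (mean_field xh p.1 p.2) => m.
    apply: dot_inj => w.
    rewrite !(mulmxDr, mulmxDl, mulmxN, mulNmx) !mulmxA !(dotDl, dotNl); ring.
  by rewrite !mxE summxE.
Qed.

Lemma cdev_sqr_le k t : IT t -> (\int[Pr]_w (cdev (t, w) k 0 ^+ 2)%:E <=
  ((4 * (C0 + xbar0 k 0 ^+ 2) + 2 * csig k) / N%:R)%:E)%E.
Proof.
move=> tI; under eq_integral do rewrite mxE/=.
have m1 : measurable_fun setT (fun w => N%:R^-1 * \sum_(i < N) (x0 i w k 0 - xbar0 k 0)).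
  apply: measurable_funM => //; apply: measurable_sum => i.
  exact: measurable_funB.
have m2 : measurable_fun setT (fun w => N%:R^-1 * \sum_i M i k t w).
  apply: measurable_funM => //; apply: measurable_sum => i.
  exact: (ito_martingale_meas (x0_meas i) (xh_sde i) (drift_mvec i)).
apply: (le_trans (integral_sqrD_le Pr measurableT m1 m2)).
have -> : (((4 * (C0 + xbar0 k 0 ^+ 2) + 2 * csig k) / N%:R)%:E =
   2%:E * (2 * (C0 + xbar0 k 0 ^+ 2) / N%:R)%:E + 2%:E * (csig k / N%:R)%:E)%E.
  by rewrite -!EFinM -EFinD; congr EFin; field.
apply: leeD; apply: lee_wpmul2l => //.
- exact: (initial_mean_sqr_le x0_meas x0_indep x0_mean x0_L2).
- exact: feedback_martingale_mean_sqr.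
Qed.

Let dev_svec : svec Pr T dev.
Proof.
apply: svecD; first by apply: svec_mean => // i; exact: feedback_state_svec.
apply: svecN; exact: (svec_det Pr cxb).
Qed.

Let cdev_mvec : mvec T cdev.
Proof.
move=> k; have -> : (fun p => cdev p k 0) = fun p => N%:R^-1 *
    (\sum_(i < N) (x0 i p.2 k 0 - xbar0 k 0)) + N%:R^-1 * \sum_i M i k p.1 p.2.
  by apply/funext => p; rewrite mxE.
apply: measurable_funD; apply: measurable_funM => //; apply: measurable_sum => i.
- apply: measurable_funB => //; apply: measurable_funTS.
  by apply: (measurableT_comp (x0_meas i k)); exact: measurable_snd.
- exact: (ito_martingale_strip (x0_meas i) (xh_sde i) (drift_mvec i)).
Qed.

Lemma cdev_sqnorm_le : (\int[mu]_(p in strip) (sqnorm (cdev p))%:E <=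
  (T * (\sum_k (4 * (C0 + xbar0 k 0 ^+ 2) + 2 * csig k)) / N%:R)%:E)%E.
Proof.
have mst := @measurable_strip d Omega R T.
under eq_integral do rewrite /sqnorm -sumEFin.
rewrite ge0_integral_sum//; last 2 first.
- by move=> k; apply/measurable_EFinP; apply: measurable_funX; exact: cdev_mvec.
- by move=> k p _; rewrite lee_fin sqr_ge0.
rewrite mulr_sumr mulr_suml -sumEFin; apply: lee_sum => k _.
have TI : IT T by rewrite /= in_itv/= ltW//= lexx.
have c0 : (0 <= ((4 * (C0 + xbar0 k 0 ^+ 2) + 2 * csig k) / N%:R)%:E)%E.
  apply: le_trans (cdev_sqr_le k TI).
  by apply: integral_ge0 => w _; rewrite lee_fin sqr_ge0.
apply: (le_trans (strip_sq_le (cdev_mvec k) _ c0)).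
  by move=> t tI; exact: cdev_sqr_le.
rewrite [X in (_ * X <= _)%E](_ : _ = T%:E); last exact: (lebesgue_itv0 (ltW T_gt0)).
by rewrite -EFinM lee_fin mulrC mulrA.
Qed.

(** As [L] bounds the matrix uniformly in time, the Gronwall constant is the same for every [N], and
    the rate [1 / N] of the source is inherited. *)
Lemma deviation_sqnorm_le L : 0 <= L ->
  (forall t u, IT t -> sqnorm ((A + G - S *m P t) *m u) <= L * sqnorm u) ->
  (\int[mu]_(p in strip) (sqnorm (dev p))%:E <=
   (gronwall_cst T L * (T * (\sum_k (4 * (C0 + xbar0 k 0 ^+ 2) + 2 * csig k))) / N%:R)%:E)%E.
Proof.
move=> L0 bL; have mdev := svec_mvec dev_svec.
have cM2 : mx_continuous T (fun t => A + G - S *m P t) by mx_cont.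
apply: (le_trans (gronwall_vec (c := cdev) (b := fun p => (A + G - S *m P p.1) *m dev p)
  (gam := fun=> 0) T_gt0 L0 mdev cdev_mvec _ _ _ _ deviation_path_int _)) => //.
- exact: (mvec_mulmx cM2 mdev).
- by move=> k; exact: (sqint_path (dev_svec k)).
- by move=> p [pI _]; rewrite addr0; exact: bL.
rewrite [X in (_ * (_ + X) <= _)%E](_ : _ = 0%E); last exact: integral0.
rewrite adde0 -mulrA [X in (_ <= X)%E]EFinM; apply: lee_wpmul2l; last exact: cdev_sqnorm_le.
by rewrite lee_fin; exact: gronwall_cst_ge0.
Qed.

(** * The social cost as one integral over the strip *)

Let cost (x' : 'I_N -> R -> Omega -> 'cV[R]_n) (u' : 'I_N -> R -> Omega -> 'cV[R]_r)
    (p : U) : R := expR (- (rho * p.1)) *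
  \sum_i (quad Q (x' i p.1 p.2 - Gam *m mean_field x' p.1 p.2 - eta)
          + quad Rw (u' i p.1 p.2)).

Let dot_meas m (a c : U -> 'cV[R]_m) : mvec T a -> mvec T c ->
  measurable_fun strip (fun p => dot (a p) (c p)).
Proof.
move=> ma mc; under eq_fun do rewrite dotE.
by apply: measurable_sum => k; apply: measurable_funM; [exact: ma|exact: mc].
Qed.

Let dot_integrable m (a c : U -> 'cV[R]_m) : svec Pr T a -> svec Pr T c ->
  mu.-integrable strip (EFin \o (fun p => dot (a p) (c p))).
Proof.
move=> sa sc; have mst := @measurable_strip d Omega R T.
have Ik k : mu.-integrable strip (EFin \o (fun p => a p k 0 * c p k 0)).
  exact: (sqint_mul mst (sa k) (sc k)).
have [//|J _] := @Rintegral_sum _ _ _ mu strip _ (index_enum 'I_m)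
  (fun k p => a p k 0 * c p k 0) mst.
by move: J; congr (mu.-integrable strip); apply/funext => p /=; rewrite dotE.
Qed.

Let discount_meas : measurable_fun strip (fun p : U => expR (- (rho * p.1))).
Proof.
have [[m _] _ _] := prim_expR T (- rho).
under eq_fun do rewrite -mulNr; exact: (measurable_strip_det m).
Qed.

Let eta_svec : svec Pr T (fun=> - eta).
Proof.
have h : svec Pr T (fun p : U => (fun=> - eta) p.1) := svec_det Pr (@mx_continuous_cst R T _ _ (- eta)).
exact: h.
Qed.

(** The integrand is nonnegative because [Q] is nonnegative and [Rw] positive, so Tonelli applies
    even to costs that might be infinite. *)
Lemma social_cost_strip x' u' : (forall i, mvec T (proc (x' i))) ->
  (forall i, mvec T (proc (u' i))) ->
  social_cost Pr T rho Gam Q Rw eta x' u' = (\int[mu]_(p in strip) (cost x' u' p)%:E)%E.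
Proof.
move=> mx' mu'; have mst := @measurable_strip d Omega R T.
pose c_i i (p : U) := expR (- (rho * p.1)) *
  (quad Q (x' i p.1 p.2 - Gam *m mean_field x' p.1 p.2 - eta) + quad Rw (u' i p.1 p.2)).
have mc i : measurable_fun strip (fun p => (c_i i p)%:E).
  apply/measurable_EFinP; apply: measurable_funM; first exact: discount_meas.
  apply: measurable_funD.
    under eq_fun do rewrite quad_dot.
    have mz : mvec T (fun p => x' i p.1 p.2 - Gam *m mean_field x' p.1 p.2 - eta).
      apply: (mvecD (z := fun=> - eta)); last exact: svec_mvec eta_svec.
      by apply: mvecD => //; apply: mvecN; apply: mvec_mulmxc; exact: mvec_mean.
    by apply: dot_meas => //; exact: mvec_mulmxc.
  under eq_fun do rewrite quad_dot.
  by apply: (dot_meas (c := proc (u' i))) => //; apply: mvec_mulmxc; exact: mu'.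
have c0 i p : (0 <= (c_i i p)%:E)%E.
  rewrite lee_fin; apply: mulr_ge0; first exact: expR_ge0.
  by apply: addr_ge0; [exact: Q_psd|exact: (pd_psd Rw_pd)].
transitivity (\sum_(i < N) \int[mu]_(p in strip) (c_i i p)%:E)%E.
  by apply: eq_bigr => i _; rewrite (strip_tonelli_omega Pr (mc i) (fun p _ => c0 i p)).
rewrite -ge0_integral_sum//; apply: eq_integral => p _.
by rewrite sumEFin /cost mulr_sumr.
Qed.

Lemma cost_integrable x' u' : (forall i, svec Pr T (proc (x' i))) ->
  (forall i, svec Pr T (proc (u' i))) -> mu.-integrable strip (EFin \o cost x' u').
Proof.
move=> sx' su'; have mst := @measurable_strip d Omega R T.
have sz i : svec Pr T (fun p => x' i p.1 p.2 - Gam *m mean_field x' p.1 p.2 - eta).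
  apply: (svecD (z := fun=> - eta)); last exact: eta_svec.
  by apply: svecD => //; apply: svecN; apply: svec_mulmxc; exact: svec_mean.
have sE m (z : U -> 'cV[R]_m) : svec Pr T z -> svec Pr T (fun p => expR (- (rho * p.1)) *: z p).
  move=> sz' k; have -> : (fun p => (expR (- (rho * p.1)) *: z p) k 0) =
      fun p => expR (- (rho * p.1)) * z p k 0 by apply/funext => p; rewrite mxE.
  apply: (sq_procM _ (sz' k)); exists (fun t => expR (- rho * t)); split.
    by have [] := prim_expR T (- rho).
  by apply/funext => p; rewrite mulNr.
have I1 i : mu.-integrable strip (EFin \o (fun p =>
    dot (expR (- (rho * p.1)) *: (Q^T *m (x' i p.1 p.2 - Gam *m mean_field x' p.1 p.2 - eta)))
      (x' i p.1 p.2 - Gam *m mean_field x' p.1 p.2 - eta) +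
    dot (expR (- (rho * p.1)) *: (Rw^T *m u' i p.1 p.2)) (u' i p.1 p.2))).
  apply: (integrableD _ (dot_integrable _ _) (dot_integrable _ _)) => //.
  - by apply: sE; exact: svec_mulmxc.
  - by apply: sE; apply: svec_mulmxc; exact: su'.
have [J _] := @Rintegral_sum _ _ _ mu strip _ (index_enum 'I_N) _ mst (fun i _ => I1 i).
move: J; congr (mu.-integrable strip); apply/funext => p /=; congr EFin.
by rewrite /cost mulr_sumr; apply: eq_bigr => i _; rewrite !dotZl -mulrDr !quad_dot.
Qed.

(** * Response of the states to a change of control *)

Section competitor.
Variables (u : 'I_N -> R -> Omega -> 'cV[R]_r) (x : 'I_N -> R -> Omega -> 'cV[R]_n).
Hypothesis u_L2 : L2_control Pr T (joint_filtration x0 W N) u.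
Hypothesis x_state : is_state Pr T A G B f sigma x0 W u x.
Hypothesis xh_adapted : forall i, adapted T (joint_filtration x0 W N) (xh i).

(** Below, [y] and [v] are the perturbations of state and control, [bu] is the competitor's drift,
    and [b] is the drift of [y], free of [f] and of the noise. *)
Let uh i t w := - (invmx Rw *m B^T *m (P t *m xh i t w + K t *m xbar t + s t)).
Let y i t w := x i t w - xh i t w.
Let v i t w := u i t w - uh i t w.
Let bu i t w := A *m x i t w + B *m u i t w + G *m mean_field x t w + f t.
Let b i t w := A *m y i t w + B *m v i t w + G *m mean_field y t w.

Let u_svec i : svec Pr T (proc (u i)).
Proof.
have [mu_ _ uoo] := u_L2; have mst := @measurable_strip d Omega R T.
apply: sqnorm_lty_svec; first exact: mu_.
have muj j : measurable_fun strip (fun p => sqnorm (u j p.1 p.2)).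
  by apply: (mvec_sqnorm (z := proc (u j))); exact: mu_.
move: uoo; rewrite -(@strip_tonelli_omega _ _ _ Pr T (fun p => (\sum_(i < N) sqnorm (u i p.1 p.2))%:E)).
- apply: le_lt_trans; apply: ge0_le_integral => //.
  + by move=> p _; rewrite lee_fin sqnorm_ge0.
  + exact/measurable_EFinP.
  + by apply/measurable_EFinP; exact: measurable_sum.
  + move=> p _; rewrite lee_fin (bigD1 i)//= lerDl.
    by apply: sumr_ge0 => j _; exact: sqnorm_ge0.
- by apply/measurable_EFinP; exact: measurable_sum.
- by move=> p _; rewrite lee_fin sumr_ge0// => j _; exact: sqnorm_ge0.
Qed.

Let costate_affine i : svec Pr T (fun p => P p.1 *m xh i p.1 p.2 + K p.1 *m xbar p.1 + s p.1).
Proof.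
apply: svecD; last exact: (svec_det Pr cs).
apply: svecD; first exact: (svec_mulmx cP (feedback_state_svec i)).
by apply: (svec_det Pr (g := fun t => K t *m xbar t)); mx_cont.
Qed.

Lemma feedback_control_svec i : svec Pr T (proc (uh i)).
Proof. by apply: svecN; apply: svec_mulmxc. Qed.

Let v_svec i : svec Pr T (proc (v i)).
Proof. by apply: svecD => //; apply: svecN; exact: feedback_control_svec. Qed.

Let x_mvec i : mvec T (proc (x i)).
Proof. exact: (ito_mvec (x_state i)). Qed.

Let bu_mvec i : mvec T (proc (bu i)).
Proof.
apply: mvecD; last exact: svec_mvec (svec_det Pr cf).
apply: mvecD; last by apply: mvec_mulmxc; exact: mvec_mean.
by apply: mvecD; apply: mvec_mulmxc => //; exact: svec_mvec.
Qed.

(** Moments are not part of [is_state]; they follow from square integrability of the control, of the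
    initial states and of the martingales. *)
Let x_svec i : svec Pr T (proc (x i)).
Proof.
apply: (affine_family_sq (M := fun=> A) (G := G) (g := fun i p => B *m u i p.1 p.2 + f p.1)
  T_gt0 N_gt0 _ x_mvec (fun j => ito_source_svec (W_brownian j) (x0_meas j) ssigma
  (x_state j) (bu_mvec j) (fun k => initial_sqint x0_meas x0_L2 j k))) => //.
- exact: mx_continuous_cst.
- by move=> j; apply: svecD; [exact: svec_mulmxc|exact: (svec_det Pr cf)].
- by move=> j k; exact: (ito_sqint_path (x_state j)).
- move=> j k; apply: aeW => w; apply: aeW => t _; rewrite mxE /ito_martingale.
  have E t' : A *m x j t' w + G *m mean_field x t' w + (B *m u j t' w + f t') = bu j t' w.
    by rewrite /bu !addrA; congr (_ + _); rewrite addrAC.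
  under [X in _ - X = _]eq_Rintegral do rewrite E.
  by rewrite /bu; set I1 := Rintegral _ _ _; ring.
Qed.

Let y_svec i : svec Pr T (proc (y i)).
Proof. by apply: svecD => //; apply: svecN; exact: feedback_state_svec. Qed.

Let bu_svec i : svec Pr T (proc (bu i)).
Proof.
apply: svecD; last exact: (svec_det Pr cf).
apply: svecD; last by apply: svec_mulmxc; exact: svec_mean.
by apply: svecD; apply: svec_mulmxc.
Qed.

Let b_svec i : svec Pr T (proc (b i)).
Proof.
apply: svecD; last by apply: svec_mulmxc; exact: svec_mean.
by apply: svecD; apply: svec_mulmxc.
Qed.

Let mean_y t w : mean_field y t w = mean_field x t w - mean_field xh t w.
Proof. by rewrite /mean_field /y sumrB scalerBr. Qed.

Let driftB i t w : bu i t w - drift xh i t w = b i t w.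
Proof.
rewrite /bu /drift /b /v /uh mean_y /y.
apply: dot_inj => w'.
by rewrite !(mulmxDr, mulmxDl, mulmxN, mulNmx, opprK) !mulmxA !(dotDl, dotNl); ring.
Qed.

(** Both states are driven by the same noise from the same initial value, so the two sources
    [x0 + M] agree and cancel. *)
Let y_path_int i k : path_int Pr T (fun p => y i p.1 p.2 k 0) (fun=> 0)
  (fun p => b i p.1 p.2 k 0).
Proof.
have h1 : path_int Pr T (fun p => x i p.1 p.2 k 0)
    (fun p => x0 i p.2 k 0 + ito_martingale (x0 i) (bu i) (x i) k p.1 p.2)
    (fun p => bu i p.1 p.2 k 0).
  have := svec_path_integrable k (bu_svec i).
  apply: filterS => w Iw; split => //.
  apply: aeW => t _; rewrite /ito_martingale /=.
  by set I1 := Rintegral _ _ _; ring.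
(* The competitor's martingale is traded for that of the feedback state. *)
have h2 : path_int Pr T (fun p => x i p.1 p.2 k 0)
    (fun p => x0 i p.2 k 0 + M i k p.1 p.2) (fun p => bu i p.1 p.2 k 0).
  apply: path_int_congr h1 _.
  have := ito_martingale_indistinguishable (W_brownian i) (x0_meas i) ssigma k
    (x_state i) (xh_sde i) (bu_mvec i) (drift_mvec i).
  apply: filterS => w h.
  apply: (@filterS _ _ (ae_filter_ringOfSetsType leb) _ _ _ h) => t E tI.
  by rewrite /= opprD addrACA subrr add0r; exact: E.
have := path_intB h2 (feedback_path_int i k).
congr path_int; apply/funext => p.
- by rewrite /y !mxE.
- by rewrite subrr.
- by rewrite -driftB !mxE.
Qed.

Let mean_y_path_int k : path_int Pr T (fun p => mean_field y p.1 p.2 k 0) (fun=> 0)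
  (fun p => ((A + G) *m mean_field y p.1 p.2 + B *m mean_field v p.1 p.2) k 0).
Proof.
have := path_intZ N%:R^-1 (path_int_sum (index_enum 'I_N) (fun i => y_path_int i k)).
congr path_int; apply/funext => p.
- by rewrite /mean_field mxE summxE.
- by rewrite big1 ?mulr0.
- have -> : (A + G) *m mean_field y p.1 p.2 + B *m mean_field v p.1 p.2 =
      N%:R^-1 *: \sum_i b i p.1 p.2.
    have E (z : 'cV[R]_n) : N%:R^-1 *: (N%:R *: z) = z by rewrite scalerA mulVf// scale1r.
    rewrite /b !big_split/= -!mulmx_sumr sum_cst !scalerDr !scalemxAr E.
    rewrite -/(mean_field y p.1 p.2) -/(mean_field v p.1 p.2).
    by rewrite mulmxDl addrAC.
  by rewrite mxE summxE.
Qed.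

(** The mean of [y] solves a closed linear equation driven by the mean of [v], whose squared norm is
    at most the average of the squared norms: this is where [1 / N] comes from. *)
Lemma response_mean_sqnorm_le cA cB : 0 <= cA -> 0 <= cB ->
  (forall z, sqnorm ((A + G) *m z) <= cA * sqnorm z) ->
  (forall z, sqnorm (B *m z) <= cB * sqnorm z) ->
  (\int[mu]_(p in strip) (sqnorm (mean_field y p.1 p.2))%:E <=
   (gronwall_cst T (2 * cA) * (2 * cB) / N%:R)%:E *
   \int[mu]_(p in strip) (\sum_i sqnorm (v i p.1 p.2))%:E)%E.
Proof.
move=> cA0 cB0 bA bB; have mst := @measurable_strip d Omega R T.
have mv i : measurable_fun strip (fun p => sqnorm (v i p.1 p.2)).
  by apply: (mvec_sqnorm (z := proc (v i))); exact: svec_mvec.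
have mmv : measurable_fun strip (fun p => sqnorm (mean_field v p.1 p.2)).
  exact: (mvec_sqnorm (svec_mvec (svec_mean v_svec))).
have L0 : 0 <= 2 * cA by rewrite mulr_ge0.
have my : mvec T (proc (mean_field y)) by exact: svec_mvec (svec_mean y_svec).
apply: (le_trans (gronwall_vec (z := proc (mean_field y)) (c := fun=> 0)
  (b := fun p => (A + G) *m mean_field y p.1 p.2 + B *m mean_field v p.1 p.2)
  (gam := fun p => 2 * cB * sqnorm (mean_field v p.1 p.2)) T_gt0 L0 my _ _ _ _ _ _ _)).
- by move=> k; under eq_fun do rewrite mxE; exact: meas_proc0.
- apply: mvecD; apply: mvec_mulmxc => //.
  exact: svec_mvec (svec_mean v_svec).
- exact: measurable_funM.
- by move=> p; rewrite !mulr_ge0 ?sqnorm_ge0.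
- by move=> k; exact: (sqint_path (svec_mean y_svec k)).
- move=> k; have := mean_y_path_int k.
  by congr path_int; apply/funext => p; rewrite mxE.
- move=> p _; apply: (le_trans (sqnormD_le _ _)).
  by have := bA (mean_field y p.1 p.2); have := bB (mean_field v p.1 p.2); lra.
have -> : (\int[mu]_(p in strip) (sqnorm (0 : 'cV[R]_n))%:E = 0)%E.
  apply: integral0_eq => p _; congr EFin.
  by rewrite /sqnorm big1// => k _; rewrite mxE expr0n.
have : 0 <= gronwall_cst T (2 * cA) by exact: gronwall_cst_ge0.
move: (gronwall_cst T (2 * cA)) => gc gc0.
rewrite add0e -!mulrA [X in (_ <= X * _)%E]EFinM -muleA; apply: lee_wpmul2l => //.
have m2 : measurable_fun strip (fun p => (\sum_i sqnorm (v i p.1 p.2))%:E).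
  by apply/measurable_EFinP; exact: measurable_sum.
have p2 p : strip p -> (0 <= (\sum_i sqnorm (v i p.1 p.2))%:E)%E.
  by rewrite lee_fin sumr_ge0// => i _; exact: sqnorm_ge0.
have k0 : 0 <= 2 * (cB / N%:R) by rewrite mulr_ge0// mulr_ge0// invr_ge0.
rewrite -ge0_integralZl//; apply: ge0_le_integral => //.
- by move=> p _; rewrite lee_fin !mulr_ge0 ?sqnorm_ge0.
- by apply/measurable_EFinP; exact: measurable_funM.
- exact: measurable_funeM.
- move=> p _; rewrite -EFinM lee_fin -!mulrA ler_wpM2l// ler_wpM2l//.
  exact: sqnorm_mean_le.
Qed.

(** * Measurability for the joint past, and duality with the costate *)

Let past t m (z : Omega -> 'cV[R]_m) := vec (past_meas W x0 N t) z.
Let scalars : set (Omega -> R) := [set h | exists k, h = fun=> k].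

Let scalars_cst k : scalars (fun=> k). Proof. by exists k. Qed.

Let scalarsM t h g : scalars h -> past_meas W x0 N t g ->
  past_meas W x0 N t (fun w => h w * g w).
Proof. by move=> [k ->]; exact: past_measZ. Qed.

Let pastD t m (z z' : Omega -> 'cV[R]_m) : past t z -> past t z' ->
  past t (fun w => z w + z' w).
Proof. by apply: vecD; exact: past_measD. Qed.

Let pastN t m (z : Omega -> 'cV[R]_m) : past t z -> past t (fun w => - z w).
Proof. by apply: (vecN (@scalarsM t) scalars_cst). Qed.

Let past_cst t m (z : 'cV[R]_m) : past t (fun=> z).
Proof. by move=> k; exact: past_meas_cst. Qed.

Let past_mulmx t m k (L : 'M[R]_(m, k)) (z : Omega -> 'cV[R]_k) : past t z ->
  past t (fun w => L *m z w).
Proof.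
apply: (vec_mulmxc (C := scalars)) => //; [exact: past_meas_cst|exact: past_measD|exact: scalarsM].
Qed.

Let past_mean t m (z : 'I_N -> R -> Omega -> 'cV[R]_m) : (forall i, past t (z i t)) ->
  past t (mean_field z t).
Proof.
move=> pz; apply: (vecZ (@scalarsM t) scalars_cst).
by apply: vec_sum => //; [exact: past_meas_cst|exact: past_measD].
Qed.

Let xh_past i t : IT t -> past t (xh i t).
Proof. by move=> tI k; apply: (adapted_past_meas (T := T)) => //; exact: xh_adapted. Qed.

Let uh_past i t : IT t -> past t (uh i t).
Proof.
move=> tI; apply: pastN; apply: past_mulmx; apply: pastD; last exact: past_cst.
by apply: pastD; [apply: past_mulmx; exact: xh_past|exact: past_cst].
Qed.

Lemma feedback_control_adapted i : adapted T (joint_filtration x0 W N) (uh i).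
Proof. by apply: past_meas_adapted => t k tI; exact: (uh_past i tI k). Qed.

Let y_past i t : IT t -> past t (y i t).
Proof.
move=> tI; apply: pastD; last by apply: pastN; exact: xh_past.
by have [_ ax _ _] := x_state i; move=> k; apply: (adapted_past_meas (T := T)).
Qed.

Let v_past i t : IT t -> past t (v i t).
Proof.
move=> tI; apply: pastD; last by apply: pastN; exact: uh_past.
by have [_ au _] := u_L2; move=> k; apply: (adapted_past_meas (T := T)) => //; exact: au.
Qed.

Let b_past i t : IT t -> past t (b i t).
Proof.
move=> tI; apply: pastD; last by apply: past_mulmx; apply: past_mean => j; exact: y_past.
by apply: pastD; apply: past_mulmx; [exact: y_past|exact: v_past].
Qed.

(** At each [t] the combination [F t * b + F1 t * y] is measurable for the joint past, so it is
    enough that the increments of [MX] be orthogonal to past variables. That is left as a hypothesis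
    in order to cover both the states and the deterministic part of the costate. *)
Let dual (F F1 : R -> R) (X bX MX : U -> R) (X0 : Omega -> R) i l :
  prim T F F1 -> F T = 0 -> sqint mu strip X -> sqint mu strip bX -> sqint mu strip MX ->
  sqint Pr setT (fun w => MX (T, w)) ->
  (forall t w, IT t -> X (t, w) = X0 w + \int[leb]_(r in `[0, t]) bX (r, w) + MX (t, w)) ->
  (forall t xi, IT t -> sqint Pr setT xi -> past_meas W x0 N t xi ->
     \int[Pr]_w ((MX (T, w) - MX (t, w)) * xi w) = 0) ->
  \int[mu]_(p in strip) (X p * (F p.1 * b i p.1 p.2 l 0 + F1 p.1 * y i p.1 p.2 l 0)
     + bX p * (F p.1 * y i p.1 p.2 l 0)) = 0.
Proof.
move=> [[mF [c Fc]] [mF1 [c1 F1c]] FE] FT sX sbX sMX sMT XE orth.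
apply: (duality_process (b := fun p => b i p.1 p.2 l 0) (y := fun p => y i p.1 p.2 l 0)
  (M := MX) (X0 := X0) (c := `|c| + `|c1|) (ltW T_gt0)) => //.
- move=> t tI; apply: (le_trans (Fc t tI)); apply: (le_trans (ler_norm _)).
  by rewrite lerDl.
- move=> t tI; apply: (le_trans (F1c t tI)); apply: (le_trans (ler_norm _)).
  by rewrite lerDr.
- exact: y_svec.
- exact: b_svec.
- by apply: filterS (y_path_int i l) => w [_]; apply: filterS => t h /h; rewrite /= subr0.
- move=> t tI sbeta; apply: orth => //.
  by apply: past_measD; apply: past_measZ; [exact: (b_past i tI l)|exact: (y_past i tI l)].
Qed.

Let dual_integrable (F F1 : R -> R) (X bX : U -> R) i l : prim T F F1 ->
  sqint mu strip X -> sqint mu strip bX ->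
  mu.-integrable strip (EFin \o (fun p =>
    X p * (F p.1 * b i p.1 p.2 l 0 + F1 p.1 * y i p.1 p.2 l 0)
    + bX p * (F p.1 * y i p.1 p.2 l 0))).
Proof.
move=> [bF bF1 _] sX sbX; have mst := @measurable_strip d Omega R T.
have sh (h : R -> R) g : mbounded T h -> sqint mu strip g -> sqint mu strip (fun p => h p.1 * g p).
  by move=> bh sg; apply: (sq_procM (det_coefP _ bh) sg).
apply: (integrableD _ (sqint_mul mst sX _) (sqint_mul mst sbX _)) => //.
- apply: sqintD => //; apply: sh => //; [exact: (b_svec i l)|exact: (y_svec i l)].
- by apply: sh => //; exact: (y_svec i l).
Qed.

(* [expR (- rho t) * D i] is the drift of [expR (- rho t) <p_i, y_i>], where
   [p_i = P xhat_i + K xbar + s] is the costate. *)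
Let D i (p : U) : R :=
  dot (P p.1 *m xh i p.1 p.2 + (K p.1 *m xbar p.1 + s p.1)) (b i p.1 p.2) +
  dot ((Pd p.1 - rho *: P p.1) *m xh i p.1 p.2 + P p.1 *m drift xh i p.1 p.2
    + ((Kd p.1 *m xbar p.1 + K p.1 *m xbd p.1 + sd p.1)
       - rho *: (K p.1 *m xbar p.1 + s p.1))) (y i p.1 p.2).

Let Ph t := expR (- rho * t) *: P t.
Let Ph1 t := expR (- rho * t) *: (Pd t + (- rho) *: P t).
Let ch t := expR (- rho * t) *: (K t *m xbar t + s t).
Let ch1 t := expR (- rho * t) *: ((Kd t *m xbar t + K t *m xbd t + sd t)
  + (- rho) *: (K t *m xbar t + s t)).

Let pPh : mx_prim T Ph Ph1. Proof. exact: (mx_prim_expRZ (- rho) pP). Qed.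
Let pch : mx_prim T ch ch1.
Proof. exact: (mx_prim_expRZ (- rho) (mx_primD (mx_primM pK pxb) ps)). Qed.

Let DPk i l k (p : U) : R :=
  xh i p.1 p.2 k 0 * (Ph p.1 l k * b i p.1 p.2 l 0 + Ph1 p.1 l k * y i p.1 p.2 l 0)
  + drift xh i p.1 p.2 k 0 * (Ph p.1 l k * y i p.1 p.2 l 0).
Let Dc i l (p : U) : R :=
  1 * (ch p.1 l 0 * b i p.1 p.2 l 0 + ch1 p.1 l 0 * y i p.1 p.2 l 0)
  + 0 * (ch p.1 l 0 * y i p.1 p.2 l 0).

Let D_decomp i p : expR (- (rho * p.1)) * D i p = \sum_l (\sum_k DPk i l k p + Dc i l p).
Proof. by rewrite -mulNr; exact: costate_entries. Qed.

Let DPk_integrable i l k : mu.-integrable strip (EFin \o DPk i l k).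
Proof.
apply: (@dual_integrable _ _ (fun p => xh i p.1 p.2 k 0) (fun p => drift xh i p.1 p.2 k 0)
  i l (pPh l k)); [exact: feedback_state_svec|exact: feedback_drift_svec].
Qed.

Let Dc_integrable i l : mu.-integrable strip (EFin \o Dc i l).
Proof.
have mst := @measurable_strip d Omega R T.
apply: (@dual_integrable _ _ (fun=> 1) (fun=> 0) i l (pch l 0)); last exact: sqint0.
by apply: sqint_cst => //; exact: strip_measure_lty.
Qed.

Let DPk0 i l k : \int[mu]_(p in strip) DPk i l k p = 0.
Proof.
apply: (@dual (fun t => Ph t l k) (fun t => Ph1 t l k) (fun p => xh i p.1 p.2 k 0)
  (fun p => drift xh i p.1 p.2 k 0) (proc (M i k)) (fun w => x0 i w k 0) i l) => //.
- by rewrite /Ph P_T scaler0 mxE.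
- exact: feedback_state_svec.
- exact: feedback_drift_svec.
- exact: (ito_martingale_sq_proc (W_brownian i) (x0_meas i) ssigma (xh_sde i) (drift_mvec i)).
- apply: (ito_martingale_sqint (W_brownian i) (x0_meas i) ssigma (xh_sde i) (drift_mvec i)).
  by rewrite /= in_itv/= ltW//= lexx.
- by move=> t w tI; rewrite /M /ito_martingale /=; set I1 := Rintegral _ _ _; ring.
- move=> t xi tI sxi pxi.
  apply: (wiener_past_orth W_brownian W_indep x0_meas x0_W_indep (ssigma k)
    (ito_wiener (xh_sde i) k) tI _ _ sxi pxi).
  + exact: (ito_martingale_meas (x0_meas i) (xh_sde i) (drift_mvec i)).
  + apply: (ito_martingale_meas (x0_meas i) (xh_sde i) (drift_mvec i)).
    by rewrite /= in_itv/= ltW//= lexx.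
Qed.

Let Dc0 i l : \int[mu]_(p in strip) Dc i l p = 0.
Proof.
have mst := @measurable_strip d Omega R T.
have s0 : sqint mu strip (fun=> 0) by exact: sqint0.
(* The trivial process 1, without drift or noise, makes the deterministic [ch] an instance of
   duality; [ch] vanishes at [T] since [K] and [s] do. *)
apply: (@dual (fun t => ch t l 0) (fun t => ch1 t l 0) (fun=> 1) (fun=> 0) (fun=> 0)
  (fun=> 1) i l) => //.
- by rewrite /ch K_T s_T mul0mx addr0 scaler0 mxE.
- by apply: sqint_cst => //; exact: strip_measure_lty.
- exact: sqint0.
- by move=> t w tI; rewrite Rintegral_cst//= mul0r !addr0.
- move=> t xi _ _ _; under eq_Rintegral do rewrite subrr mul0r.
  by rewrite Rintegral_cst// mul0r.
Qed.

(** This places the feedback law among the competitors of the infimum; adaptedness is inherited from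
    [xh], the gains being deterministic. *)
Lemma feedback_admissible :
  L2_control Pr T (joint_filtration x0 W N) uh /\
  is_state Pr T A G B f sigma x0 W uh xh.
Proof.
have mst := @measurable_strip d Omega R T.
split; last first.
  move=> i; have driftU : drift xh i = fun t w => A *m xh i t w + B *m uh i t w
      + G *m mean_field xh t w + f t.
    apply/funext => t; apply/funext => w; rewrite /drift /uh; apply: dot_inj => w'.
    by rewrite !(mulmxDr, mulmxDl, mulmxN, mulNmx) !mulmxA !(dotDl, dotNl); ring.
  by have := xh_sde i; rewrite driftU.
split; [by move=> i; exact: svec_mvec (feedback_control_svec i)|exact: feedback_control_adapted|].
have mj j : measurable_fun strip (fun p => (sqnorm (uh j p.1 p.2))%:E).
  by apply/measurable_EFinP; exact: (mvec_sqnorm (svec_mvec (feedback_control_svec j))).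
have p0 j p : (0 <= (sqnorm (uh j p.1 p.2))%:E)%E by rewrite lee_fin sqnorm_ge0.
rewrite -(@strip_tonelli_omega _ _ _ Pr T (fun p => (\sum_(i < N) sqnorm (uh i p.1 p.2))%:E)).
- under eq_integral do rewrite -sumEFin.
  rewrite ge0_integral_sum//; apply: lte_sum_pinfty => i _.
  exact: (svec_sqnorm_lty (feedback_control_svec i)).
- by under eq_fun do rewrite -sumEFin; exact: emeasurable_sum.
- by move=> p _; rewrite lee_fin sumr_ge0// => i _; exact: sqnorm_ge0.
Qed.

Lemma feedback_cost_fin : social_cost Pr T rho Gam Q Rw eta xh uh \is a fin_num.
Proof.
rewrite (social_cost_strip (fun i => svec_mvec (feedback_state_svec i))
  (fun i => svec_mvec (feedback_control_svec i))).
apply: integrable_fin_num; first exact: measurable_strip.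
exact: (cost_integrable feedback_state_svec feedback_control_svec).
Qed.

Let ED i (p : U) := expR (- (rho * p.1)) * D i p.

Let ED_sum : mu.-integrable strip (EFin \o (fun p => \sum_i ED i p)) /\
  \int[mu]_(p in strip) (\sum_i ED i p) = 0.
Proof.
have mst := @measurable_strip d Omega R T.
have Ik i l := @Rintegral_sum _ _ _ mu strip _ (index_enum 'I_n) _ mst
  (fun k _ => DPk_integrable i l k).
have Il i l : mu.-integrable strip (EFin \o (fun p => \sum_k DPk i l k p + Dc i l p)).
  exact: (integrableD _ (Ik i l).1 (Dc_integrable i l)).
have Ii i := @Rintegral_sum _ _ _ mu strip _ (index_enum 'I_n) _ mst (fun l _ => Il i l).
have := @Rintegral_sum _ _ _ mu strip _ (index_enum 'I_N) _ mst (fun i _ => (Ii i).1).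
have -> : (fun p => \sum_i ED i p) = (fun p => \sum_i \sum_l (\sum_k DPk i l k p + Dc i l p)).
  by apply/funext => p; apply: eq_bigr => i _; exact: D_decomp.
move=> [J E]; split => //; rewrite E big1// => i _.
rewrite (Ii i).2 big1// => l _.
rewrite (RintegralD _ (Ik i l).1 (Dc_integrable i l))// Dc0 addr0 (Ik i l).2.
by rewrite big1// => k _; exact: DPk0.
Qed.

(** * Lower bound for the competitor's cost *)

Let Lam t := P t *m G + G^T *m P t - Q_Gamma Gam Q.

Let PdE t : rho *: P t = Pd t + A^T *m P t + P t *m A
  - P t *m B *m invmx Rw *m B^T *m P t + Q.
Proof.
rewrite /Pd; apply/matrixP => k l.
move: (A^T *m P t) (P t *m A) (P t *m B *m _ *m _ *m _) => M1 M2 M3.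
by rewrite !mxE; ring.
Qed.

Let KdE t : rho *: K t = Kd t + (A + G)^T *m K t + K t *m (A + G)
  - P t *m B *m invmx Rw *m B^T *m K t - K t *m B *m invmx Rw *m B^T *m P t
  + G^T *m P t + P t *m G - K t *m B *m invmx Rw *m B^T *m K t - Q_Gamma Gam Q.
Proof.
rewrite /Kd; apply/matrixP => k l.
move: (_^T *m K t) (K t *m (A + G)) (P t *m B *m _ *m _ *m K t)
  (K t *m B *m _ *m _ *m P t) (G^T *m P t) (P t *m G) (K t *m B *m _ *m _ *m K t)
  (Q_Gamma Gam Q) => M1 M2 M3 M4 M5 M6 M7 M8.
by rewrite !mxE; ring.
Qed.

Let sdE t : rho *: s t = sd t + (A + G - S *m (P t + K t))^T *m s t
  + (P t + K t) *m f t - eta_bar Gam Q eta.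
Proof.
rewrite /sd; apply/matrixP => k l.
move: (_^T *m s t) ((P t + K t) *m f t) (eta_bar _ _ _) => M1 M2 M3.
by rewrite !mxE; ring.
Qed.

(** Up to the discount, the cross term is [2 X], and the algebraic identity gives [X = N Z - Y],
    where the discounted [Y] has zero mean; Young's inequality treats [N Z]. The discount is bounded
    by 1 on the term that is lost and by its terminal value on the term that is gained. *)
Lemma cost_pointwise_ge (lam cL del : R) (p : U) : 0 < lam -> 0 < del -> 0 <= cL ->
  (forall z, lam * sqnorm z <= quad Rw z) ->
  (forall t z, IT t -> sqnorm (Lam t *m z) <= cL * sqnorm z) -> strip p ->
  cost xh uh p - 2 * (\sum_i ED i p)
  - N%:R * (del * sqnorm (mean_field y p.1 p.2) + del^-1 * cL * sqnorm (dev p))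
  + expR (- (rho * T)) * lam * \sum_i sqnorm (v i p.1 p.2) <= cost x u p.
Proof.
move=> lam0 del0 cL0 Rlam LamL [pI _].
have [t0 tT] : 0 <= p.1 /\ p.1 <= T by move: pI; rewrite /= in_itv/= => /andP[].
have e0 := expR_gt0 (- (rho * p.1)); set e := expR (- (rho * p.1)) in e0 *.
have e1 : e <= 1 by rewrite /e -expR0 ler_expR oppr_le0 mulr_ge0// ltW.
have eT : expR (- (rho * T)) <= e by rewrite /e ler_expR lerN2 ler_wpM2l// ltW.
have eTp := expR_gt0 (- (rho * T)).
have := cross_term_identity Rw_sym (pd_unitmx Rw_pd) (P_sym pI) (K_sym pI)
  (PdE p.1) (KdE p.1) (sdE p.1) (erefl (xbd p.1)) (fun i => xh i p.1 p.2)
  (fun i => y i p.1 p.2) (fun i => v i p.1 p.2) N_gt0.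
set X := \sum_i (dot _ _ + dot _ _); set Y := \sum_i _; set Z := dot _ _ => XYZ.
have YE : \sum_i ED i p = e * Y by rewrite mulr_sumr.
have costE : cost x u p = cost xh uh p + e * (2 * X) + e * \sum_i
    (quad Q (y i p.1 p.2 - Gam *m mean_field y p.1 p.2) + quad Rw (v i p.1 p.2)).
  rewrite /cost -/e -!mulrDr; congr (_ * _); rewrite mulr_sumr -!big_split/=.
  apply: eq_bigr => i _.
  have -> : x i p.1 p.2 - Gam *m mean_field x p.1 p.2 - eta =
      (xh i p.1 p.2 - Gam *m mean_field xh p.1 p.2 - eta) +
      (y i p.1 p.2 - Gam *m mean_field y p.1 p.2).
    apply: dot_inj => w; rewrite mean_y /y mulmxDr mulmxN !(dotDl, dotNl); ring.
  have -> : u i p.1 p.2 = uh i p.1 p.2 + v i p.1 p.2 by rewrite /v addrC subrK.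
  by rewrite !quadD// /uh; ring.
have V1 : lam * \sum_i sqnorm (v i p.1 p.2) <= \sum_i
    (quad Q (y i p.1 p.2 - Gam *m mean_field y p.1 p.2) + quad Rw (v i p.1 p.2)).
  rewrite mulr_sumr; apply: ler_sum => i _; apply: le_trans (Rlam _) _.
  by rewrite lerDr; exact: Q_psd.
have Young : - (del^-1 * (cL * sqnorm (dev p)) + del * sqnorm (mean_field y p.1 p.2)) <= 2 * Z.
  apply: le_trans (dot_Young _ _ del0); rewrite lerN2 lerD2r.
  by rewrite ler_wpM2l ?invr_ge0 ?(ltW del0)//; exact: LamL.
set q := \sum_i (quad Q _ + quad Rw _) in costE V1 *.
set sv := \sum_i sqnorm _ in V1 *.
have sv0 : 0 <= sv by apply: sumr_ge0 => i _; exact: sqnorm_ge0.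
rewrite costE YE.
have XE : X = N%:R * Z - Y by rewrite -XYZ addrK.
rewrite XE.
set yy := del^-1 * (cL * sqnorm (dev p)) + del * sqnorm (mean_field y p.1 p.2) in Young.
have yy0 : 0 <= yy.
  by rewrite addr_ge0// !mulr_ge0 ?invr_ge0 ?(ltW del0) ?sqnorm_ge0.
have -> : del * sqnorm (mean_field y p.1 p.2) + del^-1 * cL * sqnorm (dev p) = yy.
  by rewrite /yy addrC mulrA.
have h1 : - (N%:R * yy) <= e * N%:R * (2 * Z).
  apply: (@le_trans _ _ (e * N%:R * (- yy))).
    rewrite mulrN lerN2 -mulrA; apply: ler_piMl => //.
    by rewrite mulr_ge0.
  by rewrite ler_wpM2l// mulr_ge0// ltW.
have h2 : expR (- (rho * T)) * lam * sv <= e * q.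
  apply: (@le_trans _ _ (e * (lam * sv))).
    by rewrite -mulrA ler_wpM2r// mulr_ge0// ltW.
  by rewrite ler_wpM2l// ltW.
have -> : cost xh uh p + e * (2 * (N%:R * Z - Y)) + e * q =
  cost xh uh p - 2 * (e * Y) + e * N%:R * (2 * Z) + e * q by ring.
by apply: lerD => //; apply: lerD.
Qed.

Let Rint (g : U -> R) := \int[mu]_(p in strip) g p.

(** Integration removes the costate term from the pointwise bound. The factor [N] meets [C1 / N] in
    one term of Young's inequality and [C2 / N] in the other: by the condition on [del], the
    coercive term in [v] absorbs the first, and the second is the additive constant. *)
Lemma social_cost_ge (lam cL del cA cB cD : R) :
  0 < lam -> 0 < del -> 0 <= cL -> 0 <= cA -> 0 <= cB -> 0 <= cD ->
  (forall z, lam * sqnorm z <= quad Rw z) ->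
  (forall t z, IT t -> sqnorm (Lam t *m z) <= cL * sqnorm z) ->
  (forall z, sqnorm ((A + G) *m z) <= cA * sqnorm z) ->
  (forall z, sqnorm (B *m z) <= cB * sqnorm z) ->
  (forall t z, IT t -> sqnorm ((A + G - S *m P t) *m z) <= cD * sqnorm z) ->
  del * (gronwall_cst T (2 * cA) * (2 * cB)) <= expR (- (rho * T)) * lam ->
  (social_cost Pr T rho Gam Q Rw eta xh uh <=
   social_cost Pr T rho Gam Q Rw eta x u + (del^-1 * cL *
     (gronwall_cst T cD * (T * (\sum_k (4 * (C0 + xbar0 k 0 ^+ 2) + 2 * csig k)))))%:E)%E.
Proof.
move=> lam0 del0 cL0 cA0 cB0 cD0 Rlam LamL bA bB bD delle.
have mst := @measurable_strip d Omega R T.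
rewrite (social_cost_strip (fun i => svec_mvec (feedback_state_svec i))
  (fun i => svec_mvec (feedback_control_svec i))).
rewrite (social_cost_strip (fun i => svec_mvec (x_svec i)) (fun i => svec_mvec (u_svec i))).
have EI g : mu.-integrable strip (EFin \o g) ->
    (\int[mu]_(p in strip) (g p)%:E = (Rint g)%:E)%E.
  by move=> Ig; rewrite /Rint /Rintegral fineK//; exact: integrable_fin_num Ig.
have Isq m (z : U -> 'cV[R]_m) : svec Pr T z ->
    mu.-integrable strip (EFin \o (fun p => sqnorm (z p))).
  move=> sz; have := dot_integrable sz sz.
  by congr (mu.-integrable strip); apply/funext => p /=; rewrite dot_sqnorm.
have Ih := cost_integrable feedback_state_svec feedback_control_svec.
have Iu := cost_integrable x_svec u_svec.
have [ID ED0] := ED_sum.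
have Iy := Isq _ _ (svec_mean y_svec).
have Ie := Isq _ _ dev_svec.
have [Iv _] := @Rintegral_sum _ _ _ mu strip _ (index_enum 'I_N) _ mst
  (fun i _ => Isq _ _ (v_svec i)).
have bY := response_mean_sqnorm_le cA0 cB0 bA bB.
have bE := deviation_sqnorm_le cD0 bD.
rewrite (EI _ Iy) (EI _ Iv) -EFinM lee_fin in bY.
rewrite (EI _ Ie) lee_fin in bE.
rewrite (EI _ Ih) (EI _ Iu) -EFinD lee_fin.
set C1 := gronwall_cst T (2 * cA) * (2 * cB) in delle bY *.
set C2 := gronwall_cst T cD * _ in bE *.
set eT := expR (- (rho * T)) in delle *.
pose y_ := fun p : U => sqnorm (mean_field y p.1 p.2).
pose e_ := fun p : U => sqnorm (dev p).
pose v_ := fun p : U => \sum_i sqnorm (v i p.1 p.2).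
pose d_ := fun p : U => \sum_i ED i p.
have I1 : mu.-integrable strip (EFin \o (fun p => cost xh uh p + (- 2) * d_ p)).
  exact: (integrableD _ Ih (integrableZl _ (- 2) ID)).
have I2 : mu.-integrable strip (EFin \o (fun p => - (N%:R * del) * y_ p
    + - (N%:R * (del^-1 * cL)) * e_ p)).
  exact: (integrableD _ (integrableZl _ (- (N%:R * del)) Iy)
    (integrableZl _ (- (N%:R * (del^-1 * cL))) Ie)).
have I3 : mu.-integrable strip (EFin \o (fun p => eT * lam * v_ p)).
  exact: (integrableZl _ (eT * lam) Iv).
have I12 := integrableD mst I1 I2.
have main : Rint (fun p => (cost xh uh p + (- 2) * d_ p) + (- (N%:R * del) * y_ p
    + - (N%:R * (del^-1 * cL)) * e_ p) + eT * lam * v_ p) <= Rint (cost x u).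
  apply: le_Rintegral => //.
    exact: (integrableD _ I12 I3).
  move=> p pS; apply: le_trans (cost_pointwise_ge lam0 del0 cL0 Rlam LamL pS).
  by rewrite le_eqVlt; apply/orP; left; apply/eqP; rewrite /y_ /e_ /v_ /d_ /eT; ring.
move: main; rewrite /Rint (RintegralD _ I12 I3)// (RintegralD _ I1 I2)//.
rewrite (RintegralD _ Ih (integrableZl _ (- 2) ID))//.
rewrite (RintegralD _ (integrableZl _ (- (N%:R * del)) Iy)
    (integrableZl _ (- (N%:R * (del^-1 * cL))) Ie))//.
rewrite !RintegralZl// ED0 mulr0 addr0 -/(Rint _) -/(Rint (cost x u)) -/(Rint y_)
  -/(Rint e_) -/(Rint v_) => main.
have v0 : 0 <= Rint v_.
  by apply: Rintegral_ge0 => p _; apply: sumr_ge0 => i _; exact: sqnorm_ge0.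
have NN : N%:R * N%:R^-1 = 1 :> R by rewrite mulfV.
have hY : N%:R * del * Rint y_ <= eT * lam * Rint v_.
  apply: (@le_trans _ _ (N%:R * del * (C1 / N%:R * Rint v_))).
    by rewrite ler_wpM2l// mulr_ge0// ltW.
  have -> : N%:R * del * (C1 / N%:R * Rint v_) = N%:R * N%:R^-1 * (del * C1 * Rint v_) by ring.
  by rewrite NN mul1r ler_wpM2r.
have hE : N%:R * (del^-1 * cL) * Rint e_ <= del^-1 * cL * C2.
  apply: (@le_trans _ _ (N%:R * (del^-1 * cL) * (C2 / N%:R))).
    by rewrite ler_wpM2l// !mulr_ge0// invr_ge0 ltW.
  have -> : N%:R * (del^-1 * cL) * (C2 / N%:R) = N%:R * N%:R^-1 * (del^-1 * cL * C2) by ring.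
  by rewrite NN mul1r.
move: main; rewrite !mulNr; lra.
Qed.

End competitor.

End feedback.


(** The constant is quantified before [N]: all its ingredients, Young's parameter included, depend
    on the coefficients, the horizon and the bounds on the data alone. *)
Lemma feedback_near_optimal : exists2 C : R, 0 <= C &
  forall (N : nat) (xh : 'I_N -> R -> Omega -> 'cV[R]_n), (0 < N)%N ->
  (forall i : 'I_N, ito_solution Pr T (joint_filtration x0 W N) (W i) (x0 i)
     (drift xh i) sigma (xh i)) ->
  let uh (i : 'I_N) t w := - (invmx Rw *m B^T *m (P t *m xh i t w + K t *m xbar t + s t)) in
  [/\ L2_control Pr T (joint_filtration x0 W N) uh,
      is_state Pr T A G B f sigma x0 W uh xh,
      social_cost Pr T rho Gam Q Rw eta xh uh \is a fin_num &
      forall (u : 'I_N -> R -> Omega -> 'cV[R]_r) (x : 'I_N -> R -> Omega -> 'cV[R]_n),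
        L2_control Pr T (joint_filtration x0 W N) u ->
        is_state Pr T A G B f sigma x0 W u x ->
        (social_cost Pr T rho Gam Q Rw eta xh uh <=
         social_cost Pr T rho Gam Q Rw eta x u + C%:E)%E].
Proof.
have [lam lam0 Rlam] := pd_coercive Rw_sym Rw_pd.
have cLam : mx_continuous T (fun t => P t *m G + G^T *m P t - Q_Gamma Gam Q) by mx_cont.
have cD : mx_continuous T (fun t => A + G - S *m P t) by mx_cont.
have [cL cL0 bL] := mx_continuous_bound cLam.
have [cA cA0 bA] := mx_bound T_gt0 (A + G).
have [cB cB0 bB] := mx_bound T_gt0 B.
have [c c0 bD] := mx_continuous_bound cD.
pose C1 := gronwall_cst T (2 * cA) * (2 * cB).
have C10 : 0 <= C1.
  by apply: mulr_ge0; [apply: gronwall_cst_ge0 => //; exact: ltW|exact: mulr_ge0].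
pose eT := expR (- (rho * T)).
have eT0 : 0 < eT by exact: expR_gt0.
(* Small enough for [del * C1 <= eT * lam]; the 1 guards against [C1 = 0]. *)
pose del := eT * lam / (C1 + 1).
have del0 : 0 < del by rewrite divr_gt0 ?mulr_gt0// ltr_wpDl.
have delC1 : del * C1 <= eT * lam.
  rewrite /del mulrAC ler_pdivrMr ?ltr_wpDl// ler_wpM2l ?lerDl//.
  by rewrite mulr_ge0// ltW.
pose C := del^-1 * cL * (gronwall_cst T c * (T * (\sum_k (4 * (C0 + xbar0 k 0 ^+ 2) +
  2 * (4 * normal_var R * \int[leb]_(t in IT) (sigma t k 0 ^+ 2)))))).
(* The absolute value stands in for a proof that [C] is nonnegative. *)
exists `|C|; first exact: normr_ge0.
move=> N xh N0 sde uh.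
have xa (i : 'I_N) : adapted T (joint_filtration x0 W N) (xh i) by have [_ ax _ _] := sde i.
have [adm st] := feedback_admissible N0 sde xa.
split; [exact: adm|exact: st|exact: feedback_cost_fin|move=> u x uL2 xst].
apply: (le_trans (social_cost_ge N0 sde uL2 xst xa lam0 del0 cL0 cA0 cB0 c0 Rlam bL bA bB bD delC1)).
by apply: leeD; [exact: lexx|rewrite lee_fin; exact: ler_norm].
Qed.

End closed_loop.

Theorem mainTheorem3 (R : realType) (d : measure_display)
    (Omega : measurableType d) (Pr : probability Omega R) (n r : nat)
    (T rho : R) (T_gt0 : 0 < T) (rho_gt0 : 0 < rho)
    (A G Gam Q : 'M[R]_n) (B : 'M[R]_(n, r)) (Rw : 'M[R]_r) (eta : 'cV[R]_n)
    (Q_sym : sym_mx Q) (Rw_sym : sym_mx Rw) (Rw_pd : pd_mx Rw)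
    (f sigma : R -> 'cV[R]_n)
    (f_cont : {within `[0, +oo[, continuous f})
    (sigma_cont : {within `[0, +oo[, continuous sigma})
    (f_sigma_L2 : (\int[lebesgue_measure]_(t in `[0%R, +oo[)
       (expR (- (rho * t)) * (sqnorm (f t) + sqnorm (sigma t)))%:E < +oo)%E)
    (W : nat -> R -> Omega -> R) (x0 : nat -> Omega -> 'cV[R]_n)
    (W_brownian : forall i, brownian_motion Pr (W i))
    (W_indep : mutual_indep Pr
       (fun i => sigma_gen [set W i t | t in `[0, +oo[]))
    (x0_meas : forall i k, measurable_fun setT (fun w => x0 i w k 0))
    (x0_indep : mutual_indep Pr (fun i => sigma_gen (coords (x0 i))))
    (xbar0 : 'cV[R]_n)
    (x0_mean : forall i k, ('E_Pr[fun w => x0 i w k 0%R])%E = (xbar0 k 0)%:E)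
    (C0 : R)
    (x0_L2 : forall i, (\int[Pr]_w (sqnorm (x0 i w))%:E < C0%:E)%E)
    (x0_W_indep : indep2 Pr
       (sigma_gen (\bigcup_i coords (x0 i)))
       (sigma_gen (\bigcup_i [set W i t | t in `[0, +oo[])))
    (Q_psd : psd_mx Q)
    (P K : R -> 'M[R]_n) (s xbar : R -> 'cV[R]_n)
    (P_cont : {within `[0, T], continuous P})
    (P_eq : forall t, t \in `]0, T[ -> derivable P t 1 /\
       rho *: P t = derive1 P t + A^T *m P t + P t *m A
         - P t *m B *m invmx Rw *m B^T *m P t + Q)
    (P_T : P T = 0)
    (K_cont : {within `[0, T], continuous K})
    (K_eq : forall t, t \in `]0, T[ -> derivable K t 1 /\
       rho *: K t = derive1 K t + (A + G)^T *m K t + K t *m (A + G)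
         - P t *m B *m invmx Rw *m B^T *m K t
         - K t *m B *m invmx Rw *m B^T *m P t
         + G^T *m P t + P t *m G
         - K t *m B *m invmx Rw *m B^T *m K t - Q_Gamma Gam Q)
    (K_T : K T = 0)
    (s_cont : {within `[0, T], continuous s})
    (s_eq : forall t, t \in `]0, T[ -> derivable s t 1 /\
       rho *: s t = derive1 s t
         + (A + G - B *m invmx Rw *m B^T *m (P t + K t))^T *m s t
         + (P t + K t) *m f t - eta_bar Gam Q eta)
    (s_T : s T = 0)
    (xbar_cont : {within `[0, T], continuous xbar})
    (xbar_eq : forall t, t \in `]0, T[ -> derivable xbar t 1 /\
       derive1 xbar t = (A + G) *m xbar t
         - B *m invmx Rw *m B^T *m ((P t + K t) *m xbar t + s t) + f t)
    (xbar_0 : xbar 0 = xbar0)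
    (xhat : forall N : nat, 'I_N -> R -> Omega -> 'cV[R]_n)
    (uhat : forall N : nat, 'I_N -> R -> Omega -> 'cV[R]_r)
    (uhat_def : forall (N : nat) (i : 'I_N) (t : R) (w : Omega),
       uhat N i t w = - (invmx Rw *m B^T *m
         (P t *m xhat N i t w + K t *m xbar t + s t)))
    (xhat_sde : forall (N : nat) (i : 'I_N),
       ito_solution Pr T (joint_filtration x0 W N) (W i) (x0 i)
         (fun t w => (A - B *m invmx Rw *m B^T *m P t) *m xhat N i t w
            - B *m invmx Rw *m B^T *m (K t *m xbar t + s t)
            + G *m mean_field (xhat N) t w + f t)
         sigma (xhat N i)) :
  exists (C : R) (N0 : nat), forall N : nat, (0 < N)%N -> (N0 <= N)%N ->
    (`| (N%:R^-1)%:E * social_cost Pr T rho Gam Q Rw eta (xhat N) (uhat N)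
        - (N%:R^-1)%:E
          * social_optimum Pr T rho A G Gam Q B Rw eta f sigma x0 W N |
     <= (C / Num.sqrt N%:R)%:E)%E.

Proof.
have [C C_ge0 opt] := feedback_near_optimal T_gt0 rho_gt0 Q_sym Rw_sym Rw_pd f_cont
  sigma_cont W_brownian W_indep x0_meas x0_indep x0_mean x0_L2 x0_W_indep Q_psd
  P_cont P_eq P_T K_cont K_eq K_T s_cont s_eq s_T xbar_cont xbar_eq xbar_0.
(* The bound holds for every positive [N], so the threshold can be 0. *)
exists C, 0%N => N N0 _.
have [] := opt N (xhat N) N0 (@xhat_sde N).
have -> : (fun (i : 'I_N) t w => - (invmx Rw *m B^T *m
    (P t *m xhat N i t w + K t *m xbar t + s t))) = uhat N.
  by apply/funext => i; apply/funext => t; apply/funext => w; rewrite uhat_def.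
set J := social_cost Pr T rho Gam Q Rw eta (xhat N) (uhat N).
set V := social_optimum Pr T rho A G Gam Q B Rw eta f sigma x0 W N.
move=> adm st Jfin Jle.
have VJ : (V <= J)%E by apply: ereal_inf_lbound; exists (uhat N), (xhat N).
have JV : (J - C%:E <= V)%E.
  apply: le_ereal_inf_tmp => _ [u [x [uL2 xst ->]]].
  by rewrite leeBlDr//; exact: Jle.
(* Squeezed between two real numbers, the infimum is itself real. *)
move: Jfin VJ JV {Jle}; case: J => // j _; case: V => [v||]//=.
rewrite -EFinB !lee_fin => vj jv.
have N0' : 0 < N%:R :> R by rewrite ltr0n.
have i0 : 0 <= N%:R^-1 :> R by rewrite invr_ge0 ltW.
have d0 : 0 <= j - v by rewrite subr_ge0.
rewrite -mulrBr normrM (ger0_norm i0) (ger0_norm d0).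
(* The gap is at most [C / N], which [sqrt N <= N] for [N >= 1] weakens to the rate claimed. *)
apply: (@le_trans _ _ (C / N%:R)).
  by rewrite mulrC ler_pM2r ?invr_gt0// lerBlDl -lerBlDr.
apply: ler_wpM2l => //; rewrite lef_pV2 ?posrE ?sqrtr_gt0//.
rewrite -{2}(sqr_sqrtr (ltW N0')) expr2 ler_peMl ?sqrtr_ge0//.
by rewrite -{1}sqrtr1 ler_wsqrtr// ler1n.
Qed.
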